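(* Let $G$ be a locally compact abelian group, let $1<p,q,r<\infty$, let $\vartheta_0,\vartheta_1$ be Beurling weights on $G$ and $\vartheta_2$ a Beurling weight on the dual group $\widehat G$. If $\vartheta_1\prec\vartheta_0$, then $A^{p,1,q,r}_{\vartheta_1,\vartheta_2}(G)$ is a Banach $L^1_{\vartheta_0}(G)$-module (under convolution) with respect to $\|\cdot\|^{p,1,q,r}_{\vartheta_1,\vartheta_2}$.
   Context: A Beurling weight on a locally compact abelian group $G$ is a measurable, locally integrable function $\vartheta:G\to(0,\infty)$ with $\vartheta(x)\ge 1$ and $\vartheta(x+y)\le\vartheta(x)\vartheta(y)$ for all $x,y\in G$. $\vartheta\prec\vartheta'$ means there is $C>0$ with $\vartheta(x)\le C\vartheta'(x)$ for all $x$. $L^1_\vartheta(G)=\{f:f\vartheta\in L^1(G)\}$ with norm $\|f\|_{1,\vartheta}=\|f\vartheta\|_1$ is a Banach algebra under convolution. For a Banach algebra $A$, a Banach space $B$ is a Banach $A$-module if there is a bilinear operation $\cdot:A\times B\to B$ with $(f\cdot g)\cdot h=f\cdot(g\cdot h)$ for $f,g\in A$, $h\in B$, and $\|f\cdot h\|_B\le C\|f\|_A\|h\|_B$ for some constant $C\ge1$ and all $f\in A$, $h\in B$. Amalgam spaces: by the structure theorem write $G=\mathbb R^a\times G_1$ with $a\ge 0$ an integer and $G_1$ a locally compact abelian group containing an open compact subgroup $H$. Put $I=[0,1)^a\times H$, $J=\mathbb Z^a\times T$ with $T$ a transversal of $H$ in $G_1$ (so $G_1=\bigcup_{t\in T}(t+H)$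 is a coset decomposition), and $I_\alpha=\alpha+I$ for $\alpha\in J$; $G$ is the disjoint union of the $I_\alpha$, and Haar measure is normalized so that $I$ has measure $1$. For $1\le p,q<\infty$ let $\|f\|_{pq}=\big(\sum_{\alpha\in J}\|f\|_{L^p(I_\alpha)}^q\big)^{1/q}$. For a weight $\vartheta$, $(L^p_\vartheta,\ell^q)$ is the space of $f\in L^p_{loc}(G)$ (mod a.e. equality) with $\|f\|_{pq,\vartheta}:=\|f\vartheta\|_{pq}<\infty$. The same definitions are used on $\widehat G$. $\widehat f(\gamma)=\int_G f(x)\overline{\langle x,\gamma\rangle}\,dx$ is the Fourier transform (well defined since $(L^p_{\vartheta_1},\ell^1)\subset L^1(G)$). Define $A^{p,1,q,r}_{\vartheta_1,\vartheta_2}(G)=\{f\in(L^p_{\vartheta_1},\ell^1):\widehat f\in(L^q_{\vartheta_2},\ell^r)\}$, the second space being taken on $\widehat G$, with norm $\|f\|^{p,1,q,r}_{\vartheta_1,\vartheta_2}=\|f\|_{p1,\vartheta_1}+\|\widehat f\|_{qr,\vartheta_2}$. *)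

(* Defs.v *)
From HB Require Import structures.
From mathcomp Require Import all_boot all_order all_algebra generic_quotient.
From mathcomp Require Import ring_quotient complex.
From mathcomp Require Import all_classical all_reals all_analysis.

Set Implicit Arguments.
Unset Strict Implicit.
Unset Printing Implicit Defensive.
Import Order.TTheory GRing.Theory Num.Theory.
Import numFieldNormedType.Exports.

Local Open Scope classical_set_scope.
Local Open Scope quotient_scope.
Local Open Scope ring_scope.

(* [Normc.normc] is the modulus with values in [R]; the generic norm [`|z|] of
   [R[i]] has values in [R[i]] itself. *)
Definition cabs (R : realType) (z : R[i]) : R := Normc.normc z.

(* The bare join of abelian group and topological space.  It is enough for the
   definitions below and covers both a [topologicalZmodType] and its dual. *)
Notation preTopologicalZmodType := PreTopologicalZmodule.type.

Definition lca (G : topologicalZmodType) : Prop :=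
  hausdorff_space G /\ locally_compact [set: G].

Section Borel.
Variable G : preTopologicalZmodType.

(* [g_sigma_algebraType] asks for a pointed type, hence this alias. *)
Definition pointed_at0 : Type := G.
HB.instance Definition _ := Choice.on pointed_at0.
HB.instance Definition _ := isPointed.Build pointed_at0 (0 : G).

Definition borel : Type :=
  @g_sigma_algebraType pointed_at0 (@open G : set (set pointed_at0)).
HB.instance Definition _ := Measurable.on borel.
End Borel.

Section HaarMeasure.
Variables (R : realType) (G : preTopologicalZmodType).
Variable mu : {measure set (borel G) -> \bar R}.

(* Haar measure, in the convention where every Borel set is inner regular.
   With the other usual convention (outer regular on Borel sets) a locally null
   Borel set of a group that is not sigma-compact may have infinite measure;
   the two measures have the same integrable functions up to null sets, but
   only with the present one is "locally null" the same as "null", so that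
   spaces of locally integrable functions can be taken modulo a.e. equality. *)
Definition haar_measure : Prop :=
  [/\ mu [set: G] != 0%E,
      forall (x : G) (A : set (borel G)), measurable A ->
        mu [set (x + a : G) | a in A] = mu A,
      forall K : set G, compact K -> (mu K < +oo)%E &
      forall A : set (borel G), measurable A ->
        mu A = ereal_sup [set mu K | K in [set K : set G | compact K /\ K `<=` A]]].

Definition beurling_weight (w : G -> R) : Prop :=
  [/\ measurable_fun [set: borel G] (w : borel G -> R),
      forall K : set G, compact K -> mu.-integrable K (EFin \o w),
      forall x, 0 < w x,
      forall x, 1 <= w x &
      forall x y, w (x + y) <= w x * w y].
End HaarMeasure.

Definition weight_le (R : realType) (T : Type) (w w' : T -> R) : Prop :=
  exists2 C : R, 0 < C & forall x, w x <= C * w' x.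

(* [R[i]^o] is [R[i]] with the topology of its modulus. *)
Definition is_character (R : realType) (G : preTopologicalZmodType)
    (chi : G -> R[i]) : Prop :=
  [/\ forall x y, chi (x + y) = chi x * chi y,
      forall x, cabs (chi x) = 1 &
      continuous (chi : G -> R[i]^o)].

Record dual (R : realType) (G : preTopologicalZmodType) := Dual {
  chr :> G -> R[i];
  chrP : is_character chr }.

Section DualGroup.
Variables (R : realType) (G : topologicalZmodType).
Local Notation dualG := (dual R G).

Lemma dual_eq (chi psi : dualG) : (chi : G -> R[i]) =1 psi -> chi = psi.
Proof.
case: chi psi => [f fP] [g gP] /= /funext fg.
by case: _ / fg gP => gP; congr Dual; exact: Prop_irrelevance.
Qed.

Lemma cabs_char_neq0 (chi : dualG) x : chi x != 0.
Proof.
case: (chrP chi) => _ /(_ x) + _; apply: contra_eq_neq => ->.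
by rewrite /cabs Normc.normc0 eq_sym oner_neq0.
Qed.

Lemma char0 (chi : dualG) : chi 0 = 1.
Proof.
case: (chrP chi) => /(_ 0 0) + _ _; rewrite addr0 => h.
by apply: (mulfI (cabs_char_neq0 chi 0)); rewrite -h mulr1.
Qed.

(* The group law is pointwise multiplication, written additively. *)
Lemma one_is_character : is_character (fun _ : G => 1 : R[i]).
Proof.
split=> [x y|x|]; first by rewrite mulr1.
- exact: Normc.normc1.
- by move=> x; exact: cvg_cst.
Qed.

Lemma mul_is_character (chi psi : dualG) :
  is_character (fun x => chi x * psi x).
Proof.
case: (chrP chi) => chiD chi1 chiC; case: (chrP psi) => psiD psi1 psiC.
split=> [x y|x|x]; first by rewrite chiD psiD mulrACA.
- by rewrite /cabs Normc.normcM [X in X * _]chi1 [X in _ * X]psi1 mulr1.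
- exact: (@cvgM _ _ _ _ (chr chi : G -> R[i]^o) (chr psi : G -> R[i]^o)
    _ _ (chiC x) (psiC x)).
Qed.

Lemma inv_is_character (chi : dualG) : is_character (fun x => (chi x)^-1).
Proof.
case: (chrP chi) => chiD chi1 chiC.
split=> [x y|x|x]; first by rewrite chiD invfM.
- by rewrite /cabs Normc.normcV [X in X^-1]chi1 invr1.
- by apply: (@cvgV _ _ _ _ (chr chi : G -> R[i]^o) _ _ (chiC x));
    exact: cabs_char_neq0.
Qed.

HB.instance Definition _ := gen_eqMixin dualG.
HB.instance Definition _ := gen_choiceMixin dualG.

Definition dual_zero : dualG := Dual one_is_character.
Definition dual_add (chi psi : dualG) : dualG := Dual (mul_is_character chi psi).
Definition dual_opp (chi : dualG) : dualG := Dual (inv_is_character chi).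

Lemma dual_addA : associative dual_add.
Proof. by move=> *; apply: dual_eq => x; exact: mulrA. Qed.
Lemma dual_addC : commutative dual_add.
Proof. by move=> *; apply: dual_eq => x; exact: mulrC. Qed.
Lemma dual_add0 : left_id dual_zero dual_add.
Proof. by move=> *; apply: dual_eq => x; exact: mul1r. Qed.
Lemma dual_addN : left_inverse dual_zero dual_opp dual_add.
Proof.
move=> chi; apply: dual_eq => x; apply: mulVf; exact: cabs_char_neq0.
Qed.

HB.instance Definition _ :=
  GRing.isZmodule.Build dualG dual_addA dual_addC dual_add0 dual_addN.

HB.instance Definition _ := Topological.copy dualG
  (initial_topology (@chr R G : dualG -> {compact-open, G -> R[i]^o})).
End DualGroup.

Section L0.
Variables (R : realType) (G : preTopologicalZmodType).
Variable mu : {measure set (borel G) -> \bar R}.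

Definition null_fun : {pred G -> R[i]} :=
  [pred f | `[< {ae mu, forall x, (f : borel G -> R[i]) x = 0} >]].

Lemma null_funB : zmod_closed null_fun.
Proof.
split; first by apply/asboolP; exact: aeW.
move=> f g /asboolP f0 /asboolP g0; apply/asboolP.
by apply: filterS2 f0 g0 => x fx gx; change (f x - g x = 0); rewrite fx gx subr0.
Qed.
HB.instance Definition _ := GRing.isZmodClosed.Build _ null_fun null_funB.

Lemma null_funZ (a : R[i]) (f : G -> R[i]) :
  f \in null_fun -> a *: f \in null_fun.
Proof.
move=> /asboolP f0; apply/asboolP.
by apply: filterS f0 => x fx; change (a * f x = 0); rewrite fx mulr0.
Qed.

(* Classes of all functions; the function spaces below consist of classes of
   measurable ones. *)
Definition L0 : Type := Quotient.quot null_fun.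
HB.instance Definition _ := GRing.Zmodule.on L0.
HB.instance Definition _ := Quotient.on L0.

Definition ae_class (f : G -> R[i]) : L0 := \pi_(Quotient.quot null_fun) f.

Definition L0_scale (a : R[i]) (u : L0) : L0 :=
  ae_class (a *: (repr u : G -> R[i])).

Lemma ae_classP (f g : G -> R[i]) :
  ae_class f = ae_class g <-> f - g \in null_fun.
Proof.
rewrite Quotient.idealrBE; split; first by move=> fg; apply/eqP.
by move/eqP.
Qed.

Lemma ae_classD (f g : G -> R[i]) :
  ae_class (f + g) = ae_class f + ae_class g.
Proof. exact: Quotient.pi_add. Qed.

Lemma ae_class_repr (u : L0) : ae_class (repr u) = u.
Proof. exact: reprK. Qed.

Lemma L0_scaleE (a : R[i]) (f : G -> R[i]) :
  L0_scale a (ae_class f) = ae_class (a *: f).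
Proof.
apply/ae_classP; rewrite -scalerBr; apply: null_funZ.
by apply/ae_classP; rewrite ae_class_repr.
Qed.

Lemma L0_scaleA a b u : L0_scale a (L0_scale b u) = L0_scale (a * b) u.
Proof. by rewrite -[u]ae_class_repr !L0_scaleE scalerA. Qed.
Lemma L0_scale1 : left_id 1 L0_scale.
Proof. by move=> u; rewrite -[u]ae_class_repr !L0_scaleE scale1r. Qed.
Lemma L0_scaleDr : right_distributive L0_scale +%R.
Proof.
move=> a u v; rewrite -[u]ae_class_repr -[v]ae_class_repr.
by rewrite -ae_classD !L0_scaleE scalerDr ae_classD.
Qed.
Lemma L0_scaleDl u : {morph L0_scale^~ u : a b / a + b}.
Proof.
by move=> a b; rewrite -[u]ae_class_repr !L0_scaleE scalerDl ae_classD.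
Qed.
HB.instance Definition _ := GRing.Zmodule_isLmodule.Build R[i] L0
  L0_scaleA L0_scale1 L0_scaleDr L0_scaleDl.

Definition cmeasurable (f : G -> R[i]) : Prop :=
  measurable_fun [set: borel G] (fun x : borel G => complex.Re (f x)) /\
  measurable_fun [set: borel G] (fun x : borel G => complex.Im (f x)).

(* A measurable representative of the class, when there is one. *)
Definition mrepr (u : L0) : G -> R[i] :=
  xget (0 : G -> R[i]) [set f | cmeasurable f /\ ae_class f = u].

Definition cintegral (f : G -> R[i]) : R[i] :=
  ((\int[mu]_x complex.Re (f x)) +i* (\int[mu]_x complex.Im (f x)))%C.

Definition convolution (f g : G -> R[i]) (x : G) : R[i] :=
  cintegral (fun y => f y * g (x - y)).

Definition conv_class (u v : L0) : L0 := ae_class (convolution (mrepr u) (mrepr v)).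

Definition norm1w (w : G -> R) (f : G -> R[i]) : \bar R :=
  ('N[mu]_1[EFin \o (fun x : borel G => (cabs (f x) * w x)%R)])%E.

Definition L1w (w : G -> R) : set L0 :=
  [set ae_class f | f in
    [set f | cmeasurable f /\ (norm1w w f < +oo)%E]].

Definition L1w_norm (w : G -> R) (u : L0) : R := fine (norm1w w (mrepr u)).
End L0.

Arguments conv_class {R G} mu u v.
Arguments L1w {R G} mu w.
Arguments L1w_norm {R G} mu w u.

Definition fourier (R : realType) (G : topologicalZmodType)
    (mu : {measure set (borel G) -> \bar R}) (f : G -> R[i]) :
    dual R G -> R[i] :=
  fun gamma => cintegral mu (fun x => f x * (gamma x)^*%C).

(* G = R^a x G1, G1 a locally compact abelian group with an open compact
   subgroup H, and T a transversal of H in G1.  Below, [cell] is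
   I = [0,1)^a x H and [cell_index] is J = Z^a x T, both transported to G. *)
Record decomposition (R : realType) (G : preTopologicalZmodType) := Decomposition {
  dec_dim : nat;
  dec_G1 : topologicalZmodType;
  dec_G1_lca : lca dec_G1;
  dec_iso : 'rV[R]_dec_dim * dec_G1 -> G;
  dec_isoD : forall u v, dec_iso (u + v) = dec_iso u + dec_iso v;
  dec_iso_bij : set_bij setT setT dec_iso;
  dec_iso_continuous : continuous dec_iso;
  dec_iso_open : forall U, open U -> open (dec_iso @` U);
  dec_H : set dec_G1;
  dec_H0 : dec_H 0;
  dec_HB : forall x y, dec_H x -> dec_H y -> dec_H (x - y);
  dec_H_open : open dec_H;
  dec_H_compact : compact dec_H;
  dec_T : set dec_G1;
  dec_T_transversal : forall x, exists! t, dec_T t /\ dec_H (x - t) }.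

Section Amalgam.
Variables (R : realType) (G : preTopologicalZmodType).
Variables (mu : {measure set (borel G) -> \bar R}) (D : decomposition R G).

Definition cell : set G :=
  [set dec_iso (v, h) | v in [set v : 'rV[R]_(dec_dim D) |
     forall i, 0 <= v 0 i < 1] & h in @dec_H R G D].

Definition cell_index : set G :=
  [set dec_iso (map_mx intr n, t) | n in [set: 'rV[int]_(dec_dim D)] &
     t in @dec_T R G D].

Definition cell_at (alpha : G) : set G := [set alpha + x | x in cell].

Definition amalgam_norm (p q : R) (w : G -> R) (f : G -> R[i]) : \bar R :=
  ((\esum_(alpha in cell_index)
     ('N[mu]_(p%:E)[EFin \o (fun x : borel G => (cabs (f x) * w x)%R)
                               \_ (cell_at alpha)]) `^ q) `^ q^-1)%E.

Definition Lp_loc (p : R) (f : G -> R[i]) : Prop :=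
  cmeasurable f /\
  forall K : set G, compact K ->
    mu.-integrable K (fun x : borel G => (cabs (f x) `^ p)%:E).

Definition amalgam (p q : R) (w : G -> R) : set (G -> R[i]) :=
  [set f | Lp_loc p f /\ (amalgam_norm p q w f < +oo)%E].
End Amalgam.

Section ASpace.
Variables (R : realType) (G : topologicalZmodType).
Variables (mu : {measure set (borel G) -> \bar R}) (D : decomposition R G).
Variables (nu : {measure set (borel (dual R G)) -> \bar R}).
Variables (D' : decomposition R (dual R G)).
Variables (p q r : R) (w1 : G -> R) (w2 : dual R G -> R).

Definition A_space : set (L0 mu) :=
  [set ae_class mu f | f in
    [set f | amalgam mu D p 1 w1 f /\ amalgam nu D' q r w2 (fourier mu f)]].

Definition A_norm (u : L0 mu) : R :=
  fine (amalgam_norm mu D p 1 w1 (mrepr u)) +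
  fine (amalgam_norm nu D' q r w2 (fourier mu (mrepr u))).
End ASpace.
Arguments A_space {R G} mu D nu D' p q r w1 w2.
Arguments A_norm {R G} mu D nu D' p q r w1 w2 u.

Section Banach.
Variables (R : realType) (V W : lmodType R[i]).

Definition banach_space (B : set V) (N : V -> R) : Prop :=
  [/\ B 0 /\ (forall a u v, B u -> B v -> B (a *: u + v)),
      forall u, B u -> 0 <= N u /\ (N u = 0 -> u = 0),
      forall a u, B u -> N (a *: u) = cabs a * N u,
      forall u v, B u -> B v -> N (u + v) <= N u + N v &
      forall s : nat -> V, (forall n, B (s n)) ->
        (forall e : R, 0 < e -> exists k, forall m n,
           (k <= m)%N -> (k <= n)%N -> N (s m - s n) < e) ->
        exists2 l, B l & N (s n - l) @[n --> \oo] --> (0 : R)].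

Definition bilinear_on (A : set V) (B : set W) (act : V -> W -> W) : Prop :=
  (forall a f g h, A f -> A g -> B h ->
     act (a *: f + g) h = a *: act f h + act g h) /\
  (forall a f h k, A f -> B h -> B k ->
     act f (a *: h + k) = a *: act f h + act f k).
End Banach.

Definition banach_algebra (R : realType) (V : lmodType R[i])
    (A : set V) (N : V -> R) (mul : V -> V -> V) : Prop :=
  [/\ banach_space A N,
      forall f g, A f -> A g -> A (mul f g),
      bilinear_on A A mul,
      forall f g h, A f -> A g -> A h -> mul (mul f g) h = mul f (mul g h) &
      forall f g, A f -> A g -> N (mul f g) <= N f * N g].

Definition banach_module (R : realType) (V W : lmodType R[i])
    (A : set V) (NA : V -> R) (mul : V -> V -> V)
    (B : set W) (NB : W -> R) (act : V -> W -> W) : Prop :=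
  [/\ banach_algebra A NA mul /\ banach_space B NB,
      forall f h, A f -> B h -> B (act f h),
      bilinear_on A B act,
      forall f g h, A f -> A g -> B h -> act (mul f g) h = act f (act g h) &
      exists2 C : R, 1 <= C &
        forall f h, A f -> B h -> NB (act f h) <= C * NA f * NB h].

(* Main.v *)
Require Import Defs.
From mathcomp Require Import all_boot all_order all_algebra complex.
From mathcomp Require Import all_classical all_reals all_analysis.
From mathcomp Require Import measurable_realfun ring lra zify.

(** Let [N f] be the amalgam norm of [f] on the group plus the amalgam norm of its
transform on the dual group.

The module action. Let [f] be in the Beurling algebra of [w0] and [h] in the space
of finite [N].  On the dual side the transform of the convolution is the product
of the transforms ([fourier_convolution]), and the transform of [f] is bounded by
the integral of |f|, hence by its weighted norm ([frequency_norm_conv]).  On the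
group itself, w1(x) <= w1(y) w1(x - y) gives |f * h| w1 <= (|f| w1) * (|h| w1)
([convolution_weight_le]), which leaves an unweighted inequality of Young type,
||F * H||_(p,1) <= 2^a ||F||_1 ||H||_(p,1) for nonnegative F and H ([amal_econv]).
When F lives on one cell beta, the difference of a point of the cell gamma and a
point of beta lies in one of 2^a cells, each of which determines gamma
([cell_atB], [neighbour_cell_inj]); so Young's inequality in L^p on each gamma
and summation over gamma give the bound.  An integrable F lives, up to a null
set, on countably many cells ([nnL1_cells]) and is the sum of such pieces.
Finally w1 <= C w0 bounds the integral of |f| w1 by the norm of [f] for [w0].

Completeness. [N f] is at least the integral of |f|, by Hoelder's inequality on
each cell, and [N] is lower semicontinuous along sequences that converge both in
the mean and almost everywhere ([A_fatou_normP]); for the transform this holds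
because convergence in the mean makes transforms converge uniformly.  These two
properties suffice ([fatou_norm_banach]): a Cauchy sequence has a limit in the mean,
a subsequence converges almost everywhere, and lower semicontinuity bounds the norm
of the remainder.  The Beurling algebra is complete for the same reason.

Exchange of integrals. Associativity of convolution and multiplicativity of the
transform need a Tonelli theorem on G x G.  The group need be neither second
countable nor sigma-compact, so the Borel sets of G x G may be more than the
product sigma-algebra, Haar measure may fail to be sigma-finite, and the theorem
for product measures does not apply.  Instead, the two iterated integrals of
f(z) g(y - z) k(y) are positive, countably additive functionals of [f] and of
[g], so they may be compared on indicators of compact sets ([nnL1_ind],
[nnlinear_le_compact]) and, in [f], on functions that live on a small translate
of a neighbourhood of 0 ([nnlinear_le_local]).  There g(y - z) depends on z
only for y in a small set, by regularity of Haar measure ([tonelli_local]); the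
result is [tonelli]. *)

Set Implicit Arguments.
Unset Strict Implicit.
Unset Printing Implicit Defensive.
Import Order.TTheory GRing.Theory Num.Theory.
Import numFieldNormedType.Exports.
Local Open Scope classical_set_scope.
Local Open Scope ring_scope.

(** * Borel sets, translations and regularity of Haar measure *)

Section BorelSets.
Variable G : preTopologicalZmodType.

Lemma open_borel (A : set G) : open A -> measurable (A : set (borel G)).
Proof. by move=> oA; exact: sub_sigma_algebra. Qed.

Lemma closed_borel (A : set G) : closed A -> measurable (A : set (borel G)).
Proof.
by move=> cA; rewrite -[A]setCK; apply: measurableC; apply: open_borel; exact: closed_openC.
Qed.

Lemma compact_borel (A : set G) :
  hausdorff_space G -> compact A -> measurable (A : set (borel G)).
Proof. by move=> hG cA; apply: closed_borel; exact: compact_closed. Qed.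

Lemma continuous_borel (H : preTopologicalZmodType) (f : G -> H) :
  continuous f -> measurable_fun [set: borel G] (f : borel G -> borel H).
Proof.
move=> cf; apply: (@measurability _ _ (borel G) (borel H) setT f (@open H)) => //.
move=> _ [U oU <-]; rewrite setTI; apply: open_borel.
by move/continuousP : cf; exact.
Qed.

Lemma continuous_borel_real (R : realType) (f : G -> R) :
  continuous f -> measurable_fun [set: borel G] (f : borel G -> R).
Proof.
move=> cf; apply: (measurability _ (RGenOpens.measurableE R)).
move=> _ [_ [a [b ->] <-]]; rewrite setTI; apply: open_borel.
by move/continuousP : cf; apply; exact: interval_open.
Qed.

Lemma measurable_EFin_indic (R : realType) (A : set (borel G)) : measurable A ->
  measurable_fun [set: borel G] (fun x : borel G => (\1_A x)%:E : \bar R).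
Proof. by move=> mA; apply/measurable_EFinP; exact: measurable_indic. Qed.
End BorelSets.

Lemma lca_compact_borel (G : topologicalZmodType) (K : set G) :
  lca G -> compact K -> measurable (K : set (borel G)).
Proof. by case=> hG _; exact: compact_borel. Qed.

Section Translation.
Variables (R : realType) (G : topologicalZmodType).
Variable mu : {measure set (borel G) -> \bar R}.
Hypothesis hmu : haar_measure mu.

Lemma continuous_addl (a : G) : continuous (fun x : G => a + x).
Proof.
move=> x; apply: (continuous2_cvg _ (@add_continuous G (a, x))).
- exact: cvg_cst.
- exact: cvg_id.
Qed.

Lemma continuous_subl (a : G) : continuous (fun x : G => a - x).
Proof.
move=> x; apply: (continuous2_cvg _ (@add_continuous G (a, - x))).
- exact: cvg_cst.
- exact: (@opp_continuous G x).
Qed.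

Lemma measurable_addl (a : G) :
  measurable_fun [set: borel G] (fun x : borel G => (a + x : borel G)).
Proof. exact: (continuous_borel (@continuous_addl a)). Qed.

Lemma measurable_subl (a : G) :
  measurable_fun [set: borel G] (fun x : borel G => (a - x : borel G)).
Proof. exact: (continuous_borel (@continuous_subl a)). Qed.

Lemma measurable_subr (a : G) :
  measurable_fun [set: borel G] (fun x : borel G => ((x : G) - a : borel G)).
Proof. by under eq_fun do rewrite addrC; exact: measurable_addl. Qed.

Lemma preimage_addl (a : G) (A : set G) :
  (fun x => a + x) @^-1` A = [set - a + x | x in A].
Proof.
apply/seteqP; split=> [x Ax|_ [x Ax <-]] /=.
  by exists (a + x) => //; rewrite addKr.
by rewrite addrA subrr add0r.
Qed.

Lemma haar_preimage_addl (a : G) (A : set (borel G)) : measurable A ->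
  mu ((fun x : G => a + x) @^-1` A) = mu A.
Proof. by move=> mA; rewrite preimage_addl; case: hmu => _ /(_ (- a) A mA). Qed.

Lemma haar_integral_addl (a : G) (f : borel G -> \bar R) :
  measurable_fun setT f -> (forall x, (0 <= f x)%E) ->
  (\int[mu]_x f (a + x)%R = \int[mu]_x f x)%E.
Proof.
move=> mf f0; have := @ge0_integral_pushforward _ _ _ _ R _ (measurable_addl a) mu setT f.
rewrite preimage_setT => <- //.
apply: eq_measure_integral => [mT A mA|? A].
- exact: (measurable_addl a mT mA).
- by move=> mA _; exact: haar_preimage_addl.
Qed.
End Translation.

Section Regularity.
Variables (R : realType) (G : topologicalZmodType).
Variable mu : {measure set (borel G) -> \bar R}.
Hypothesis hG : lca G.
Hypothesis hmu : haar_measure mu.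

Lemma haar_compact_fin (K : set G) : compact K -> (mu K < +oo)%E.
Proof. by case: hmu => _ _ + _; exact. Qed.

Lemma haar_inner (A : set (borel G)) (e : R) : measurable A -> (mu A < +oo)%E ->
  0 < e -> exists K : set G, [/\ compact K, K `<=` A & (mu (A `\` K) < e%:E)%E].
Proof.
move=> mA Afin e0; case: (hmu) => _ _ _ /(_ A mA) Asup.
have fA : mu A \is a fin_num by rewrite ge0_fin_numE.
have [|_ [K [cK KA] <-] AK] := @ub_ereal_sup_adherent R
    [set mu K | K in [set K : set G | compact K /\ K `<=` A]] e e0.
  by rewrite -Asup.
exists K; split => //.
have mK := lca_compact_borel hG cK.
have KE : mu (A `&` K) = mu K by congr (mu _); apply/setIidPr.
have fK : mu K \is a fin_num by rewrite ge0_fin_numE// haar_compact_fin.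
have mAK : mu (A `\` K) = (mu A - mu K)%E by rewrite -KE; exact: measureD.
rewrite mAK lteBlDr// addeC.
by move: AK; rewrite -Asup lteBlDr// addeC.
Qed.

Lemma haar_null_compact (A : set (borel G)) : measurable A ->
  (forall K : set G, compact K -> K `<=` A -> mu K = 0%E) -> mu A = 0%E.
Proof.
move=> mA A0; case: (hmu) => _ _ _ /(_ A mA) ->.
apply/eqP; rewrite eq_le; apply/andP; split.
  by apply: ge_ereal_sup => _ [K [cK KA] <-]; rewrite A0.
by apply: ereal_sup_ubound; exists set0; rewrite ?measure0//; split => //; exact: compact0.
Qed.

Lemma compact_nbhs0 : exists V : set G, compact V /\ nbhs 0 V.
Proof.
have [U U0 [cU _]] := hG.2 (0 : G) I.
by exists U; split => //; apply: filterS (U0 : nbhs 0 (fun x => [set: G] x -> U x)) => x; exact.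
Qed.

Lemma compact_sum (K L : set G) : compact K -> compact L ->
  compact [set xy.1 + xy.2 | xy in K `*` L].
Proof.
move=> cK cL; apply: continuous_compact; last exact: compact_setX.
by apply: continuous_subspaceT => xy; exact: add_continuous.
Qed.

Lemma compact_opp (K : set G) : compact K -> compact [set - x | x in K].
Proof.
move=> cK; apply: continuous_compact => //.
by apply: continuous_subspaceT => x; exact: opp_continuous.
Qed.

Lemma nbhs_addl (a : G) (V : set G) : nbhs 0 V -> nbhs a [set a + x | x in V].
Proof.
move=> V0; have /(_ V) := @continuous_addl G (- a) a; rewrite addNr => /(_ V0).
by rewrite nbhs_simpl /=; apply: filterS => x /= Vx; exists (- a + x) => //; rewrite addrA subrr add0r.
Qed.

Lemma compact_open_hull (K : set G) : compact K ->
  exists O : set G, [/\ open O, K `<=` O & (mu O < +oo)%E].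
Proof.
move=> cK; have [V [cV V0]] := compact_nbhs0.
have cKV := compact_sum cK cV.
exists (interior [set xy.1 + xy.2 | xy in K `*` V]); split.
- exact: open_interior.
- move=> x Kx; apply: filterS (nbhs_addl x V0) => _ [v Vv <-].
  by exists (x, v).
- apply: le_lt_trans (haar_compact_fin cKV); apply: le_measure.
  + by rewrite inE; apply: open_borel; exact: open_interior.
  + by rewrite inE; exact: lca_compact_borel.
  + exact: interior_subset.
Qed.

Lemma haar_outer_compact (K : set G) (e : R) : compact K -> 0 < e ->
  exists U : set G, [/\ open U, K `<=` U, (mu U < +oo)%E & (mu (U `\` K) < e%:E)%E].
Proof.
move=> cK e0; case: (compact_open_hull cK) => O [oO KO Ofin].
have mO := open_borel oO; have mK := lca_compact_borel hG cK.
have mOK : measurable (O `\` K : set (borel G)) by exact: measurableD.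
have OKfin : (mu (O `\` K) < +oo)%E.
  by apply: le_lt_trans Ofin; apply: le_measure; rewrite ?inE//; exact: subDsetl.
have [L [cL LOK OKL]] := haar_inner mOK OKfin e0.
exists (O `\` L); split.
- by apply: openI => //; apply: closed_openC; apply: compact_closed => //; case: hG.
- by move=> x Kx; split; [exact: KO|move=> /LOK[]].
- apply: le_lt_trans Ofin; apply: le_measure; rewrite ?inE//.
  by apply: measurableD => //; exact: lca_compact_borel.
- by rewrite setDDl setUC -setDDl.
Qed.

(** Each point of [K] has a neighbourhood that stays in [U] under all sufficiently
small translations, and compactness of [K] makes the bound uniform. *)
Lemma compact_tube (K U : set G) : compact K -> open U -> K `<=` U ->
  exists W : set G, [/\ open W, W 0 &
    forall w x, W w -> K x -> U (x + w) /\ U (x - w)].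
Proof.
move=> /compact_near_coveringP cK oU KU.
have P1 : \forall w \near (0 : G), K `<=` (fun x => U (x + w)).
  apply: (cK G (nbhs (0 : G)) (fun w x => U (x + w))) => x Kx.
  have /= := @add_continuous G (x, 0).
  rewrite /continuous_at /= addr0 => /(_ U); apply.
  by apply: open_nbhs_nbhs; split => //; exact: KU.
have P2 : \forall w \near (0 : G), K `<=` (fun x => U (x - w)).
  apply: (cK G (nbhs (0 : G)) (fun w x => U (x - w))) => x Kx.
  have /= := @sub_continuous G (x, 0).
  rewrite /continuous_at /= subr0 => /(_ U); apply.
  by apply: open_nbhs_nbhs; split => //; exact: KU.
exists (interior [set w | K `<=` (fun x => U (x + w)) /\ K `<=` (fun x => U (x - w))]).
split; first exact: open_interior.
  by near=> w; split; near: w.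
by move=> w x /interior_subset[/= KU1 KU2] Kx; split; [exact: KU1|exact: KU2].
Unshelve. all: by end_near. Qed.

Lemma compact_translates (K W : set G) : compact K -> open W -> W 0 ->
  exists s : seq G, forall x, K x -> exists2 z, z \in s & W (x - z).
Proof.
move=> /compact_near_coveringP cK oW W0.
(* Near covering along the filter of finite lists directed by inclusion yields one
   list of centres for the whole compact set. *)
pose F : set_system (seq G) :=
  filter_from setT (fun s0 : seq G => [set s : seq G | {subset s0 <= s}]).
have FF : Filter F.
  apply: filter_from_filter; first by exists [::].
  move=> s t _ _; exists (s ++ t) => //= u stu; split=> x xs; apply: stu; rewrite mem_cat xs ?orbT//.
have [] := cK (seq G) F (fun s x => exists2 z, z \in s & W (x - z)) FF.
  move=> x Kx.
  exists ([set y | W (y - x)], [set s : seq G | x \in s]) => /=.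
    split; last by exists [:: x] => // s /= sx; apply: sx; rewrite inE.
    have /= := @sub_continuous G (x, x).
    rewrite /continuous_at /= subrr => /(_ W) h.
    have {}h := h (open_nbhs_nbhs (conj oW W0)).
    case: h => [[A B] /= [xA xB]] AB; apply: filterS xA => y Ay.
    by apply: (AB (y, x)); split => //=; exact: nbhs_singleton.
  by move=> [y s] /= [Wyx xs]; exists x.
by move=> s _ /(_ s) h; exists s; apply: h => /=.
Qed.
End Regularity.

(** * Generation of nonnegative integrable functions *)

Section NonnegSeries.
Variable R : realType.
Local Open Scope ereal_scope.

Lemma nneseriesMl (c : \bar R) (f : nat -> \bar R) : 0 <= c -> (forall n, 0 <= f n) ->
  \sum_(n <oo) (c * f n) = c * \sum_(n <oo) f n.
Proof.
move=> c0 f0; rewrite -!ge0_integral_count//; last by move=> n; exact: mule_ge0.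
by rewrite ge0_integralZl.
Qed.

Lemma nneseriesMr (c : \bar R) (f : nat -> \bar R) : 0 <= c -> (forall n, 0 <= f n) ->
  \sum_(n <oo) (f n * c) = (\sum_(n <oo) f n) * c.
Proof.
move=> c0 f0; rewrite muleC -nneseriesMl//.
by apply: eq_eseriesr => n _; rewrite muleC.
Qed.

Lemma ge0_integral_seriesM d (T : measurableType d) (m : {measure set T -> \bar R})
    (c : nat -> R) (u : nat -> T -> \bar R) (h : T -> \bar R) :
  (forall n, (0 <= c n)%R) -> (forall n, measurable_fun setT (u n)) ->
  (forall n x, 0 <= u n x) -> measurable_fun setT h -> (forall x, 0 <= h x) ->
  \int[m]_x (h x * \sum_(n <oo) (c n)%:E * u n x) =
  \sum_(n <oo) (c n)%:E * \int[m]_x (h x * u n x).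
Proof.
move=> c0 mu_ u0 mh h0.
have mhu n : measurable_fun setT (fun x => h x * u n x) by exact: emeasurable_funM.
have hu0 n x : 0 <= h x * u n x by exact: mule_ge0.
transitivity (\int[m]_x (\sum_(n <oo) (c n)%:E * (h x * u n x))).
  apply: eq_integral => x _; rewrite -nneseriesMl//; last by move=> n; rewrite mule_ge0// lee_fin.
  by apply: eq_eseriesr => n _; rewrite muleCA.
transitivity (\sum_(n <oo) \int[m]_x ((c n)%:E * (h x * u n x))).
  apply: integral_nneseries => // [n|n x _]; first exact: measurable_funeM.
  by rewrite mule_ge0// lee_fin.
by apply: eq_eseriesr => n _; exact: ge0_integralZl_EFin.
Qed.
End NonnegSeries.

Definition nnL1 (R : realType) (G : preTopologicalZmodType)
    (mu : {measure set (borel G) -> \bar R}) (f : borel G -> \bar R) :=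
  [/\ measurable_fun [set: borel G] f, forall x, (0 <= f x)%E & (\int[mu]_x f x < +oo)%E].

Section Induction.
Variables (R : realType) (G : topologicalZmodType).
Variable mu : {measure set (borel G) -> \bar R}.
Hypothesis hG : lca G.
Hypothesis hmu : haar_measure mu.
Local Open Scope ereal_scope.

(** From what is left of [A] at step [n], remove a compact part that exhausts it up
to measure 1/(n+1). *)
Lemma haar_compact_exhaustion (A : set (borel G)) : measurable A -> mu A < +oo ->
  exists K : nat -> set G, [/\ forall n, compact (K n), trivIset setT K,
     \bigcup_n K n `<=` A & mu (A `\` \bigcup_n K n) = 0].
Proof.
move=> mA Afin.
have [k kP] : {k : set (borel G) * nat -> set G & forall Bn, measurable Bn.1 -> mu Bn.1 < +oo ->
    [/\ compact (k Bn), k Bn `<=` Bn.1 & mu (Bn.1 `\` k Bn) < (Bn.2.+1%:R^-1)%:E]}.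
  apply: (@choice _ _ (fun (Bn : set (borel G) * nat) (K : set G) => measurable Bn.1 -> mu Bn.1 < +oo ->
    [/\ compact K, K `<=` Bn.1 & mu (Bn.1 `\` K) < (Bn.2.+1%:R^-1)%:E])) => -[B n] /=.
  have [[mB Bfin]|nB] := pselect (measurable B /\ mu B < +oo).
    by have [|K KP] := @haar_inner _ _ _ hG hmu B n.+1%:R^-1 mB Bfin => //; exists K.
  by exists set0 => mB Bfin; exfalso; apply: nB.
pose B := fix B n := if n is m.+1 then B m `\` k (B m, m) else A.
have BP n : measurable (B n) /\ mu (B n) < +oo.
  elim: n => //= n [mB Bfin]; have [cK KB KBn] := kP (B n, n) mB Bfin.
  have mK : measurable (k (B n, n) : set (borel G)) by apply: compact_borel => //; case: hG.
  split; first exact: measurableD.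
  by apply: le_lt_trans Bfin; apply: le_measure; rewrite ?inE//; exact: measurableD.
have kPB n : [/\ compact (k (B n, n)), k (B n, n) `<=` B n & mu (B n.+1) < (n.+1%:R^-1)%:E].
  by have [mB Bfin] := BP n; exact: kP (B n, n) mB Bfin.
have Bdec m n : (m <= n)%N -> B n `<=` B m.
  move=> /subnKC <-; elim: (n - m)%N => [|d IH]; first by rewrite addn0.
  by rewrite addnS => x [/IH].
have mK n : measurable (k (B n, n) : set (borel G)).
  by apply: compact_borel; [case: hG|have [] := kPB n].
exists (fun n => k (B n, n)); split.
- by move=> n; have [] := kPB n.
- apply/trivIsetP => i j _ _.
  wlog ij : i j / (i < j)%N.
    move=> H; rewrite neq_ltn => /orP[ij|ji]; first by apply: H => //; rewrite neq_ltn ij.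
    by rewrite setIC; apply: H => //; rewrite neq_ltn ji.
  move=> _; apply/seteqP; split => // x [kx kjx]; have [_ /(_ _ kjx) Bjx _] := kPB j.
  by have [_] := Bdec _ _ ij _ Bjx.
- by move=> x [n _ kx]; have [_ /(_ _ kx) Bx _] := kPB n; exact: (Bdec 0%N n (leq0n _) _ Bx).
- apply/eqP; rewrite eq_le measure_ge0 andbT.
  apply/lee_addgt0Pr => e e0; rewrite add0e.
  have [n ne] : exists n : nat, (n.+1%:R^-1 < e)%R.
    have := @near_infty_natSinv_lt R (PosNum e0) => -[n _ /(_ n)]; rewrite /= leqnn => h.
    by exists n; exact: h.
  have [_ _ Bn] := kPB n; apply: ltW; apply: le_lt_trans (lt_trans Bn _); last by rewrite lte_fin.
  apply: le_measure; rewrite ?inE.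
  + apply: measurableD => //; exact: bigcupT_measurable.
  + by have [] := BP n.+1.
  + have H m x : A x -> (forall i, ~ k (B i, i) x) -> B m x by move=> Ax kx; elim: m => //= m IH; split.
    by move=> x [Ax kx]; apply: H => // i kix; apply: kx; exists i.
Qed.

Lemma nnL1_compact (K : set G) : compact K -> nnL1 mu (fun x => (\1_K x)%:E).
Proof.
move=> cK; have mK := lca_compact_borel hG cK.
split.
- by exact: measurable_EFin_indic.
- by move=> x; rewrite lee_fin.
- by rewrite integral_indic// setIT; exact: haar_compact_fin.
Qed.

Lemma nnL1_le (f g : borel G -> \bar R) : measurable_fun [set: borel G] f ->
  (forall x, 0 <= f x) -> (forall x, f x <= g x) -> nnL1 mu g -> nnL1 mu f.
Proof.
move=> mf f0 fg [mg g0 gfin]; split => //.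
by apply: le_lt_trans gfin; exact: ge0_le_integral.
Qed.

Lemma nnL1_indic (A : set (borel G)) : measurable A -> mu A < +oo ->
  nnL1 mu (fun x => (\1_A x)%:E).
Proof.
move=> mA Afin; split.
- by exact: measurable_EFin_indic.
- by move=> x; rewrite lee_fin.
- by rewrite integral_indic// setIT.
Qed.

(** The greedy expansion: 1/(n+1) is added at [x] whenever the partial sum stays
below [f x].  If the total fell short of [f x] by some amount, every late term
would have been added, and the harmonic series would converge.  Unlike an
approximation by simple functions, this gives a single series of indicators
without differences, so that countably additive functionals apply to it. *)
Lemma nn_indic_series (f : borel G -> \bar R) : measurable_fun [set: borel G] f ->
  (forall x, 0 <= f x) ->
  exists A : nat -> set (borel G), (forall n, measurable (A n)) /\
    forall x, f x = \sum_(n <oo) (n.+1%:R^-1%:E * (\1_(A n) x)%:E).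
Proof.
move=> mf f0.
(* [s n] is the partial sum before term [n], and [A n] is the set where adding
   1/(n+1) to it does not exceed [f]. *)
pose step n (s : borel G -> R) (x : borel G) : R :=
  (s x + n.+1%:R^-1 * \1_[set x | ((s x + n.+1%:R^-1)%:E <= f x)%E] x)%R.
pose s := fix s n := if n is m.+1 then step m (s m) else fun=> 0%R.
pose A n := [set x | (s n x + n.+1%:R^-1)%:E <= f x].
have mA n : measurable_fun [set: borel G] (s n) -> measurable (A n).
  move=> msn; rewrite -[A n]setTI; apply: measurable_lee => //; apply/measurable_EFinP.
  by apply: measurable_funD => //; exact: measurable_cst.
have ms n : measurable_fun [set: borel G] (s n).
  elim: n => [|n msn]; first exact: measurable_cst.
  apply: (measurable_funD msn); apply: measurable_funM; first exact: measurable_cst.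
  by apply: measurable_indic; exact: mA.
have sE n x : (s n x)%:E = \sum_(0 <= k < n) (k.+1%:R^-1%:E * (\1_(A k) x)%:E).
  elim: n => [|n IH]; first by rewrite big_geq.
  by rewrite big_nat_recr//= -IH /step EFinD EFinM.
have sf n x : (s n x)%:E <= f x.
  elim: n => [|n IH]; first exact: f0.
  rewrite /= /step indicE; have [|_] := boolP (x \in _); last by rewrite mulr0 addr0.
  by rewrite inE /= mulr1.
exists A; split=> [n|x]; first exact: mA.
have t0 n : 0 <= n.+1%:R^-1%:E * (\1_(A n) x)%:E by rewrite -EFinM lee_fin mulr_ge0.
apply/eqP; rewrite eq_le andbC; apply/andP; split.
  apply: lime_le; first exact: is_cvg_nneseries.
  by apply: nearW => n; rewrite -sE.
rewrite leNgt; apply/negP => Sf.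
set S := (limn _) in Sf.
have S0 : 0 <= S by exact: nneseries_ge0.
have Sfin : S \is a fin_num by rewrite ge0_fin_numE//; apply: lt_le_trans Sf _; exact: leey.
have [N NS] : exists N : nat, S + N.+1%:R^-1%:E <= f x.
  have : exists2 e : R, (0 < e)%R & S + e%:E <= f x.
    move: Sf; rewrite -(fineK Sfin); case: (f x) => [r|_|//].
    - rewrite lte_fin => Sr; exists (r - fine S)%R; first by rewrite subr_gt0.
      by rewrite -EFinD lee_fin addrC subrK.
    - by exists 1%R => //; rewrite leey.
  move=> [e e0 eS]; have := @near_infty_natSinv_lt R (PosNum e0) => -[n _ /(_ n)] /=.
  rewrite leqnn => /(_ isT) h; exists n; apply: le_trans eS.
  by rewrite leeD2l// lee_fin ltW.
have sS n : (s n x)%:E <= S by rewrite sE; apply: nneseries_lim_ge.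
have xA n : (N <= n)%N -> A n x.
  move=> Nn; rewrite /A /=; apply: le_trans NS; rewrite EFinD; apply: leeD => //.
  by rewrite lee_fin lef_pV2 ?posrE// ler_nat.
apply: (@dvg_harmonic R).
apply: nondecreasing_is_cvgn.
  by apply: nondecreasing_series => n _ _; rewrite invr_ge0.
exists (series harmonic N + fine S)%R => _ [M _ <-].
have [MN|NM] := leqP M N.
  rewrite (@le_trans _ _ (series harmonic N))//; last by rewrite lerDl fine_ge0.
  by apply: nondecreasing_series => // n _ _; rewrite invr_ge0.
rewrite /series/= (big_cat_nat (n := N))//=; last exact: ltnW.
rewrite lerD2l -lee_fin fineK// -sumEFin; apply: le_trans (sS M).
rewrite sE [leRHS](big_cat_nat (n := N))//=; last exact: ltnW.
rewrite (le_trans _ (leeDr _ _))//; last by apply: sume_ge0.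
rewrite big_nat [leRHS]big_nat; apply: lee_sum => n /andP[Nn _].
by rewrite indicE mem_set ?mule1//; exact: xA.
Qed.

(** Inner regularity exhausts a set of finite measure by disjoint compact sets up to
a null set, and a nonnegative integrable function is a series of multiples of
indicators of such sets. *)
Lemma nnL1_ind (P : (borel G -> \bar R) -> Prop) :
  (forall K : set G, compact K -> P (fun x => (\1_K x)%:E)) ->
  (forall (c : R) f, (0 <= c)%R -> nnL1 mu f -> P f -> P (fun x => c%:E * f x)) ->
  (forall f_ : nat -> borel G -> \bar R, (forall n, nnL1 mu (f_ n)) -> (forall n, P (f_ n)) ->
     nnL1 mu (fun x => \sum_(n <oo) f_ n x) -> P (fun x => \sum_(n <oo) f_ n x)) ->
  (forall f g, nnL1 mu f -> nnL1 mu g -> ae_eq mu setT f g -> P f -> P g) ->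
  forall f, nnL1 mu f -> P f.
Proof.
move=> Pcompact PZ Psum Pae.
have Pindic (A : set (borel G)) : measurable A -> mu A < +oo -> P (fun x => (\1_A x)%:E).
  move=> mA Afin; have [K [cK tK KA AK0]] := haar_compact_exhaustion mA Afin.
  have mK n : measurable (K n : set (borel G)) by apply: compact_borel => //; case: hG.
  have mUK : measurable (\bigcup_n (K n : set (borel G))) by exact: bigcupT_measurable.
  have UKE : (fun x : borel G => (\1_(\bigcup_n K n) x)%:E) =
             (fun x => \sum_(n <oo) (\1_(K n) x)%:E) :> (borel G -> \bar R).
    by apply/funext => x; rewrite indic_bigcup.
  have UK1 : nnL1 mu (fun x => (\1_(\bigcup_n K n) x)%:E).
    by apply: nnL1_indic => //; apply: le_lt_trans Afin; apply: le_measure; rewrite ?inE.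
  apply: (Pae (fun x => (\1_(\bigcup_n K n) x)%:E)) => //; first exact: nnL1_indic.
    exists (A `\` \bigcup_n K n); split => //; first exact: measurableD.
    move=> x /= H; apply: contrapT => nAK; apply: H => _; congr EFin.
    rewrite !indicE; congr (nat_of_bool _)%:R; apply/idP/idP; rewrite !inE; first exact: KA.
    by move=> Ax; apply: contrapT => nK; apply: nAK.
  rewrite UKE; apply: Psum; rewrite -?UKE// => n; first exact: nnL1_compact.
  exact: Pcompact.
move=> f fL1; have [mf f0 ffin] := fL1.
have [A [mA fE]] := nn_indic_series mf f0.
have t0 n x : 0 <= n.+1%:R^-1%:E * (\1_(A n) x)%:E.
  by rewrite -EFinM lee_fin mulr_ge0.
have mt n : measurable_fun [set: borel G] (fun x => n.+1%:R^-1%:E * (\1_(A n) x)%:E).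
  by apply: measurable_funeM; exact: measurable_EFin_indic.
have tf n x : n.+1%:R^-1%:E * (\1_(A n) x)%:E <= f x.
  by rewrite fE (nneseriesD1 (n := n))//; apply: leeDl; exact: nneseries_ge0.
have tL1 n : nnL1 mu (fun x => n.+1%:R^-1%:E * (\1_(A n) x)%:E) by exact: nnL1_le fL1.
have Afin n : mu (A n) < +oo.
  have [_ _] := tL1 n; rewrite ge0_integralZl_EFin//; last first.
    by exact: measurable_EFin_indic.
  rewrite integral_indic// setIT !ltey; apply: contra => /eqP ->.
  by rewrite gt0_muley// lte_fin.
have -> : f = (fun x => \sum_(n <oo) (n.+1%:R^-1%:E * (\1_(A n) x)%:E)) by exact/funext.
apply: Psum => //; first by move=> n; apply: PZ => //; [exact: nnL1_indic|exact: Pindic].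
by rewrite (_ : (fun x => _) = f)//; exact/esym/funext.
Qed.
End Induction.

(** * Countably additive functionals *)

Section NNLinear.
Variables (R : realType) (G : topologicalZmodType).
Variable mu : {measure set (borel G) -> \bar R}.
Hypothesis hG : lca G.
Hypothesis hmu : haar_measure mu.
Local Open Scope ereal_scope.

(** Nonnegative functionals, linear over nonnegative scalars and countably additive,
that do not see null sets: the properties of an iterated integral, as a function of
one of its arguments, that [nnL1_ind] needs. *)
Definition nnlinear (L : (borel G -> \bar R) -> \bar R) :=
  [/\ forall f, nnL1 mu f -> 0 <= L f,
      forall (c : R) f, (0 <= c)%R -> nnL1 mu f -> L (fun x => c%:E * f x) = c%:E * L f,
      forall f : nat -> borel G -> \bar R, (forall n, nnL1 mu (f n)) ->
        nnL1 mu (fun x => \sum_(n <oo) f n x) ->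
        L (fun x => \sum_(n <oo) f n x) = \sum_(n <oo) L (f n) &
      forall f g, nnL1 mu f -> nnL1 mu g -> ae_eq mu setT f g -> L f = L g].

Lemma nnlinear_le_compact (L1 L2 : (borel G -> \bar R) -> \bar R) :
  nnlinear L1 -> nnlinear L2 ->
  (forall K : set G, compact K -> L1 (fun x => (\1_K x)%:E) <= L2 (fun x => (\1_K x)%:E)) ->
  forall f, nnL1 mu f -> L1 f <= L2 f.
Proof.
move=> [L1_0 L1Z L1S L1e] [L2_0 L2Z L2S L2e] L12; apply: (nnL1_ind hG hmu) => //.
- by move=> c f c0 fL1 fL; rewrite L1Z// L2Z//; apply: lee_wpmul2l.
- by move=> f fL1 fL sL1; rewrite L1S// L2S//; apply: lee_nneseries => [n _ _|n _]; [exact: L1_0|exact: fL].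
- by move=> f g fL1 gL1 fg fL; rewrite -(L1e _ _ fL1)// -(L2e _ _ fL1).
Qed.

Lemma nnlinearD (L : (borel G -> \bar R) -> \bar R) f g : nnlinear L ->
  nnL1 mu f -> nnL1 mu g -> nnL1 mu (fun x => f x + g x) ->
  L (fun x => f x + g x) = L f + L g.
Proof.
move=> [L0 LZ LS Le] fL1 gL1 fgL1.
have [mf f0 _] := fL1; have [mg g0 _] := gL1.
(* A finite sum is a series with zero terms, so that countable additivity
   contains additivity. *)
pose u (n : nat) : borel G -> \bar R := if n is n'.+1 then if n' is 0%N then g else (fun=> 0) else f.
have zL1 : nnL1 mu (fun=> 0).
  by split; [exact: measurable_cst|by []|rewrite integral0].
have L00 : L (fun=> 0) = 0.
  transitivity (L (fun x => 0%:E * f x)); last by rewrite LZ// mul0e.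
  by congr L; apply/funext => x; rewrite mul0e.
have uL1 n : nnL1 mu (u n) by case: n => [|[|n]].
have sE : (fun x => f x + g x) = (fun x => \sum_(n <oo) u n x).
  apply/funext => x; rewrite (nneseries_split 0 2)/=; last by move=> n _; have [_ ] := uL1 n.
  rewrite [X in _ = _ + X]eseries0 ?adde0; last by move=> [|[|n]].
  by rewrite big_nat_recl// big_nat1.
rewrite sE LS//; last by rewrite -sE.
rewrite (nneseries_split 0 2)/=; last by move=> n _; exact: L0.
rewrite [X in _ + X = _]eseries0 ?adde0; last by move=> [|[|n]].
by rewrite big_nat_recl// big_nat1.
Qed.

Lemma nnlinear_add (L1 L2 : (borel G -> \bar R) -> \bar R) : nnlinear L1 -> nnlinear L2 ->
  nnlinear (fun f => L1 f + L2 f).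
Proof.
move=> [L1_0 L1Z L1S L1e] [L2_0 L2Z L2S L2e]; split.
- by move=> f fL1; rewrite adde_ge0 ?L1_0 ?L2_0.
- by move=> c f c0 fL1; rewrite L1Z// L2Z// ge0_muleDr ?L1_0 ?L2_0.
- move=> f fL1 sL1; rewrite L1S// L2S// nneseriesD//.
    by move=> n _ _; exact: L1_0.
  by move=> n _ _; exact: L2_0.
- by move=> f g fL1 gL1 fg; rewrite (L1e _ _ fL1 gL1 fg) (L2e _ _ fL1 gL1 fg).
Qed.

(** The form in which convolutions and their adjoints are functionals: [s] is a
translation, or a translation composed with inversion. *)
Lemma nnlinear_comp (s : borel G -> borel G) (psi : borel G -> \bar R) :
  measurable_fun [set: borel G] s ->
  (forall P : borel G -> Prop, {ae mu, forall x, P x} -> {ae mu, forall x, P (s x)}) ->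
  measurable_fun [set: borel G] psi -> (forall x, 0 <= psi x) ->
  nnlinear (fun f => \int[mu]_z (f (s z) * psi z)).
Proof.
move=> ms aes mpsi psi0.
have mfs f : nnL1 mu f -> measurable_fun [set: borel G] (fun z => f (s z) * psi z).
  by move=> [mf _ _]; apply: emeasurable_funM => //; exact: measurableT_comp.
have fs0 f z : nnL1 mu f -> 0 <= f (s z) * psi z by move=> [_ f0 _]; exact: mule_ge0.
split.
- by move=> f fL1; apply: integral_ge0 => z _; exact: fs0.
- move=> c f c0 fL1; transitivity (\int[mu]_z (c%:E * (f (s z) * psi z))).
    by apply: eq_integral => z _; rewrite muleA.
  by apply: ge0_integralZl_EFin => // [z _|]; [exact: fs0|exact: mfs].
- move=> f fL1 _; transitivity (\int[mu]_z (\sum_(n <oo) f n (s z) * psi z)).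
    by apply: eq_integral => z _; rewrite nneseriesMr// => n; case: (fL1 n).
  by apply: integral_nneseries => // [n|n z _]; [exact: mfs|exact: fs0].
- move=> f g fL1 gL1 fg; apply: ge0_ae_eq_integral => //; try exact: mfs.
  + by move=> z _; exact: fs0.
  + by move=> z _; exact: fs0.
  + by apply: filterS (aes _ fg) => z /= /(_ I) ->.
Qed.

Lemma nnlinear_integral (psi : borel G -> \bar R) : measurable_fun [set: borel G] psi ->
  (forall x, 0 <= psi x) -> nnlinear (fun f => \int[mu]_z (f z * psi z)).
Proof. by move=> mpsi psi0; exact: (nnlinear_comp (@measurable_id _ _ _)). Qed.

Lemma nnL1_restrict (A : set (borel G)) f : measurable A -> nnL1 mu f ->
  nnL1 mu (fun x => f x * (\1_A x)%:E).
Proof.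
move=> mA fL1; have [mf f0 _] := fL1.
apply: (nnL1_le _ _ _ fL1).
- by apply: emeasurable_funM => //; exact: measurable_EFin_indic.
- by move=> x; rewrite mule_ge0.
- move=> x; rewrite indicE; case: (x \in A); rewrite ?mule1 ?mule0//.
Qed.

(** A compact set is covered by finitely many translates of [W]; cutting a function
along them reduces the comparison to functions that live on one translate, where
an integrand that depends continuously on its argument is nearly constant. *)
Lemma nnlinear_le_local (W : set G) (L1 L2 : (borel G -> \bar R) -> \bar R) :
  open W -> W 0%R -> nnlinear L1 -> nnlinear L2 ->
  (forall z0 f, nnL1 mu f -> (forall x : G, ~ W (x - z0)%R -> f x = 0) -> L1 f <= L2 f) ->
  forall f, nnL1 mu f -> L1 f <= L2 f.
Proof.
move=> oW W0 hL1 hL2 L12.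
have H (s : seq G) f : nnL1 mu f ->
    (forall x : G, (forall z, z \in s -> ~ W (x - z)%R) -> f x = 0) -> L1 f <= L2 f.
  elim: s f => [|z0 s IH] f fL1 f0.
    by apply: (L12 0%R) => // x _; exact: f0.
  pose A : set (borel G) := [set x : G | W (x - z0)%R].
  have mA : measurable A.
    by have := measurable_addl (- z0)%R measurableT (open_borel oW); rewrite setTI /A /preimage;
     under eq_set do rewrite addrC.
  pose f1 x := f x * (\1_A x)%:E; pose f2 x := f x * (\1_(~` A) x)%:E.
  have mCA : measurable (~` A) by exact: measurableC.
  have f1L1 : nnL1 mu f1 by exact: nnL1_restrict.
  have f2L1 : nnL1 mu f2 by exact: nnL1_restrict.
  have fE : f = (fun x => f1 x + f2 x).
    apply/funext => x; rewrite /f1 /f2 !indicE in_setC.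
    by case: (x \in A); rewrite /= ?mule1 ?mule0 ?adde0 ?add0e.
  rewrite fE in fL1 *; rewrite (nnlinearD hL1)// (nnlinearD hL2)//; apply: leeD.
    apply: (L12 z0) => // x nW; rewrite /f1 indicE (_ : (x \in A) = false) ?mule0//.
    by apply/negbTE; rewrite notin_setE.
  apply: IH => // x nW; rewrite /f2 indicE in_setC; have [xA|xA] := boolP (x \in A).
    by rewrite mule0.
  rewrite f0 ?mul0e// => z; rewrite inE => /orP[/eqP -> Wxz|/nW//].
  by move/negP: xA; apply; rewrite inE.
apply: (nnlinear_le_compact hL1 hL2) => K cK.
have [s sK] := compact_translates cK oW W0.
apply: (H s) => [|x xs]; first exact: nnL1_compact.
rewrite indicE; case: (boolP (x \in K)) => //; rewrite inE => /sK[z zs Wxz].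
by exfalso; apply: (xs z).
Qed.
End NNLinear.

(** * Continuity of translation *)

Section Shift.
Variables (R : realType) (G : topologicalZmodType).
Variable mu : {measure set (borel G) -> \bar R}.
Hypothesis hG : lca G.
Hypothesis hmu : haar_measure mu.

Definition shift_set (y : G) (A : set G) : set G := [set z | A (y + z)].

Lemma measurable_shift_set (y : G) (A : set G) : measurable (A : set (borel G)) ->
  measurable (shift_set y A : set (borel G)).
Proof.
move=> mA; have := measurable_addl y measurableT mA; by rewrite setTI.
Qed.

Lemma haar_shift_set (y : G) (A : set G) : measurable (A : set (borel G)) ->
  mu (shift_set y A) = mu A.
Proof. by move=> mA; exact: (haar_preimage_addl hmu y mA). Qed.

Lemma haar_ae_addl (y : G) (P : borel G -> Prop) :
  {ae mu, forall x, P x} -> {ae mu, forall x : borel G, P (y + (x : G))}.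
Proof.
move=> [N [mN N0 subN]]; exists (shift_set y N); split.
- exact: measurable_shift_set.
- by rewrite haar_shift_set.
- by move=> x /= h; exact: subN.
Qed.

Lemma near_sub (W : set G) (y0 : G) : open W -> W 0 ->
  \forall y \near y0, W (y - y0) /\ W (y0 - y).
Proof.
move=> oW W0.
have W1 : \forall y \near y0, W (- y0 + y).
  have := @continuous_addl G (- y0) y0; rewrite /continuous_at /= addNr; apply.
  exact: open_nbhs_nbhs.
have W2 : \forall y \near y0, W (y0 - y).
  have := @continuous_subl G y0 y0; rewrite /continuous_at /= subrr; apply.
  exact: open_nbhs_nbhs.
by apply: filterS2 W1 W2 => y; rewrite addrC.
Qed.

(** A small translation keeps [K] inside an open set of nearly the same measure. *)
Lemma shift_continuous (K : set G) (A : set (borel G)) : compact K -> measurable A ->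
  continuous (fun y : G => fine (mu (shift_set y K `&` A))).
Proof.
move=> cK mA.
have mK := lca_compact_borel hG cK.
pose m y := mu (shift_set y K `&` A).
have mm y : measurable (shift_set y K `&` A : set (borel G)).
  by apply: measurableI => //; exact: measurable_shift_set.
have mfin y : (m y < +oo)%E.
  apply: le_lt_trans (haar_compact_fin hmu cK).
  rewrite -(haar_shift_set y mK); apply: le_measure; rewrite ?inE//; exact: measurable_shift_set.
have fm y : m y \is a fin_num by rewrite ge0_fin_numE.
move=> y0; apply/cvgrPdist_le => e e0.
have [U [oU KU Ufin UKe]] := haar_outer_compact hG hmu cK e0.
have [W [oW W0 WU]] := compact_tube cK oU KU.
have mU : measurable (U : set (borel G)) by exact: open_borel.
have key a b : W (b - a) -> (m b <= m a + e%:E)%E.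
  move=> Wba.
  have mUK : measurable (U `\` K : set (borel G)) by exact: measurableD.
  have mD := measurable_shift_set a mUK.
  have De : (mu (shift_set a (U `\` K)) <= e%:E)%E by rewrite ltW// haar_shift_set.
  apply: le_trans (leeD2l _ De).
  apply: le_trans (measureU2 _ _ _) => //.
  apply: le_measure; rewrite ?inE//; first exact: measurableU.
  move=> z [/= Kbz Az]; have [Kaz|nKaz] := pselect (K (a + z)); [by left|right; split=> //].
  by have [_] := WU _ _ Wba Kbz; rewrite opprB addrC addrA subrK.
apply: filterS (near_sub y0 oW W0) => y [Wy Wy'] /=.
have fy := fm y; have fy0 := fm y0; rewrite /m in fy fy0.
rewrite ler_distl lerBlDr -!lee_fin !EFinD !fineK//.
by apply/andP; split; exact: key.
Qed.

(** Joint measurability of f(y + z) phi(z) in (y, z) cannot be used, as the product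
sigma-algebra may miss Borel sets of G x G.  On the indicator of a compact set the
integral is a series of continuous functions of [y], by [shift_continuous], and
measurability passes to all [f] by induction. *)
Lemma measurable_shift_integral (f phi : borel G -> \bar R) : nnL1 mu f ->
  measurable_fun [set: borel G] phi -> (forall x, 0 <= phi x)%E ->
  measurable_fun [set: borel G] (fun y : borel G => \int[mu]_z (f ((y : G) + z)%R * phi z))%E.
Proof.
move=> + mphi phi0; move: f.
have L (y : G) := nnlinear_comp (measurable_addl y) (haar_ae_addl y) mphi phi0.
apply: (nnL1_ind hG hmu).
- move=> K cK; have [A [mA phiE]] := nn_indic_series mphi phi0.
  have mK := lca_compact_borel hG cK.
  rewrite (_ : (fun y => _) = (fun y : borel G =>
      \sum_(n <oo) n.+1%:R^-1%:E * (fine (mu (shift_set y K `&` A n)))%:E)%E).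
    apply: ge0_emeasurable_sum => n //.
    move=> _; apply: measurable_funeM; apply/measurable_EFinP.
    apply: continuous_borel_real; exact: shift_continuous.
  apply/funext => y; under eq_integral do rewrite phiE.
  have mKy := measurable_shift_set y mK.
  rewrite (ge0_integral_seriesM mu (c := fun n => n.+1%:R^-1) (u := fun n x => (\1_(A n) x)%:E)
    (h := fun z => (\1_K (y + z))%:E))//; last 2 first.
  - by move=> n; exact: measurable_EFin_indic.
  - exact: (measurable_EFin_indic mKy).
  apply: eq_eseriesr => n _; congr (_ * _)%E.
  have mI : measurable (shift_set y K `&` A n : set (borel G)) by exact: measurableI.
  transitivity (\int[mu]_z (\1_(shift_set y K `&` A n) z)%:E)%E.
    apply: eq_integral => z _; rewrite -EFinM !indicE -natrM mulnb; congr (nat_of_bool _)%:R%:E.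
    by rewrite in_setI; congr (_ && _); apply/idP/idP; rewrite !inE.
  rewrite integral_indic// setIT fineK// ge0_fin_numE//.
  apply: le_lt_trans (haar_compact_fin hmu cK).
  by rewrite -(haar_shift_set y mK); apply: le_measure; rewrite ?inE.
- move=> c f c0 fL1 IH.
  rewrite (_ : (fun y => _) = (fun y : borel G => c%:E * \int[mu]_z (f ((y : G) + z)%R * phi z))%E).
    exact: measurable_funeM.
  by apply/funext => y; have [_ LZ _ _] := L y; exact: LZ.
- move=> f fL1 IH sL1.
  rewrite (_ : (fun y => _) = (fun y : borel G => \sum_(n <oo) \int[mu]_z (f n ((y : G) + z)%R * phi z))%E).
    apply: ge0_emeasurable_sum => n // x _ _; have [+ _ _ _] := L x; exact.
  by apply/funext => y; have [_ _ LS _] := L y; exact: LS.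
- move=> f g fL1 gL1 fg.
  rewrite (_ : (fun y => _) = (fun y : borel G => \int[mu]_z (f ((y : G) + z)%R * phi z))%E)//.
  by apply/funext => y; have [_ _ _ Le] := L y; rewrite (Le _ _ fL1 gL1 fg).
Qed.
End Shift.

(** * Exchange of integrals for convolutions *)

Lemma lee_addl_cancel (R : realType) (a b a1 b1 a2 b2 : \bar R) :
  a = (a1 + a2)%E -> b = (b1 + b2)%E -> (a <= b)%E -> (b2 <= a2)%E -> a2 \is a fin_num ->
  (a1 <= b1)%E.
Proof.
move=> -> -> ab ba2 fa2; have := le_trans ab (leeD2l _ ba2); by rewrite leeD2rE.
Qed.

Section Tonelli.
Variables (R : realType) (G : topologicalZmodType).
Variable mu : {measure set (borel G) -> \bar R}.
Hypothesis hG : lca G.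
Hypothesis hmu : haar_measure mu.
Local Open Scope ereal_scope.
Local Notation ind E := (fun x => (\1_E x)%:E).

Definition econv (f g : G -> \bar R) (y : G) : \bar R := \int[mu]_z (f z * g (y - z)%R).

(** The adjoint of convolution by [g]: [tonelli] moves [g] from [f] to [k]. *)
Definition corr (g k : G -> \bar R) (z : G) : \bar R := \int[mu]_y (g (y - z)%R * k y).

Lemma measurable_comp_subl (g : borel G -> \bar R) (y : G) :
  measurable_fun [set: borel G] g ->
  measurable_fun [set: borel G] (fun z : borel G => g (y - (z : G))%R).
Proof. by move=> mg; apply: (measurableT_comp mg); exact: measurable_subl. Qed.

Lemma measurable_comp_subr (g : borel G -> \bar R) (z : G) :
  measurable_fun [set: borel G] g ->
  measurable_fun [set: borel G] (fun y : borel G => g ((y : G) - z)%R).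
Proof. by move=> mg; exact: (measurableT_comp mg (measurable_subr z)). Qed.

Lemma econv_ge0 (f g : borel G -> \bar R) y :
  (forall x, 0 <= f x) -> (forall x, 0 <= g x) -> 0 <= econv f g y.
Proof. by move=> f0 g0; apply: integral_ge0 => z _; rewrite mule_ge0. Qed.

Lemma corr_ge0 (f g : borel G -> \bar R) y :
  (forall x, 0 <= f x) -> (forall x, 0 <= g x) -> 0 <= corr f g y.
Proof. by move=> f0 g0; apply: integral_ge0 => z _; rewrite mule_ge0. Qed.

Lemma measurable_econv (f g : borel G -> \bar R) : nnL1 mu f ->
  measurable_fun [set: borel G] g -> (forall x, 0 <= g x) ->
  measurable_fun [set: borel G] (econv f g : borel G -> \bar R).
Proof.
move=> fL1 mg g0.
rewrite (_ : (econv f g : borel G -> \bar R) =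
   fun y => \int[mu]_z (f ((y : G) + z)%R * g (0 - z)%R)).
  apply: (measurable_shift_integral hG hmu fL1); last by [].
  exact: measurable_comp_subl.
apply/funext => y; rewrite /econv -(@haar_integral_addl _ _ _ hmu y).
- by apply: eq_integral => z _; rewrite opprD addrA subrr.
- by apply: emeasurable_funM; [case: fL1|exact: measurable_comp_subl].
- by move=> z; rewrite mule_ge0//; case: fL1.
Qed.

Lemma measurable_corr (g k : borel G -> \bar R) : nnL1 mu g ->
  measurable_fun [set: borel G] k -> (forall x, 0 <= k x) ->
  measurable_fun [set: borel G] (corr g k : borel G -> \bar R).
Proof.
move=> gL1 mk k0.
have := measurable_comp_subl 0%R (measurable_shift_integral hG hmu gL1 mk k0).
rewrite (_ : (fun z => _) = corr g k)//.
by apply/funext => z; apply: eq_integral => y _; rewrite sub0r addrC.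
Qed.

Lemma nnlinear_mix (L : borel G -> (borel G -> \bar R) -> \bar R) (psi : borel G -> \bar R) :
  (forall y, nnlinear mu (L y)) ->
  (forall f, nnL1 mu f -> measurable_fun [set: borel G] (L ^~ f)) ->
  measurable_fun [set: borel G] psi -> (forall x, 0 <= psi x) ->
  nnlinear mu (fun f => \int[mu]_y (psi y * L y f)).
Proof.
move=> Ly mL mpsi psi0.
have L0 y f : nnL1 mu f -> 0 <= L y f by have [+ _ _ _] := Ly y; exact.
split.
- by move=> f fL1; apply: integral_ge0 => y _; rewrite mule_ge0// L0.
- move=> c f c0 fL1; transitivity (\int[mu]_y (c%:E * (psi y * L y f))).
    by apply: eq_integral => y _; have [_ -> // _ _] := Ly y; rewrite muleCA.
  apply: ge0_integralZl_EFin => //.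
  + by move=> y _; rewrite mule_ge0// L0.
  + by apply: emeasurable_funM => //; exact: mL.
- move=> f fL1 sL1; transitivity (\int[mu]_y (\sum_(n <oo) psi y * L y (f n))).
    by apply: eq_integral => y _; have [_ _ -> // _] := Ly y; rewrite nneseriesMl// => n; exact: L0.
  apply: integral_nneseries => //.
  + by move=> n; apply: emeasurable_funM => //; exact: mL.
  + by move=> n y _; rewrite mule_ge0// L0.
- move=> f g' fL1 gL1 fg; apply: eq_integral => y _.
  by have [_ _ _ Le] := Ly y; rewrite (Le _ _ fL1 gL1 fg).
Qed.

Lemma nnlinear_econvl (g k : borel G -> \bar R) :
  measurable_fun [set: borel G] g -> (forall x, 0 <= g x) ->
  measurable_fun [set: borel G] k -> (forall x, 0 <= k x) ->
  nnlinear mu (fun f => \int[mu]_y (k y * econv f g y)).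
Proof.
move=> mg g0 mk k0; apply: (nnlinear_mix (L := fun y f => econv f g y) _ _ mk k0).
  by move=> y; apply: nnlinear_integral; [exact: measurable_comp_subl|].
by move=> f fL1; exact: measurable_econv.
Qed.

Lemma nnlinear_corrl (g k : borel G -> \bar R) : nnL1 mu g ->
  measurable_fun [set: borel G] k -> (forall x, 0 <= k x) ->
  nnlinear mu (fun f => \int[mu]_z (f z * corr g k z)).
Proof.
move=> gL1 mk k0; apply: nnlinear_integral; first exact: measurable_corr.
by move=> x; apply: corr_ge0 => // y; case: gL1.
Qed.

Lemma nnL1_small_cst (f : borel G -> \bar R) (e : R) : (0 < e)%R -> nnL1 mu f ->
  exists2 d : R, (0 < d)%R & \int[mu]_z (f z * d%:E) <= e%:E.
Proof.
move=> e0 [mf f0 ffin].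
have c0 : 0 <= \int[mu]_z f z by exact: integral_ge0.
have cfin : \int[mu]_z f z \is a fin_num by rewrite ge0_fin_numE.
have c1 : (0 < fine (\int[mu]_z f z) + 1)%R by rewrite ltr_wpDl// fine_ge0.
exists (e / (fine (\int[mu]_z f z) + 1))%R; first by rewrite divr_gt0.
rewrite ge0_integralZr//; last by rewrite lee_fin divr_ge0// ltW.
rewrite -(fineK cfin) -EFinM lee_fin mulrA ler_pdivrMr// mulrC ler_wpM2l//; first exact: ltW.
by rewrite lerDl.
Qed.

Section BoundedTest.
Variable k : borel G -> \bar R.
Hypothesis mk : measurable_fun [set: borel G] k.
Hypothesis k0 : forall y, 0 <= k y.
Hypothesis k1 : forall y, k y <= 1.

(** A translate of [E1] lies in a translate of [E2], and they differ by a set of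
measure at most [e]. *)
Lemma corr_indic_le (E1 E2 : set G) (a b : G) (e : R) :
  measurable (E1 : set (borel G)) -> measurable (E2 : set (borel G)) -> mu E1 < +oo ->
  mu E2 <= mu E1 + e%:E ->
  (forall y : G, E1 (y - a)%R -> E2 (y - b)%R) ->
  corr (ind E2) k b <= corr (ind E1) k a + e%:E.
Proof.
move=> mE1 mE2 E1fin E2E1 E12.
pose S1 : set (borel G) := shift_set (- a)%R E1; pose S2 : set (borel G) := shift_set (- b)%R E2.
have mS1 : measurable S1 by exact: measurable_shift_set.
have mS2 : measurable S2 by exact: measurable_shift_set.
have S12 : S1 `<=` S2 by move=> y; rewrite /S1 /S2 /shift_set /= addrC [X in _ -> E2 X]addrC; exact: E12.
have mD : measurable (S2 `\` S1) by exact: measurableD.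
have muD : mu (S2 `\` S1) <= e%:E.
  have S1E : mu S1 = mu E1 by exact: haar_shift_set.
  have S2E : mu S2 = mu E2 by exact: haar_shift_set.
  have := measureDI mu mS2 mS1; rewrite (setIidr S12) => E.
  move: E2E1; have S1f : mu S1 \is a fin_num by rewrite S1E ge0_fin_numE.
  by rewrite -S2E -S1E E [leRHS]addeC leeD2rE.
have corrE (E : set G) (c : G) : corr (ind E) k c =
    \int[mu]_y ((\1_(shift_set (- c)%R E) y)%:E * k y).
  apply: eq_integral => y _; congr (_%:E * _); rewrite !indicE; congr (nat_of_bool _)%:R.
  by apply/idP/idP; rewrite !inE /shift_set /= addrC.
rewrite !corrE -/S1 -/S2.
have muDk : \int[mu]_y ((\1_(S2 `\` S1) y)%:E * k y) <= e%:E.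
  apply: le_trans muD; rewrite -[X in mu X]setIT -(integral_indic mu measurableT mD).
  apply: ge0_le_integral => //.
  - by move=> y _; rewrite mule_ge0.
  - by apply: emeasurable_funM => //; exact: measurable_EFin_indic.
  - exact: measurable_EFin_indic.
  - by move=> y _; rewrite -[leRHS]mule1 lee_wpmul2l.
apply: le_trans (leeD2l _ muDk).
have mEk (E : set (borel G)) : measurable E ->
    measurable_fun [set: borel G] (fun y => (\1_E y)%:E * k y).
  by move=> mE; apply: (emeasurable_funM _ mk); exact: measurable_EFin_indic.
have Ek0 (E : set (borel G)) y : 0 <= (\1_E y)%:E * k y by rewrite mule_ge0.
rewrite -(ge0_integralD mu measurableT _ (mEk _ mS1) _ (mEk _ mD))//.
apply: (ge0_le_integral mu measurableT).
- by move=> y _; exact: Ek0.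
- exact: mEk.
- by apply: emeasurable_funD; exact: mEk.
- move=> y _; rewrite -ge0_muleDl// lee_wpmul2r// -EFinD lee_fin !indicE in_setD.
  by case: (y \in S1); case: (y \in S2); rewrite ?addr0 ?add0r.
Qed.

(** If [f] lives on the translate of [W] by [z0], both iterated integrals are close to
(integral of f) times [corr (ind E) k z0].  Indeed, where f(z) <> 0, translations by
z - z0 and by z0 - z map [E1] into [E2], so E1 + z lies in E2 + z0 and E1 + z0 lies
in E2 + z. *)
Lemma tonelli_local (W E1 E2 : set G) (e : R) (z0 : G) (f : borel G -> \bar R) :
  measurable (E1 : set (borel G)) -> measurable (E2 : set (borel G)) -> mu E1 < +oo ->
  (0 <= e)%R -> mu E2 <= mu E1 + e%:E ->
  (forall w x : G, W w -> E1 x -> E2 (x + w)%R /\ E2 (x - w)%R) ->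
  nnL1 mu f -> (forall x : G, ~ W (x - z0)%R -> f x = 0) ->
  \int[mu]_y (econv f (ind E1) y * k y) <=
    \int[mu]_z (f z * corr (ind E1) k z) + \int[mu]_z (f z * e%:E) /\
  \int[mu]_z (f z * corr (ind E2) k z) <=
    \int[mu]_y (econv f (ind E2) y * k y) + \int[mu]_z (f z * e%:E).
Proof.
move=> mE1 mE2 E1fin e0 E2E1 EW fL1 fW; have [mf f0 ffin] := fL1.
have E2fin : mu E2 < +oo by apply: le_lt_trans E2E1 _; rewrite lte_add_pinfty// ltry.
have L1E (E : set G) : measurable (E : set (borel G)) -> mu E < +oo ->
    nnL1 mu (fun x : borel G => (\1_E x)%:E) by exact: nnL1_indic.
have mcorr (E : set G) : measurable (E : set (borel G)) -> mu E < +oo ->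
    measurable_fun [set: borel G] (corr (ind E) k : borel G -> \bar R).
  by move=> mE Efin; apply: measurable_corr => //; exact: L1E.
have corr0 (E : set G) z : 0 <= corr (ind E) k z.
  by apply: corr_ge0 => // x; rewrite lee_fin.
have mconv (E : set G) : measurable (E : set (borel G)) ->
    measurable_fun [set: borel G] (econv f (ind E) : borel G -> \bar R).
  by move=> mE; apply: measurable_econv => //; exact: measurable_EFin_indic.
have conv0 (E : set G) z : 0 <= econv f (ind E) z.
  by apply: econv_ge0 => // x; rewrite lee_fin.
have msub (E : set G) z : measurable (E : set (borel G)) ->
    measurable_fun [set: borel G] (fun y : borel G => (\1_E ((y : G) - z)%R)%:E : \bar R).
  by move=> mE; apply: (@measurable_comp_subr (ind E)); exact: measurable_EFin_indic.
have msubl (E : set G) y : measurable (E : set (borel G)) ->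
    measurable_fun [set: borel G] (fun z : borel G => (\1_E (y - (z : G))%R)%:E : \bar R).
  by move=> mE; apply: (@measurable_comp_subl (ind E)); exact: measurable_EFin_indic.
pose c := \int[mu]_z f z.
have c0 : 0 <= c by exact: integral_ge0.
have fE z : f z != 0 -> W (z - z0)%R.
  by move=> /eqP fz; apply: contrapT => nW; apply: fz; exact: fW.
have intc (E : set G) : measurable (E : set (borel G)) ->
    \int[mu]_y (c * (\1_E (y - z0)%R)%:E * k y) = c * corr (ind E) k z0.
  move=> mE; transitivity (\int[mu]_y (c * ((\1_E (y - z0)%R)%:E * k y))).
    by apply: eq_integral => y _; rewrite muleA.
  apply: ge0_integralZl => //.
  + by apply: emeasurable_funM => //; exact: msub.
  + by move=> y _; rewrite mule_ge0// lee_fin.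
have mck (E : set G) : measurable (E : set (borel G)) ->
    measurable_fun [set: borel G] (fun y : borel G => c * (\1_E ((y : G) - z0)%R)%:E * k y).
  by move=> mE; apply: (emeasurable_funM _ mk); apply: measurable_funeM; exact: msub.
have mfcorr (E : set G) : measurable (E : set (borel G)) -> mu E < +oo ->
    measurable_fun [set: borel G] (fun z : borel G => f z * corr (ind E) k z).
  by move=> mE Efin; apply: (emeasurable_funM mf); exact: mcorr.
have fcorr0 (E : set G) z : 0 <= f z * corr (ind E) k z by rewrite mule_ge0.
have intf (a : \bar R) : 0 <= a -> c * a = \int[mu]_z (f z * a).
  by move=> a0; rewrite ge0_integralZr.
have mfe : measurable_fun [set: borel G] (fun z => f z * e%:E).
  by apply: emeasurable_funM => //; exact: measurable_cst.
have fe0 z : 0 <= f z * e%:E by rewrite mule_ge0// lee_fin.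
split.
- apply: (@le_trans _ _ (c * corr (ind E2) k z0)).
    rewrite -(intc _ mE2); apply: (ge0_le_integral mu measurableT).
    + by move=> y _; rewrite mule_ge0.
    + by apply: (emeasurable_funM _ mk); exact: mconv.
    + exact: mck.
    + move=> y _; rewrite lee_wpmul2r//.
      have [yE|yE] := boolP ((y - z0)%R \in E2).
        rewrite indicE yE mule1; apply: ge0_le_integral => //.
        * by move=> z _; rewrite mule_ge0// lee_fin.
        * by apply: emeasurable_funM => //; exact: msubl.
        * move=> z _; rewrite -[leRHS]mule1 lee_wpmul2l// lee_fin indicE.
          by case: (_ \in _).
      rewrite indicE (negbTE yE) mule0 [leLHS]integral0_eq// => z _.
      have [->|/fE Wz] := eqVneq (f z) 0; first by rewrite mul0e.
      rewrite indicE; have [yzE|_] := boolP (_ \in _); last by rewrite mule0.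
      move: yzE; rewrite inE => /(EW _ _ Wz)[+ _]; rewrite addrA subrK => yE2.
      by move: yE; rewrite notin_setE.
  rewrite (intf _ (corr0 E2 z0)) -(ge0_integralD mu measurableT _ (mfcorr _ mE1 E1fin) _ mfe)//.
  apply: (ge0_le_integral mu measurableT).
  + by move=> z _; rewrite mule_ge0.
  + by apply: (emeasurable_funM mf); exact: measurable_cst.
  + by apply: emeasurable_funD mfe; exact: mfcorr.
  + move=> z _; rewrite -ge0_muleDr// ?lee_fin//.
    have [->|/fE Wz] := eqVneq (f z) 0; first by rewrite !mul0e.
    rewrite lee_wpmul2l//; apply: corr_indic_le => // y yE1.
    by have [+ _] := EW _ _ Wz yE1; rewrite addrA subrK.
- apply: (@le_trans _ _ (c * corr (ind E1) k z0 + \int[mu]_z (f z * e%:E))).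
    have mfc : measurable_fun [set: borel G] (fun z => f z * corr (ind E1) k z0).
      by apply: (emeasurable_funM mf); exact: measurable_cst.
    have fc0 z : 0 <= f z * corr (ind E1) k z0 by rewrite mule_ge0.
    rewrite (intf _ (corr0 E1 z0)) -(ge0_integralD mu measurableT _ mfc _ mfe)//.
    apply: (ge0_le_integral mu measurableT).
    + by move=> z _; exact: fcorr0.
    + exact: mfcorr.
    + exact: emeasurable_funD.
    + move=> z _; rewrite -ge0_muleDr// ?lee_fin//.
      have [->|/fE Wz] := eqVneq (f z) 0; first by rewrite !mul0e.
      rewrite lee_wpmul2l//; apply: corr_indic_le => // y yE1.
      by have [_] := EW _ _ Wz yE1; rewrite opprB addrA subrK.
  apply: leeD2r; rewrite -(intc _ mE1); apply: (ge0_le_integral mu measurableT).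
  + by move=> y _; rewrite mule_ge0// mule_ge0// lee_fin.
  + exact: mck.
  + by apply: (emeasurable_funM _ mk); exact: mconv.
  + move=> y _; rewrite lee_wpmul2r//.
    rewrite indicE; have [yE|_] := boolP (_ \in E1); last by rewrite mule0.
    rewrite mule1; apply: ge0_le_integral => //.
    * by apply: emeasurable_funM => //; exact: msubl.
    * move=> z _; have [->|/fE Wz] := eqVneq (f z) 0; first by rewrite mul0e.
      move: yE; rewrite inE => /(EW _ _ Wz)[_]; rewrite opprB addrA subrK => yzE.
      by rewrite indicE mem_set// mule1.
Qed.
(** Both errors are proportional to the integral of [f], hence additive in [f], so the
restriction on the support of [f] disappears by [nnlinear_le_local]. *)
Lemma tonelli_approx (W E1 E2 : set G) (e : R) (f : borel G -> \bar R) :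
  open W -> W 0%R ->
  measurable (E1 : set (borel G)) -> measurable (E2 : set (borel G)) -> mu E1 < +oo ->
  (0 <= e)%R -> mu E2 <= mu E1 + e%:E ->
  (forall w x : G, W w -> E1 x -> E2 (x + w)%R /\ E2 (x - w)%R) -> nnL1 mu f ->
  \int[mu]_y (k y * econv f (ind E1) y) <=
    \int[mu]_z (f z * corr (ind E1) k z) + \int[mu]_z (f z * e%:E) /\
  \int[mu]_z (f z * corr (ind E2) k z) <=
    \int[mu]_y (k y * econv f (ind E2) y) + \int[mu]_z (f z * e%:E).
Proof.
move=> oW W0 mE1 mE2 E1fin e0 E2E1 EW fL1.
have E2fin : mu E2 < +oo by apply: le_lt_trans E2E1 _; rewrite lte_add_pinfty// ltry.
have PhiN (E : set G) : measurable (E : set (borel G)) ->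
    nnlinear mu (fun f => \int[mu]_y (k y * econv f (ind E) y)).
  by move=> mE; apply: nnlinear_econvl => //; exact: measurable_EFin_indic.
have PsiN (E : set G) : measurable (E : set (borel G)) -> mu E < +oo ->
    nnlinear mu (fun f => \int[mu]_z (f z * corr (ind E) k z)).
  by move=> mE Efin; apply: nnlinear_corrl => //; exact: nnL1_indic.
have eN : nnlinear mu (fun f => \int[mu]_z (f z * e%:E)).
  by apply: (@nnlinear_integral _ _ mu (fun=> e%:E)) => //; exact: measurable_cst.
have T f' z0 := @tonelli_local W E1 E2 e z0 f' mE1 mE2 E1fin e0 E2E1 EW.
split; move: f fL1.
- apply: (nnlinear_le_local hG hmu oW W0 (PhiN _ mE1) (nnlinear_add (PsiN _ mE1 E1fin) eN)).
  move=> z0 f fL1 fW; have [+ _] := T f z0 fL1 fW.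
  by under eq_integral do rewrite muleC.
- apply: (nnlinear_le_local hG hmu oW W0 (PsiN _ mE2 E2fin) (nnlinear_add (PhiN _ mE2) eN)).
  move=> z0 f fL1 fW; have [_] := T f z0 fL1 fW.
  by under [X in _ <= X + _]eq_integral do rewrite muleC.
Qed.

(** [tonelli_approx] compares a set with a slightly larger one.  A compact set has open
neighbourhoods of nearly the same measure, which gives one inequality; an open set
contains compact sets of nearly the same measure, which gives the other one in
[tonelli_open_ge]. *)
Lemma tonelli_compact_le (E : set G) (f : borel G -> \bar R) :
  compact E -> nnL1 mu f ->
  \int[mu]_y (k y * econv f (ind E) y) <=
    \int[mu]_z (f z * corr (ind E) k z).
Proof.
move=> cE fL1; have mE := lca_compact_borel hG cE.
apply/lee_addgt0Pr => e e0; have [d d0 fd] := nnL1_small_cst e0 fL1.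
have [U [oU EU Ufin UEd]] := haar_outer_compact hG hmu cE d0.
have mU := open_borel oU.
have [W [oW W0 EW]] := compact_tube cE oU EU.
have Efin := haar_compact_fin hmu cE.
apply: le_trans (leeD2l _ fd).
apply: (tonelli_approx oW W0 mE mU Efin (ltW d0) _ EW fL1).1.
rewrite (measureDI mu mU mE) (setIidr EU) addeC leeD2l//; exact: ltW.
Qed.

Lemma tonelli_open_ge (O : set G) (f : borel G -> \bar R) :
  open O -> mu O < +oo -> nnL1 mu f ->
  \int[mu]_z (f z * corr (ind O) k z) <=
  \int[mu]_y (k y * econv f (ind O) y).
Proof.
move=> oO Ofin fL1; have mO := open_borel oO.
apply/lee_addgt0Pr => e e0; have [d d0 fd] := nnL1_small_cst e0 fL1.
have [L [cL LO OLd]] := haar_inner hG hmu mO Ofin d0.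
have mL := lca_compact_borel hG cL.
have [W [oW W0 LW]] := compact_tube cL oO LO.
have Lfin := haar_compact_fin hmu cL.
apply: le_trans (leeD2l _ fd).
apply: (tonelli_approx oW W0 mL mO Lfin (ltW d0) _ LW fL1).2.
rewrite (measureDI mu mO mL) (setIidr LO) addeC leeD2l//; exact: ltW.
Qed.

End BoundedTest.

(** Otherwise every compact set, being covered by finitely many translates of [U],
would be null, and so would be the group. *)
Lemma haar_open_gt0 (U : set G) : open U -> U 0%R -> 0 < mu U.
Proof.
move=> oU U0; rewrite lt_neqAle measure_ge0 andbT; apply/negP => /eqP Unull.
have mU := open_borel oU.
have [+ _ _ _] := hmu => /negP; apply; apply/eqP.
apply: (haar_null_compact hmu) => // K cK _; apply/eqP; rewrite eq_le measure_ge0 andbT.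
have mK := lca_compact_borel hG cK.
have [s sK] := compact_translates cK oU U0.
have mS z : measurable (shift_set (- z)%R U : set (borel G)) by exact: measurable_shift_set.
have : mu (\big[setU/set0]_(z <- s) (shift_set (- z)%R U : set (borel G))) = 0.
  elim: s {sK} => [|z s IH]; first by rewrite big_nil measure0.
  rewrite big_cons; apply/eqP; rewrite eq_le measure_ge0 andbT.
  apply: le_trans (measureU2 _ _ _) _ => //.
    by apply: bigsetU_measurable => i _; exact: mS.
  rewrite -[leRHS]adde0; apply: leeD; last exact: (eq_ind_r (fun u => u <= 0) (lexx _) IH).
  have /eqP := haar_shift_set hmu (- z)%R mU; rewrite -Unull eq_le => /andP[+ _]; exact.
move=> <-; apply: le_measure; rewrite ?inE//.
  by apply: bigsetU_measurable => i _; exact: mS.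
move=> x /sK[z zs Uxz]; rewrite -bigcup_seq; exists z => //=.
by rewrite /shift_set /= addrC.
Qed.

(** The measure is not assumed to be invariant under inversion.  Let [K] be compact in
the inverse of [N], so that [C = - K] is null, let [V] be a compact neighbourhood of
0 and [S = V + K].  By [tonelli_compact_le] the convolution of the indicators of [S]
and [C] has integral 0, so it vanishes at some point of [V], which has positive
measure; but at any point of [V] its value is the measure of [K]. *)
Lemma haar_opp_null (N : set G) : measurable (N : set (borel G)) -> mu N = 0 ->
  measurable ([set x | N (- x)%R] : set (borel G)) /\ mu [set x : G | N (- x)%R] = 0.
Proof.
move=> mN N0.
have mNo : measurable ([set x | N (- x)%R] : set (borel G)).
  have := measurable_subl 0%R measurableT mN; rewrite setTI /preimage.
  by under eq_set do rewrite sub0r.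
split => //; apply: (haar_null_compact hmu mNo) => K cK KN.
pose C := [set (- x)%R | x in K].
have cC : compact C by exact: compact_opp.
have mC := lca_compact_borel hG cC.
have mK := lca_compact_borel hG cK.
have C0 : mu C = 0.
  apply/eqP; rewrite eq_le measure_ge0 andbT -N0; apply: le_measure; rewrite ?inE//.
  by move=> _ [x /KN Nx <-].
have [V [cV V0]] := compact_nbhs0 hG.
pose S := [set xy.1 + xy.2 | xy in V `*` K]%R.
have cS : compact S by exact: compact_sum.
have mS := lca_compact_borel hG cS.
have SL1 : nnL1 mu (ind S) by exact: nnL1_compact.
have := tonelli_compact_le (measurable_cst 1) (fun=> lee01) (fun=> lexx 1) cC SL1.
rewrite [X in _ <= X]integral0_eq; last first.
  move=> z _; suff -> : corr (ind C) (cst 1) z = 0.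
    by rewrite mule0.
  rewrite /corr; transitivity (\int[mu]_y (\1_(shift_set (- z)%R C) y)%:E).
    apply: eq_integral => y _; rewrite mule1 !indicE; congr (nat_of_bool _)%:R%:E.
    by apply/idP/idP; rewrite !inE /shift_set /= addrC.
  by rewrite integral_indic ?setIT ?haar_shift_set//; exact: measurable_shift_set.
have mconv : measurable_fun [set: borel G]
    (econv (ind S) (ind C) : borel G -> \bar R).
  apply: measurable_econv => //; by exact: measurable_EFin_indic.
have conv0 y : 0 <= econv (ind S) (ind C) y.
  by apply: econv_ge0 => x; rewrite lee_fin.
under eq_integral do rewrite mul1e.
move=> conv_le0.
have : \int[mu]_y `|econv (ind S) (ind C) y| = 0.
  apply/eqP; rewrite eq_le integral_ge0// andbT.
  by under eq_integral do rewrite gee0_abs//.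
move/(ae_eq_integral_abs _ measurableT mconv) => -[M [mM M0 subM]].
have [y [Vy My]] : exists y, interior V y /\ ~ M y.
  apply: contrapT => /forallNP VM.
  have oV : open (interior V) by exact: open_interior.
  suff : mu (interior V) <= mu M.
    by rewrite leNgt => /negP; apply; rewrite M0 haar_open_gt0//; exact: nbhs_interior.
  apply: le_measure; rewrite ?inE//; first exact: open_borel.
  by move=> y Vy; apply: contrapT => My; apply: (VM y).
have : econv (ind S) (ind C) y = 0.
  by apply: contrapT => ne; apply: My; apply: subM => /= /(_ I); exact: ne.
rewrite /econv => conv_y0.
have : \int[mu]_z (\1_(shift_set (- y)%R K) z)%:E = 0.
  rewrite -conv_y0; apply: eq_integral => z _.
  rewrite -EFinM !indicE -natrM mulnb; congr (nat_of_bool _)%:R%:E.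
  apply/idP/andP; rewrite !inE /shift_set /=.
    move=> Kyz; split; last by exists (- y + z)%R => //; rewrite opprD opprK.
    exists (y, - y + z)%R; last by rewrite /= addrA subrr add0r.
    by split => //=; exact: interior_subset.
  by move=> [_ [x Kx xE]]; rewrite addrC -opprB -xE opprK.
by rewrite integral_indic ?setIT ?haar_shift_set//; exact: measurable_shift_set.
Qed.

Lemma haar_ae_subl (y : G) (P : borel G -> Prop) :
  {ae mu, forall x, P x} -> {ae mu, forall x : borel G, P (y - (x : G))%R}.
Proof.
move=> [N [mN N0 subN]]; have [mNo No0] := haar_opp_null mN N0.
exists (shift_set (- y)%R [set x | N (- x)%R]); split.
- exact: measurable_shift_set.
- by rewrite haar_shift_set.
- by move=> x /= h; rewrite /shift_set /= opprD opprK; exact: subN.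
Qed.

Lemma haar_ae_subr (y : G) (P : borel G -> Prop) :
  {ae mu, forall x, P x} -> {ae mu, forall x : borel G, P ((x : G) - y)%R}.
Proof. by move=> /(haar_ae_addl hmu (- y)%R); apply: filterS => x; rewrite addrC. Qed.

(** Functions of [y - z] respect equality almost everywhere because inversion
preserves null sets; this is why [haar_opp_null] comes before the equality of the
two integrals. *)
Lemma nnlinear_econvr (f k : borel G -> \bar R) : nnL1 mu f ->
  measurable_fun [set: borel G] k -> (forall x, 0 <= k x) ->
  nnlinear mu (fun g => \int[mu]_y (k y * econv f g y)).
Proof.
move=> fL1 mk k0; have [mf f0 _] := fL1.
apply: (nnlinear_mix (L := fun y g => econv f g y) _ _ mk k0) => [y|g [mg g0 _]]; last first.
  exact: measurable_econv.
rewrite (_ : (fun g => _) = (fun g => \int[mu]_z (g (y - (z : G))%R * f z))).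
  exact: (nnlinear_comp (measurable_subl y) (haar_ae_subl y)).
by apply/funext => g; apply: eq_integral => z _; rewrite muleC.
Qed.

Lemma nnlinear_corrr (f k : borel G -> \bar R) : nnL1 mu f ->
  measurable_fun [set: borel G] k -> (forall x, 0 <= k x) ->
  nnlinear mu (fun g => \int[mu]_z (f z * corr g k z)).
Proof.
move=> fL1 mk k0; have [mf f0 _] := fL1.
apply: (nnlinear_mix (L := fun z g => corr g k z) _ _ mf f0) => [z|g gL1]; last exact: measurable_corr.
exact: (nnlinear_comp (measurable_subr z) (haar_ae_subr z)).
Qed.

(** On compact sets one inequality is [tonelli_compact_le], and it extends to all [g].
For the reverse one, enclose a compact [K] in an open [O] of finite measure: the
reverse inequality holds for [O], the first one holds for [O \ K], and the
difference of the two is the claim for [K]. *)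
Lemma tonelli_bounded (f g k : borel G -> \bar R) :
  measurable_fun [set: borel G] k -> (forall x, 0 <= k x) -> (forall x, k x <= 1) -> nnL1 mu f -> nnL1 mu g ->
  \int[mu]_y (k y * econv f g y) =
  \int[mu]_z (f z * corr g k z).
Proof.
move=> mk k0 k1 fL1 gL1; have [mf f0 ffin] := fL1.
have PhiN := nnlinear_econvr fL1 mk k0.
have PsiN := nnlinear_corrr fL1 mk k0.
have le g' : nnL1 mu g' -> \int[mu]_y (k y * econv f g' y) <=
    \int[mu]_z (f z * corr g' k z).
  move: g'; apply: (nnlinear_le_compact hG hmu PhiN PsiN) => K cK.
  exact: tonelli_compact_le.
apply: le_anti; rewrite (le g gL1) andTb; move: g gL1.
apply: (nnlinear_le_compact hG hmu PsiN PhiN) => K cK.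
have mK := lca_compact_borel hG cK.
case: (compact_open_hull hG hmu cK) => O [oO KO Ofin].
have mO := open_borel oO.
have mD : measurable (O `\` K : set (borel G)) by exact: measurableD.
have Dfin : mu (O `\` K) < +oo by apply: le_lt_trans Ofin; apply: le_measure; rewrite ?inE.
have KL1 : nnL1 mu (fun x : borel G => (\1_K x)%:E) by exact: nnL1_compact.
have DL1 : nnL1 mu (fun x : borel G => (\1_(O `\` K) x)%:E) by exact: nnL1_indic.
have OE : (ind O) = (fun x => (\1_K x)%:E + (\1_(O `\` K) x)%:E) :> (borel G -> \bar R).
  apply/funext => x; rewrite -EFinD !indicE in_setD.
  have [xK|xK] := boolP (x \in K); last by rewrite add0r andbT.
  by rewrite (_ : x \in O) ?andbF ?addr0//; move: xK; rewrite !inE; exact: KO.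
have OL1 : nnL1 mu (fun x => (\1_K x)%:E + (\1_(O `\` K) x)%:E) by rewrite -OE; exact: nnL1_indic.
have PsiE := nnlinearD PsiN KL1 DL1 OL1; have PhiE := nnlinearD PhiN KL1 DL1 OL1.
rewrite -OE in PsiE PhiE.
have PsiDfin : \int[mu]_z (f z * corr (ind (O `\` K)) k z) \is a fin_num.
  rewrite ge0_fin_numE; last by have [+ _ _ _] := PsiN; exact.
  apply: (@le_lt_trans _ _ (\int[mu]_z (f z * mu (O `\` K)))); last first.
    by rewrite ge0_integralZr// lte_mul_pinfty ?integral_ge0//; rewrite ge0_fin_numE// integral_ge0.
  apply: ge0_le_integral => //.
  - by move=> z _; rewrite mule_ge0// corr_ge0// => x; rewrite lee_fin.
  - by apply: emeasurable_funM => //; apply: measurable_corr.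
  - by apply: emeasurable_funM => //; exact: measurable_cst.
  - move=> z _; rewrite lee_wpmul2l//.
    have mS : measurable (shift_set (- z)%R (O `\` K) : set (borel G)) by exact: measurable_shift_set.
    rewrite -(haar_shift_set hmu (- z)%R mD) -[X in _ <= mu X]setIT -integral_indic//.
    apply: ge0_le_integral => //.
    + by move=> y _; rewrite mule_ge0.
    + by apply: emeasurable_funM => //; apply: (@measurable_comp_subr (ind (O `\` K))); case: DL1.
    + by exact: measurable_EFin_indic.
    + move=> y _; apply: (@le_trans _ _ ((\1_(O `\` K) (y - z)%R)%:E * 1)).
        by rewrite lee_wpmul2l ?lee_fin.
      rewrite mule1 lee_fin !indicE ler_nat.
      by case: (boolP (_ \in O `\` K)) => //; rewrite inE => h'; rewrite mem_set// /shift_set /= addrC.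
exact: (lee_addl_cancel PsiE PhiE (tonelli_open_ge mk k0 k1 oO Ofin fL1) (le _ DL1)).
Qed.

(** A nonnegative [k] is a series of multiples of indicators, and both sides are
countably additive in [k]. *)
Lemma tonelli (f g k : borel G -> \bar R) : nnL1 mu f -> nnL1 mu g ->
  measurable_fun [set: borel G] k -> (forall x, 0 <= k x) ->
  \int[mu]_y (k y * econv f g y) = \int[mu]_z (f z * corr g k z).
Proof.
move=> fL1 gL1 mk k0; have [mf f0 _] := fL1; have [mg g0 _] := gL1.
have [A [mA kE]] := nn_indic_series mk k0.
pose c n : R := (n.+1%:R^-1)%R; pose u n (x : borel G) : \bar R := (\1_(A n) x)%:E.
have c0 n : (0 <= c n)%R by rewrite /c invr_ge0.
have kE' : k = (fun x => \sum_(n <oo) (c n)%:E * u n x) by apply/funext => x; exact: kE.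
have mu_ n : measurable_fun setT (u n) by exact: measurable_EFin_indic.
have u0 n x : 0 <= u n x by rewrite lee_fin.
have mcorr n : measurable_fun [set: borel G] (corr g (u n) : borel G -> \bar R).
  exact: measurable_corr.
have corrE : corr g k = (fun z => \sum_(n <oo) (c n)%:E * corr g (u n) z).
  apply/funext => z; rewrite /corr kE'.
  apply: (ge0_integral_seriesM mu (h := fun y : borel G => g ((y : G) - z)%R)) => //.
  exact: measurable_comp_subr.
transitivity (\int[mu]_y (econv f g y * \sum_(n <oo) (c n)%:E * u n y)).
  by apply: eq_integral => y _; rewrite muleC kE'.
have mcv : measurable_fun [set: borel G] (econv f g : borel G -> \bar R) by exact: measurable_econv.
rewrite corrE (ge0_integral_seriesM mu c0 mu_ u0 mcv (fun y => econv_ge0 y f0 g0)).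
rewrite (ge0_integral_seriesM mu c0 mcorr (fun n z => corr_ge0 z g0 (u0 n)) mf f0).
apply: eq_eseriesr => n _; congr (_ * _).
rewrite -(tonelli_bounded (mu_ n) (u0 n) _ fL1 gL1); last first.
  by move=> x; rewrite lee_fin indicE; case: (_ \in _).
by apply: eq_integral => y _; rewrite muleC.
Qed.
End Tonelli.

(** * Integrals of complex functions *)

Section ComplexModulus.
Variable R : realType.
Implicit Types a b z : R[i].
Local Notation Re := complex.Re.
Local Notation Im := complex.Im.

Lemma ReD a b : Re (a + b) = Re a + Re b. Proof. by case: a; case: b. Qed.
Lemma ImD a b : Im (a + b) = Im a + Im b. Proof. by case: a; case: b. Qed.
Lemma ReN a : Re (- a) = - Re a. Proof. by case: a. Qed.
Lemma ImN a : Im (- a) = - Im a. Proof. by case: a. Qed.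
Lemma ReM a b : Re (a * b) = Re a * Re b - Im a * Im b.
Proof. by case: a; case: b. Qed.
Lemma ImM a b : Im (a * b) = Re a * Im b + Im a * Re b.
Proof. by case: a => a1 a2; case: b => b1 b2. Qed.

Lemma complex_ext a b : Re a = Re b -> Im a = Im b -> a = b.
Proof. by case: a => ? ?; case: b => ? ? /= -> ->. Qed.

Lemma cabsE z : cabs z = Num.sqrt (Re z ^+ 2 + Im z ^+ 2).
Proof. by case: z. Qed.
Lemma cabs_ge0 z : 0 <= cabs z. Proof. by rewrite cabsE sqrtr_ge0. Qed.
Lemma cabsM a b : cabs (a * b) = cabs a * cabs b. Proof. exact: Normc.normcM. Qed.
Lemma cabsD a b : cabs (a + b) <= cabs a + cabs b. Proof. exact: le_normcD. Qed.
Lemma cabsN a : cabs (- a) = cabs a. Proof. exact: normcN. Qed.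
Lemma cabs0 : cabs (0 : R[i]) = 0. Proof. exact: Normc.normc0. Qed.
Lemma cabs_eq0 z : cabs z = 0 -> z = 0. Proof. exact: Normc.eq0_normc. Qed.
Lemma cabsB a b : cabs (a - b) = cabs (b - a). Proof. by rewrite -cabsN opprB. Qed.
Lemma cabs_real (r : R) : cabs (r%:C)%C = `|r|.
Proof. by rewrite cabsE /= expr0n addr0 sqrtr_sqr. Qed.
Lemma cabs_conj z : cabs (z^*)%C = cabs z.
Proof. by rewrite !cabsE; case: z => a b /=; rewrite sqrrN. Qed.
Lemma cabs_Re z : `|Re z| <= cabs z.
Proof. by rewrite cabsE -sqrtr_sqr ler_wsqrtr// lerDl sqr_ge0. Qed.
Lemma cabs_Im z : `|Im z| <= cabs z.
Proof. by rewrite cabsE -sqrtr_sqr ler_wsqrtr// lerDr sqr_ge0. Qed.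
Lemma cabs_le z : cabs z <= `|Re z| + `|Im z|.
Proof.
rewrite [z in leLHS]complexE; apply: le_trans (cabsD _ _) _.
by rewrite cabs_real cabsM cabs_real cabsE /= expr0n add0r expr1n sqrtr1 mul1r.
Qed.

Lemma cabs_rotate z : exists2 c : R[i], cabs c <= 1 & c * z = (cabs z)%:C%C.
Proof.
have [->|z0] := eqVneq z 0.
  by exists 0; rewrite ?mul0r cabs0.
exists ((cabs z)^-1%:C * z^*)%C.
  rewrite cabsM cabs_real cabs_conj ger0_norm ?invr_ge0 ?cabs_ge0// mulVf//.
  by apply: contra z0 => /eqP/cabs_eq0 ->.
have cz0 : cabs z != 0 by apply: contra z0 => /eqP/cabs_eq0 ->.
rewrite -mulrA (_ : (z^*)%C * z = ((cabs z) ^+ 2)%:C%C).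
  by apply: complex_ext; rewrite ?ReM ?ImM /= ?mul0r ?mulr0 ?subr0 ?addr0// expr2 mulKf.
rewrite cabsE sqr_sqrtr ?addr_ge0 ?sqr_ge0//.
by case: z {z0 cz0} => a b; apply: complex_ext; rewrite ?ReM ?ImM /=; ring.
Qed.
End ComplexModulus.

Section ComplexIntegral.
Variables (R : realType) (G : preTopologicalZmodType).
Variable mu : {measure set (borel G) -> \bar R}.
Local Notation Re := complex.Re.
Local Notation Im := complex.Im.
Implicit Types f g : G -> R[i].

Definition cintegrable f :=
  cmeasurable f /\ (\int[mu]_x (cabs (f x))%:E < +oo)%E.

Lemma cmeasurable_cabs f : cmeasurable f ->
  measurable_fun [set: borel G] (fun x : borel G => cabs (f x)).
Proof.
move=> [mr mi].
rewrite (_ : (fun x => _) = (fun x : borel G => (Re (f x) ^+ 2 + Im (f x) ^+ 2) `^ 2^-1)).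
  apply: (measurableT_comp (measurable_powR _)).
  by apply: measurable_funD; apply: measurable_funX.
by apply/funext => x; rewrite cabsE powR12_sqrt// addr_ge0 ?sqr_ge0.
Qed.

Lemma cmeasurableD f g : cmeasurable f -> cmeasurable g -> cmeasurable (fun x => f x + g x).
Proof.
move=> [fr fi] [gr gi]; split.
- by under eq_fun do rewrite ReD; exact: measurable_funD.
- by under eq_fun do rewrite ImD; exact: measurable_funD.
Qed.

Lemma cmeasurableM f g : cmeasurable f -> cmeasurable g -> cmeasurable (fun x => f x * g x).
Proof.
move=> [fr fi] [gr gi]; split.
- by under eq_fun do rewrite ReM; apply: measurable_funB; exact: measurable_funM.
- by under eq_fun do rewrite ImM; apply: measurable_funD; exact: measurable_funM.
Qed.

Lemma cmeasurableN f : cmeasurable f -> cmeasurable (fun x => - f x).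
Proof.
move=> [fr fi]; split.
- by under eq_fun do rewrite ReN; exact: measurableT_comp.
- by under eq_fun do rewrite ImN; exact: measurableT_comp.
Qed.

Lemma cmeasurableB f g : cmeasurable f -> cmeasurable g -> cmeasurable (fun x => f x - g x).
Proof. by move=> mf mg; apply: cmeasurableD => //; exact: cmeasurableN. Qed.

Lemma cmeasurable_real (f : G -> R) : measurable_fun [set: borel G] (f : borel G -> R) ->
  cmeasurable (fun x => (f x)%:C%C).
Proof. by move=> mf; split => //=; exact: measurable_cst. Qed.

Lemma cintegrableP f : cintegrable f <->
  mu.-integrable setT (fun x : borel G => (Re (f x))%:E) /\
  mu.-integrable setT (fun x : borel G => (Im (f x))%:E).
Proof.
split=> [[mf ffin]|[/integrableP[mr rfin] /integrableP[mi ifin]]].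
- have mc : measurable_fun [set: borel G] (fun x : borel G => (cabs (f x))%:E).
    by apply/measurable_EFinP; exact: cmeasurable_cabs.
  case: mf => mr mi.
  have mrE : measurable_fun [set: borel G] (fun x : borel G => (Re (f x))%:E) by exact/measurable_EFinP.
  have miE : measurable_fun [set: borel G] (fun x : borel G => (Im (f x))%:E) by exact/measurable_EFinP.
  split; apply/integrableP; split => //; apply: le_lt_trans ffin; apply: ge0_le_integral => //.
  + exact: measurableT_comp.
  + by move=> x _; rewrite lee_fin cabs_Re.
  + exact: measurableT_comp.
  + by move=> x _; rewrite lee_fin cabs_Im.
- have mf : cmeasurable f by split; exact/measurable_EFinP.
  split => //; apply: (@le_lt_trans _ _ (\int[mu]_x (`|(Re (f x))%:E| + `|(Im (f x))%:E|))%E).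
    apply: ge0_le_integral => //.
    + by move=> x _; rewrite lee_fin cabs_ge0.
    + by apply/measurable_EFinP; exact: cmeasurable_cabs.
    + by apply: emeasurable_funD; exact: measurableT_comp.
    + by move=> x _; rewrite lee_fin cabs_le.
  rewrite ge0_integralD//; [exact: lte_add_pinfty| |]; exact: measurableT_comp.
Qed.

Lemma cintegrable_le f (g : borel G -> \bar R) : cmeasurable f ->
  measurable_fun [set: borel G] g ->
  (forall x, (cabs (f x))%:E <= g x)%E -> (\int[mu]_x g x < +oo)%E -> cintegrable f.
Proof.
move=> mf mg fg gfin; split => //; apply: le_lt_trans gfin; apply: ge0_le_integral => //.
- by move=> x _; rewrite lee_fin cabs_ge0.
- by apply/measurable_EFinP; exact: cmeasurable_cabs.
Qed.

Lemma cintegrableD f g : cintegrable f -> cintegrable g -> cintegrable (fun x => f x + g x).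
Proof.
move=> /cintegrableP[fr fi] /cintegrableP[gr gi]; apply/cintegrableP; split.
- by under eq_fun do rewrite ReD EFinD; exact: integrableD.
- by under eq_fun do rewrite ImD EFinD; exact: integrableD.
Qed.

Lemma cintegrableZ (a : R[i]) f : cintegrable f -> cintegrable (fun x => a * f x).
Proof.
move=> /cintegrableP[fr fi]; apply/cintegrableP; split.
- under eq_fun do rewrite ReM EFinB !EFinM; apply: integrableB => //; exact: integrableZl.
- under eq_fun do rewrite ImM EFinD !EFinM; apply: integrableD => //; exact: integrableZl.
Qed.

Lemma cintegrableN f : cintegrable f -> cintegrable (fun x => - f x).
Proof. by move=> /(cintegrableZ (-1)); under eq_fun do rewrite mulN1r. Qed.

Lemma cintegrableB f g : cintegrable f -> cintegrable g -> cintegrable (fun x => f x - g x).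
Proof. by move=> fi gi; apply: cintegrableD => //; exact: cintegrableN. Qed.

Lemma cintegrable0 : cintegrable (fun=> 0).
Proof. by apply/cintegrableP; split; exact: integrable0. Qed.

Lemma cintegralD f g : cintegrable f -> cintegrable g ->
  cintegral mu (fun x => f x + g x) = cintegral mu f + cintegral mu g.
Proof.
move=> /cintegrableP[fr fi] /cintegrableP[gr gi]; rewrite /cintegral; congr Complex.
- by rewrite -RintegralD//; apply: eq_Rintegral => x _; rewrite ReD.
- by rewrite -RintegralD//; apply: eq_Rintegral => x _; rewrite ImD.
Qed.

Lemma cintegralZ (a : R[i]) f : cintegrable f ->
  cintegral mu (fun x => a * f x) = a * cintegral mu f.
Proof.
move=> /cintegrableP[fr fi].
have Zr (c : R) : mu.-integrable setT (EFin \o (fun x : borel G => c * Re (f x))).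
  by rewrite /comp; under eq_fun do rewrite EFinM; exact: integrableZl.
have Zi (c : R) : mu.-integrable setT (EFin \o (fun x : borel G => c * Im (f x))).
  by rewrite /comp; under eq_fun do rewrite EFinM; exact: integrableZl.
apply: complex_ext; rewrite ?ReM ?ImM /=.
- rewrite -!RintegralZl// -RintegralB//; apply: eq_Rintegral => x _; exact: ReM.
- rewrite -!RintegralZl// -RintegralD//; apply: eq_Rintegral => x _; exact: ImM.
Qed.

Lemma cintegral_real (f : G -> R) :
  cintegral mu (fun x => (f x)%:C%C) = (\int[mu]_x f x)%:C%C.
Proof. by rewrite /cintegral /=; congr Complex; rewrite Rintegral_cst// mul0r. Qed.

(** Rotate the integral onto the nonnegative axis and take real parts. *)
Lemma cabs_cintegral f : cintegrable f ->
  ((cabs (cintegral mu f))%:E <= \int[mu]_x (cabs (f x))%:E)%E.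
Proof.
move=> fi; have [c c1 cE] := cabs_rotate (cintegral mu f).
have cfi := cintegrableZ c fi.
have := congr1 (fun z => Re z) cE; rewrite -cintegralZ//= => <-.
have /cintegrableP[cr _] := cfi.
have -> : (\int[mu]_x Re (c * f x))%:E = (\int[mu]_x (Re (c * f x))%:E)%E.
  by rewrite /Rintegral fineK//; exact: integrable_fin_num.
apply: (le_trans (lee_abs _)); apply: le_trans (le_abse_integral _ _ _) _ => //.
  by case/integrableP: cr.
have [mf _] := fi; have [mcf _] := cfi.
apply: ge0_le_integral => //.
- by apply: measurableT_comp => //; case/integrableP: cr.
- by apply/measurable_EFinP; exact: cmeasurable_cabs.
- move=> x _; rewrite lee_fin; apply: le_trans (cabs_Re _) _; rewrite cabsM.
  by rewrite -[leRHS]mul1r ler_wpM2r ?cabs_ge0.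
Qed.

Lemma cintegral_ae f g : cmeasurable f -> cmeasurable g ->
  {ae mu, forall x : borel G, f x = g x} -> cintegral mu f = cintegral mu g.
Proof.
move=> [fr fi] [gr gi] fg; rewrite /cintegral /Rintegral; congr Complex; congr fine.
- apply: ae_eq_integral => //; [exact/measurable_EFinP|exact/measurable_EFinP|].
  by apply: filterS fg => x -> _.
- apply: ae_eq_integral => //; [exact/measurable_EFinP|exact/measurable_EFinP|].
  by apply: filterS fg => x -> _.
Qed.

Lemma cintegrable_ae f g : cmeasurable g ->
  {ae mu, forall x : borel G, f x = g x} -> cintegrable f -> cintegrable g.
Proof.
move=> mg fg [mf ffin]; split => //; apply: le_lt_trans ffin; rewrite le_eqVlt; apply/orP; left; apply/eqP.
apply: ge0_ae_eq_integral => //.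
- by apply/measurable_EFinP; exact: cmeasurable_cabs.
- by apply/measurable_EFinP; exact: cmeasurable_cabs.
- by move=> x _; rewrite lee_fin cabs_ge0.
- by move=> x _; rewrite lee_fin cabs_ge0.
- by apply: filterS fg => x fgx _; rewrite fgx.
Qed.

Lemma cintegrable_real (h : G -> R) : nnL1 mu (EFin \o h) -> cintegrable (fun x => (h x)%:C%C).
Proof.
move=> [/measurable_EFinP mh h0 hfin]; split; first exact: cmeasurable_real.
rewrite (eq_integral (fun x : borel G => (h x)%:E))// => x _.
by rewrite cabs_real ger0_norm//=; have := h0 x; rewrite lee_fin.
Qed.

(** A function is a linear combination of the positive and negative parts of its real
and imaginary parts.  The two clauses suit statements that are linear in [f] and
reduce to [tonelli] when [f] is nonnegative. *)
Lemma cintegrable_ind (P : (G -> R[i]) -> Prop) :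
  (forall (a : R[i]) f g, cintegrable f -> cintegrable g -> P f -> P g ->
     P (fun x => a * f x + g x)) ->
  (forall f : G -> R, nnL1 mu (EFin \o f) -> P (fun x => (f x)%:C%C)) ->
  forall f, cintegrable f -> P f.
Proof.
move=> PD P0 f fi; have /cintegrableP[fr fim] := fi.
have pos (h : G -> R) : mu.-integrable setT (fun x : borel G => (h x)%:E) ->
    nnL1 mu (EFin \o (fun x => Num.max (h x) 0)).
  move=> /integrableP[/measurable_EFinP mh hfin].
  have mp : measurable_fun [set: borel G] (fun x : borel G => (Num.max (h x) 0)%:E).
    by apply/measurable_EFinP; apply: measurable_maxr => //; exact: measurable_cst.
  have p0 x : (0 <= (Num.max (h x) 0)%:E)%E by rewrite lee_fin le_max lexx orbT.
  split => //; apply: le_lt_trans hfin; apply: ge0_le_integral => //.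
  - by move=> x _; exact: p0.
  - by apply: measurableT_comp => //; exact/measurable_EFinP.
  - by move=> x _; rewrite lee_fin ge_max ler_norm normr_ge0.
have neg (h : G -> R) : mu.-integrable setT (fun x : borel G => (h x)%:E) ->
    nnL1 mu (EFin \o (fun x => Num.max (- h x) 0)).
  by move=> hi; apply: (pos (fun x => - h x)); exact: integrableN hi.
have r1 := pos _ fr; have r2 := neg _ fr; have i1 := pos _ fim; have i2 := neg _ fim.
have rE (t : R) : t = Num.max t 0 - Num.max (- t) 0.
  by rewrite /Num.max; case: ifPn; case: ifPn; rewrite ?oppr_lt0 -?leNgt; lra.
have -> : f = (fun x => 'i%C * (-1 * (Num.max (- Im (f x)) 0)%:C%C + (Num.max (Im (f x)) 0)%:C%C) +
    (-1 * (Num.max (- Re (f x)) 0)%:C%C + (Num.max (Re (f x)) 0)%:C%C)).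
  apply/funext => x; rewrite [LHS]complexE [in LHS](rE (Re (f x))) [in LHS](rE (Im (f x))).
  by apply: complex_ext; rewrite ?(ReD, ImD, ReM, ImM) /=; ring.
apply: (PD _ (fun x => -1 * _ + _) (fun x => -1 * _ + _)).
- by apply: cintegrableD; [apply: cintegrableZ|]; exact: cintegrable_real.
- by apply: cintegrableD; [apply: cintegrableZ|]; exact: cintegrable_real.
- by apply: PD; try exact: cintegrable_real; exact: P0.
- by apply: PD; try exact: cintegrable_real; exact: P0.
Qed.
End ComplexIntegral.

(** * The convolution algebra of integrable functions *)

Section Convolution.
Variables (R : realType) (G : topologicalZmodType).
Variable mu : {measure set (borel G) -> \bar R}.
Hypothesis hG : lca G.
Hypothesis hmu : haar_measure mu.
Local Notation Re := complex.Re.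
Local Notation Im := complex.Im.
Implicit Types f g h : G -> R[i].

Local Notation econv := (@econv R G mu).
Local Notation cint := (cintegrable mu).

Definition modulus f : G -> \bar R := fun x => (cabs (f x))%:E.

Lemma modulus_nnL1 f : cint f -> nnL1 mu (modulus f).
Proof.
move=> [mf ffin]; split => //; first by apply/measurable_EFinP; exact: cmeasurable_cabs.
by move=> x; rewrite lee_fin cabs_ge0.
Qed.

Lemma modulus_ge0 f (x : G) : (0 <= modulus f x)%E.
Proof. by rewrite lee_fin cabs_ge0. Qed.

Lemma measurable_modulus f : cmeasurable f ->
  measurable_fun [set: borel G] (modulus f : borel G -> \bar R).
Proof. by move=> mf; apply/measurable_EFinP; exact: cmeasurable_cabs. Qed.

Lemma integral_econv (f g : G -> \bar R) : nnL1 mu f -> nnL1 mu g ->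
  (\int[mu]_y econv f g y = (\int[mu]_z f z) * \int[mu]_z g z)%E.
Proof.
move=> fL1 gL1; have [mf f0 _] := fL1; have [mg g0 _] := gL1.
transitivity (\int[mu]_y (cst 1 y * econv f g y))%E.
  by apply: eq_integral => y _; rewrite mul1e.
transitivity (\int[mu]_z (f z * corr mu g (cst 1) z))%E; first exact: tonelli.
transitivity (\int[mu]_z (f z * \int[mu]_y g y))%E; last first.
  by apply: ge0_integralZr => //; exact: integral_ge0.
apply: eq_integral => z _; congr (_ * _)%E.
transitivity (\int[mu]_y g (- z + y)%R)%E; last exact: haar_integral_addl.
by apply: eq_integral => y _; rewrite mule1 addrC.
Qed.

Lemma nnL1_econv (f g : G -> \bar R) : nnL1 mu f -> nnL1 mu g -> nnL1 mu (econv f g).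
Proof.
move=> fL1 gL1; have [mf f0 ffin] := fL1; have [mg g0 gfin] := gL1; split.
- exact: measurable_econv.
- by move=> y; exact: econv_ge0.
- rewrite integral_econv//; apply: lte_mul_pinfty => //; first exact: integral_ge0.
  by rewrite ge0_fin_numE//; exact: integral_ge0.
Qed.

Lemma nnL1_ae_lty (f : borel G -> \bar R) : nnL1 mu f -> {ae mu, forall x, (f x < +oo)%E}.
Proof.
move=> [mf f0 ffin].
have fi : mu.-integrable setT f.
  by apply/integrableP; split=> //; under eq_integral do rewrite gee0_abs//.
by apply: filterS (integrable_ae measurableT fi) => x /(_ I); rewrite ge0_fin_numE.
Qed.

Lemma fine_le_id (e : \bar R) : (0 <= e)%E -> ((fine e)%:E <= e)%E.
Proof. by case: e => //= _; rewrite leey. Qed.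

Lemma nnL1_fine (f : borel G -> \bar R) : nnL1 mu f -> nnL1 mu (EFin \o (fine \o f)).
Proof.
move=> fL1; have [mf f0 ffin] := fL1; apply: (nnL1_le _ _ _ fL1).
- by apply/measurable_EFinP; exact: measurableT_comp.
- by move=> x; rewrite lee_fin fine_ge0.
- by move=> x; exact: fine_le_id.
Qed.

Lemma cmeasurable_comp_subl f (x : G) : cmeasurable f -> cmeasurable (fun y => f (x - y)).
Proof.
move=> [fr fi]; split.
- by apply: (measurableT_comp fr); exact: measurable_subl.
- by apply: (measurableT_comp fi); exact: measurable_subl.
Qed.

Lemma convolution_integrable f g (x : G) : cmeasurable f -> cmeasurable g ->
  (econv (modulus f) (modulus g) x < +oo)%E -> cint (fun y => f y * g (x - y)).
Proof.
move=> mf mg xfin; split; first by apply: cmeasurableM => //; exact: cmeasurable_comp_subl.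
by under eq_integral do rewrite cabsM EFinM.
Qed.

Lemma convolution_ae_integrable f g : cint f -> cint g ->
  {ae mu, forall x : borel G, cint (fun y => f y * g ((x : G) - y))}.
Proof.
move=> fi gi; have fL1 := modulus_nnL1 fi; have gL1 := modulus_nnL1 gi.
apply: filterS (nnL1_ae_lty (nnL1_econv fL1 gL1)) => x.
by apply: convolution_integrable; [case: fi|case: gi].
Qed.

Lemma convolution_real (f g : G -> R) (x : G) :
  convolution mu (fun y => (f y)%:C%C) (fun y => (g y)%:C%C) x =
  (fine (econv (EFin \o f) (EFin \o g) x))%:C%C.
Proof.
rewrite /convolution -[RHS]/((fine (\int[mu]_z (f z * g (x - z))%:E)%E)%:C%C).
rewrite -[RHS](cintegral_real mu (fun z => f z * g (x - z))).
by congr cintegral; apply/funext => y; rewrite rmorphM.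
Qed.

Lemma convolution_le f g (x : G) : cmeasurable f -> cmeasurable g ->
  ((cabs (convolution mu f g x))%:E <= econv (modulus f) (modulus g) x)%E.
Proof.
move=> mf mg; have [xfin|] := ltP (econv (modulus f) (modulus g) x) +oo%E; last first.
  by rewrite leye_eq => /eqP ->; rewrite leey.
apply: le_trans (cabs_cintegral (convolution_integrable mf mg xfin)) _.
rewrite le_eqVlt; apply/orP; left; apply/eqP.
by apply: eq_integral => y _; rewrite cabsM.
Qed.

Lemma convolution_linl (a : R[i]) f f' g : cint f -> cint f' -> cint g ->
  {ae mu, forall x : borel G, convolution mu (fun y => a * f y + f' y) g x =
     a * convolution mu f g x + convolution mu f' g x}.
Proof.
move=> fi fi' gi.
apply: filterS2 (convolution_ae_integrable fi gi) (convolution_ae_integrable fi' gi) => x ix ix'.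
rewrite /convolution -cintegralZ// -cintegralD//; last exact: cintegrableZ.
by congr cintegral; apply/funext => y; rewrite mulrDl mulrA.
Qed.

Lemma convolution_linr (a : R[i]) f g g' : cint f -> cint g -> cint g' ->
  {ae mu, forall x : borel G, convolution mu f (fun y => a * g y + g' y) x =
     a * convolution mu f g x + convolution mu f g' x}.
Proof.
move=> fi gi gi'.
apply: filterS2 (convolution_ae_integrable fi gi) (convolution_ae_integrable fi gi') => x ix ix'.
rewrite /convolution -cintegralZ// -cintegralD//; last exact: cintegrableZ.
by congr cintegral; apply/funext => y; rewrite mulrDr mulrCA.
Qed.

Lemma convolution_ae f f' g g' (x : G) :
  cmeasurable f -> cmeasurable f' -> cmeasurable g -> cmeasurable g' ->
  {ae mu, forall x : borel G, f x = f' x} -> {ae mu, forall x : borel G, g x = g' x} ->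
  convolution mu f g x = convolution mu f' g' x.
Proof.
move=> mf mf' mg mg' ff' gg'; apply: cintegral_ae.
- by apply: cmeasurableM => //; exact: cmeasurable_comp_subl.
- by apply: cmeasurableM => //; exact: cmeasurable_comp_subl.
by apply: filterS2 ff' (haar_ae_subl hG hmu x gg') => y -> ->.
Qed.

(** The integral that defines a convolution converges only almost everywhere, so
[convolution mu f g] itself need not be measurable.  Up to a null set it is an
integrable function, whose integral is multiplicative; applied to functions
multiplied by a character, this makes the Fourier transform multiplicative. *)
Lemma convolution_repr f g : cint f -> cint g ->
  exists F, [/\ cint F, {ae mu, forall x : borel G, convolution mu f g x = F x} &
    cintegral mu F = cintegral mu f * cintegral mu g].
Proof.
move=> + gi; move: f.
apply: (@cintegrable_ind _ _ mu (fun f => exists F, [/\ cint F,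
    {ae mu, forall x : borel G, convolution mu f g x = F x} &
    cintegral mu F = cintegral mu f * cintegral mu g])).
  move=> a f f' fi fi' [F [iF FE FI]] [F' [iF' FE' FI']].
  exists (fun x => a * F x + F' x); split.
  - exact: (cintegrableD (cintegrableZ a iF) iF').
  - apply: filterS3 (convolution_linl a fi fi' gi) FE FE' => x -> -> -> //.
  - rewrite (cintegralD (cintegrableZ a iF) iF') (cintegralZ a iF) FI FI'.
    by rewrite (cintegralD (cintegrableZ a fi) fi') (cintegralZ a fi) mulrDl mulrA.
move=> f fL1; have fi := cintegrable_real fL1; move: g gi.
apply: (@cintegrable_ind _ _ mu (fun g => exists F, [/\ cint F,
    {ae mu, forall x : borel G, convolution mu (fun x => (f x)%:C%C) g x = F x} &
    cintegral mu F = cintegral mu (fun x => (f x)%:C%C) * cintegral mu g])).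
  move=> a g g' gi gi' [F [iF FE FI]] [F' [iF' FE' FI']].
  exists (fun x => a * F x + F' x); split.
  - exact: (cintegrableD (cintegrableZ a iF) iF').
  - apply: filterS3 (convolution_linr a fi gi gi') FE FE' => x -> -> -> //.
  - rewrite (cintegralD (cintegrableZ a iF) iF') (cintegralZ a iF) FI FI'.
    by rewrite (cintegralD (cintegrableZ a gi) gi') (cintegralZ a gi) mulrDr mulrCA.
move=> g gL1; have gi := cintegrable_real gL1.
have cL1 := nnL1_econv fL1 gL1; have fcL1 := nnL1_fine cL1.
exists (fun x => (fine (econv (EFin \o f) (EFin \o g) x))%:C%C); split.
- exact: (cintegrable_real fcL1).
- by apply: aeW => x; exact: convolution_real.
rewrite !cintegral_real -rmorphM /=; congr (_%:C)%C.
rewrite /Rintegral -fineM; last 2 first.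
- by have [_ f0 ffin] := fL1; rewrite ge0_fin_numE//; apply: integral_ge0 => x _; exact: f0.
- by have [_ g0 gfin] := gL1; rewrite ge0_fin_numE//; apply: integral_ge0 => x _; exact: g0.
have := integral_econv fL1 gL1; rewrite /comp => <-; congr fine.
have [mc c0 _] := cL1; have [mfc fc0 _] := fcL1.
apply: ge0_ae_eq_integral => //.
- by move=> x _; exact: fc0.
- by apply: filterS (nnL1_ae_lty cL1) => x xfin _ /=; rewrite fineK// ge0_fin_numE.
Qed.

Lemma ae_class_eqP f g : ae_class mu f = ae_class mu g <->
  {ae mu, forall x : borel G, f x = g x}.
Proof.
split=> [/ae_classP/asboolP h|h].
  by apply: filterS h => x /= h; apply/eqP; rewrite -subr_eq0; apply/eqP.
apply/ae_classP/asboolP; apply: filterS h => x /= h.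
by rewrite -[LHS]/(f x - g x) h subrr.
Qed.

Lemma mreprP f : cmeasurable f ->
  cmeasurable (mrepr (ae_class mu f)) /\ {ae mu, forall x : borel G, mrepr (ae_class mu f) x = f x}.
Proof.
move=> mf; rewrite /mrepr; case: xgetP => [h -> [mh /ae_class_eqP hf]//|/(_ f) []].
by split.
Qed.

Lemma conv_classE f g : cmeasurable f -> cmeasurable g ->
  conv_class mu (ae_class mu f) (ae_class mu g) = ae_class mu (convolution mu f g).
Proof.
move=> mf mg; congr ae_class; apply/funext => x.
have [mrf frf] := mreprP mf; have [mrg grg] := mreprP mg.
exact: convolution_ae.
Qed.

(** The classes on which convolution is well behaved; the weighted algebra and the
space of the theorem consist of such classes. *)
Definition L1class (u : L0 mu) := exists2 f, cint f & ae_class mu f = u.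

Lemma L1class_conv u v : L1class u -> L1class v -> L1class (conv_class mu u v).
Proof.
move=> [f fi <-] [g gi <-]; have [F [iF FE _]] := convolution_repr fi gi.
exists F => //; rewrite conv_classE; [|by case: fi|by case: gi].
by apply/ae_class_eqP; apply: filterS FE => x ->.
Qed.

Lemma ae_class_lin a f g :
  a *: ae_class mu f + ae_class mu g = ae_class mu (fun x => a * f x + g x).
Proof. by rewrite -[a *: _]/(L0_scale _ _) L0_scaleE -ae_classD. Qed.

Lemma conv_class_linl a u u' v : L1class u -> L1class u' -> L1class v ->
  conv_class mu (a *: u + u') v = a *: conv_class mu u v + conv_class mu u' v.
Proof.
move=> [f fi <-] [f' fi' <-] [g gi <-]; have [mf _] := fi; have [mf' _] := fi'.
have [mg _] := gi; have [maf _] := cintegrableD (cintegrableZ a fi) fi'.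
rewrite ae_class_lin (conv_classE maf mg) (conv_classE mf mg) (conv_classE mf' mg) ae_class_lin.
by apply/ae_class_eqP; exact: convolution_linl.
Qed.

Lemma conv_class_linr a u v v' : L1class u -> L1class v -> L1class v' ->
  conv_class mu u (a *: v + v') = a *: conv_class mu u v + conv_class mu u v'.
Proof.
move=> [f fi <-] [g gi <-] [g' gi' <-]; have [mf _] := fi; have [mg _] := gi.
have [mg' _] := gi'; have [mag _] := cintegrableD (cintegrableZ a gi) gi'.
rewrite ae_class_lin (conv_classE mf mag) (conv_classE mf mg) (conv_classE mf mg') ae_class_lin.
by apply/ae_class_eqP; exact: convolution_linr.
Qed.

(** Tonelli moves the inner convolution onto [h], and a translation by [z] rewrites the
adjoint as a convolution.  No integrability of the result is involved, so the
identity holds at every point, with infinite values allowed. *)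
Lemma econvA (f g h : G -> \bar R) (x : G) : nnL1 mu f -> nnL1 mu g -> nnL1 mu h ->
  econv (econv f g) h x = econv f (econv g h) x.
Proof.
move=> fL1 gL1 hL1; have [mf f0 _] := fL1; have [mg g0 _] := gL1; have [mh h0 _] := hL1.
transitivity (\int[mu]_y (h (x - y)%R * econv f g y))%E.
  by apply: eq_integral => y _; rewrite muleC.
transitivity (\int[mu]_z (f z * corr mu g (fun y => h (x - y)%R) z))%E.
  by apply: tonelli => //; exact: measurable_comp_subl.
apply: eq_integral => z _; congr (_ * _)%E.
transitivity (\int[mu]_y (g (z + y - z)%R * h (x - (z + y))%R))%E.
  apply/esym; apply: (haar_integral_addl hmu z (f := fun y => (g ((y : G) - z)%R * h (x - y)%R)%E)).
    by apply: emeasurable_funM; [exact: measurable_comp_subr|exact: measurable_comp_subl].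
  by move=> y; rewrite mule_ge0.
by apply: eq_integral => y _; rewrite addrAC subrr add0r opprD addrA.
Qed.

Lemma conv_class_real (f g : G -> R) : nnL1 mu (EFin \o f) -> nnL1 mu (EFin \o g) ->
  conv_class mu (ae_class mu (fun x => (f x)%:C%C)) (ae_class mu (fun x => (g x)%:C%C)) =
  ae_class mu (fun x => (fine (econv (EFin \o f) (EFin \o g) x))%:C%C).
Proof.
move=> fL1 gL1; rewrite conv_classE; last 2 first.
- by have [] := cintegrable_real fL1.
- by have [] := cintegrable_real gL1.
by congr ae_class; apply/funext => x; exact: convolution_real.
Qed.

Lemma nnL1_fine_ae (f : borel G -> \bar R) : nnL1 mu f ->
  ae_eq mu setT (EFin \o (fine \o f)) f.
Proof.
move=> fL1; have [_ f0 _] := fL1.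
by apply: filterS (nnL1_ae_lty fL1) => x xfin _ /=; rewrite fineK// ge0_fin_numE.
Qed.

Lemma L1class_ind (P : L0 mu -> Prop) :
  (forall a u v, L1class u -> L1class v -> P u -> P v -> P (a *: u + v)) ->
  (forall f : G -> R, nnL1 mu (EFin \o f) -> P (ae_class mu (fun x => (f x)%:C%C))) ->
  forall u, L1class u -> P u.
Proof.
move=> PD P0 _ [f fi <-]; move: f fi.
apply: (@cintegrable_ind _ _ mu (fun f => P (ae_class mu f))) => // a f g fi gi Pf Pg.
by rewrite -ae_class_lin; apply: PD => //; [exists f|exists g].
Qed.

Lemma L1class_real (f : G -> R) : nnL1 mu (EFin \o f) ->
  L1class (ae_class mu (fun x => (f x)%:C%C)).
Proof. by move=> fL1; exists (fun x => (f x)%:C%C) => //; exact: cintegrable_real. Qed.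

Lemma assoc_of_bilinear (c : L0 mu -> L0 mu -> L0 mu) :
  (forall u v, L1class u -> L1class v -> L1class (c u v)) ->
  (forall a u u' v, L1class u -> L1class u' -> L1class v ->
     c (a *: u + u') v = a *: c u v + c u' v) ->
  (forall a u v v', L1class u -> L1class v -> L1class v' ->
     c u (a *: v + v') = a *: c u v + c u v') ->
  (forall f g h : G -> R, nnL1 mu (EFin \o f) -> nnL1 mu (EFin \o g) -> nnL1 mu (EFin \o h) ->
     c (c (ae_class mu (fun x => (f x)%:C%C)) (ae_class mu (fun x => (g x)%:C%C)))
       (ae_class mu (fun x => (h x)%:C%C)) =
     c (ae_class mu (fun x => (f x)%:C%C))
       (c (ae_class mu (fun x => (g x)%:C%C)) (ae_class mu (fun x => (h x)%:C%C)))) ->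
  forall u v w, L1class u -> L1class v -> L1class w -> c (c u v) w = c u (c v w).
Proof.
move=> cc linl linr base u v w + vL wL; move: u; apply: L1class_ind.
  move=> a u u' uL uL' IH IH'.
  by rewrite linl// linl// ?IH ?IH' ?linl//; exact: cc.
move=> f fL1; have fL := L1class_real fL1.
move: v vL; apply: L1class_ind.
  move=> a v v' vL vL' IH IH'.
  by rewrite linr// linl ?IH ?IH' ?linl ?linr//; exact: cc.
move=> g gL1; have gL := L1class_real gL1.
move: w wL; apply: L1class_ind.
  move=> a w w' wL wL' IH IH'.
  by rewrite linr ?IH ?IH' ?linr//; exact: cc.
by move=> h hL1; exact: base.
Qed.

Lemma conv_classA u v w : L1class u -> L1class v -> L1class w ->
  conv_class mu (conv_class mu u v) w = conv_class mu u (conv_class mu v w).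
Proof.
apply: assoc_of_bilinear; [exact: L1class_conv|exact: conv_class_linl|exact: conv_class_linr|].
move=> f g h fL1 gL1 hL1.
have fgL1 := nnL1_econv fL1 gL1; have ghL1 := nnL1_econv gL1 hL1.
have ffgL1 := nnL1_fine fgL1; have fghL1 := nnL1_fine ghL1.
rewrite (conv_class_real fL1 gL1) (conv_class_real gL1 hL1).
rewrite (conv_class_real ffgL1 hL1) (conv_class_real fL1 fghL1).
congr ae_class; apply/funext => x; congr ((fine _)%:C)%C.
have [mf f0 _] := fL1; have [mh h0 _] := hL1.
transitivity (econv (econv (EFin \o f) (EFin \o g)) (EFin \o h) x).
  have [_ _ _ Le] := nnlinear_integral mu (measurable_comp_subl x mh) (fun z => h0 (x - (z : G))).
  exact: (Le _ _ ffgL1 fgL1 (nnL1_fine_ae fgL1)).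
transitivity (econv (EFin \o f) (econv (EFin \o g) (EFin \o h)) x); first exact: econvA.
have [mgh gh0 _] := ghL1; have [mfgh fgh0 _] := fghL1.
rewrite /econv /=; under eq_integral do rewrite muleC.
under [RHS]eq_integral do rewrite muleC.
have [_ _ _ Le] := nnlinear_comp (measurable_subl x) (haar_ae_subl hG hmu x) mf f0.
exact/esym/(Le _ _ fghL1 ghL1)/nnL1_fine_ae.
Qed.
End Convolution.

(** * Lower limits *)

Section LiminfBounds.
Variable R : realType.
Implicit Types (U V : \bar R) (u v : (\bar R)^nat).
Local Open Scope ereal_scope.

(** In this form lower bounds for a lower limit are statements about all large [n],
which are stable under finite sums, powers and finite intersections. *)
Lemma le_limn_einfP U u :
  U <= limn_einf u <-> forall t : R, t%:E < U -> \forall n \near \oo, t%:E < u n.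
Proof.
have supE : limn_einf u = ereal_sup (range (einfs u)).
  by rewrite limn_einf_lim; apply/cvg_lim => //; exact: cvg_einfs_sup.
split=> [UL t tU|H].
  have : t%:E < ereal_sup (range (einfs u)) by rewrite -supE; exact: lt_le_trans UL.
  move/ereal_sup_gt => [_ [n _ <-] tn]; exists n => // m /= nm; apply: lt_le_trans tn _.
  by apply: ereal_inf_lbound; exists m.
rewrite leNgt; apply/negP => LU.
have [t Lt tU] : exists2 t : R, limn_einf u < t%:E & t%:E < U.
  move: LU; case: (limn_einf u) => [l| |]; case: U {H} => [r| |] //=.
  - rewrite lte_fin => lr; exists ((l + r) / 2)%R; rewrite lte_fin; lra.
  - by move=> _; exists (l + 1)%R; rewrite ?ltry// lte_fin ltrDl.
  - by move=> _; exists (r - 1)%R; rewrite ?ltNyr// lte_fin ltrBlDr ltrDl.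
  - by move=> _; exists 0%R; rewrite ?ltNyr ?ltry.
have [N _ Nu] := H t tU.
suff : t%:E <= limn_einf u by rewrite leNgt Lt.
rewrite supE; apply: le_trans (ereal_sup_ubound (x := einfs u N) _); last by exists N.
by apply: le_ereal_inf_tmp => _ [m /= Nm <-]; apply: ltW; exact: Nu.
Qed.

Lemma limn_einf_le u (c : \bar R) : (\forall n \near \oo, u n <= c) -> limn_einf u <= c.
Proof.
move=> uc; rewrite leNgt; apply/negP => cL.
have [_ /(_ _)] := le_limn_einfP (limn_einf u) u.
have H := (le_limn_einfP (limn_einf u) u).1 (lexx _).
have [t ct tL] : exists2 t : R, c <= t%:E & t%:E < limn_einf u.
  move: cL; case: c {uc} => [r| |]//; first by exists r.
    by case: (limn_einf u).
  case: (limn_einf u) => [l| |]// _; first by exists (l - 1)%R; rewrite ?leNye// lte_fin ltrBlDr ltrDl.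
  by exists 0%R; rewrite ?leNye ?ltry.
have [N _ /(_ N)] := filterI uc (H t tL); rewrite /= leqnn => /(_ isT)[uNc tuN] _.
by move: (le_lt_trans (le_trans uNc ct) tuN); rewrite ltxx.
Qed.

Lemma poweR_le (x y : \bar R) (r : R) : (0 <= r)%R -> 0 <= x -> x <= y -> x `^ r <= y `^ r.
Proof.
move=> r0 x0 xy; apply: gt0_ler_poweR => //; rewrite in_itv /= leey andbT//.
exact: le_trans xy.
Qed.

Lemma poweR_lt_inv (x : \bar R) (t s : R) : (0 < s)%R -> 0 <= x -> (0 <= t)%R ->
  (t%:E < x `^ s) = ((t `^ s^-1)%R%:E < x).
Proof.
move=> s0 x0 t0; apply/idP/idP; rewrite !ltNge; apply: contra => h.
  have := poweR_le (ltW s0) x0 h.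
  by rewrite poweR_EFin -powRrM mulVf ?gt_eqF// powRr1.
have si : (0 <= s^-1)%R by rewrite invr_ge0 ltW.
have := poweR_le si (poweR_ge0 _ _) h.
by rewrite -poweRrM mulfV ?gt_eqF// poweRe1// poweR_EFin.
Qed.

Lemma limn_einf_poweR U u (s : R) : (0 < s)%R -> 0 <= U -> (forall n, 0 <= u n) ->
  U <= limn_einf u -> U `^ s <= limn_einf (fun n => u n `^ s).
Proof.
move=> s0 U0 u0 /le_limn_einfP UL; apply/le_limn_einfP => t tU.
have [t0|t0] := ltP t 0%R.
  by apply: nearW => n; apply: lt_le_trans (poweR_ge0 _ _); rewrite lte_fin.
by apply: filterS (UL (t `^ s^-1)%R _) => [n|]; rewrite -poweR_lt_inv.
Qed.

Lemma limn_einfD U V u v : 0 <= U -> 0 <= V -> (forall n, 0 <= u n) -> (forall n, 0 <= v n) ->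
  U <= limn_einf u -> V <= limn_einf v -> U + V <= limn_einf (fun n => u n + v n).
Proof.
move=> U0 V0 u0 v0 /le_limn_einfP UL /le_limn_einfP VL; apply/le_limn_einfP => t.
case: U U0 UL => [a| |]// U0 UL; case: V V0 VL => [b| |]// V0 VL tUV.
- rewrite -EFinD lte_fin in tUV; pose d := ((a + b - t) / 2)%R.
  have d0 : (0 < d)%R by rewrite /d; lra.
  have h1 : (a - d)%:E < a%:E by rewrite lte_fin; lra.
  have h2 : (b - d)%:E < b%:E by rewrite lte_fin; lra.
  apply: filterS2 (UL _ h1) (VL _ h2) => n un vn.
  apply: le_lt_trans (lteD un vn); rewrite -EFinD lee_fin /d; lra.
- apply: filterS (VL _ (ltry t)) => n tv; apply: lt_le_trans tv _; exact: leeDr.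
- apply: filterS (UL _ (ltry t)) => n tu; apply: lt_le_trans tu _; exact: leeDl.
- apply: filterS (UL _ (ltry t)) => n tu; apply: lt_le_trans tu _; exact: leeDl.
Qed.

(** Only finite sums are compared, so the index set may be uncountable. *)
Lemma limn_einf_esum (T : choiceType) (J : set T) (U : T -> \bar R) (u : nat -> T -> \bar R) :
  (forall j, 0 <= U j) -> (forall n j, 0 <= u n j) ->
  (forall j, U j <= limn_einf (u ^~ j)) ->
  \esum_(j in J) U j <= limn_einf (fun n => \esum_(j in J) u n j).
Proof.
move=> U0 u0 Uu; apply: ge_ereal_sup => _ [F [finF FJ] <-].
have H (s : seq T) : \sum_(j <- s) U j <= limn_einf (fun n => \sum_(j <- s) u n j).
  elim: s => [|j s IH].
    by apply/le_limn_einfP => t; rewrite big_nil => t0; apply: nearW => n; rewrite big_nil.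
  rewrite big_cons (_ : (fun n => _) = (fun n => u n j + \sum_(i <- s) u n i)).
    apply: limn_einfD => //; [exact: sume_ge0|move=> n; exact: sume_ge0].
  by apply/funext => n; rewrite big_cons.
rewrite fsbig_finite//=; apply: le_trans (H _) _.
apply/le_limn_einfP => t /((le_limn_einfP _ _).1 (lexx _)); apply: filterS => n tn.
apply: lt_le_trans tn _; rewrite -fsbig_finite//; apply: ereal_sup_ubound.
by exists F.
Qed.

Lemma fatou_ae d (T : measurableType d) (mu : {measure set T -> \bar R})
    (F : nat -> T -> R) (f : T -> R) :
  (forall n, measurable_fun setT (F n)) -> (forall n x, (0 <= F n x)%R) ->
  measurable_fun setT f -> (forall x, (0 <= f x)%R) ->
  {ae mu, forall x, F n x @[n --> \oo] --> f x} ->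
  \int[mu]_x (f x)%:E <= limn_einf (fun n => \int[mu]_x (F n x)%:E).
Proof.
move=> mF F0 mf f0 Ff.
have mFE n : measurable_fun setT (fun x => (F n x)%:E) by exact/measurable_EFinP.
have mL : measurable_fun setT (fun x => limn_einf (fun n => (F n x)%:E)).
  apply: (emeasurable_fun_cvg (fun n x => einfs (fun n => (F n x)%:E) n)).
    by move=> n; exact: (measurable_fun_einfs mFE).
  by move=> x _; rewrite limn_einf_lim; exact: is_cvg_einfs.
apply: le_trans (fatou mu measurableT mFE _); last by move=> n x _; rewrite lee_fin.
have L0 x : 0 <= limn_einf (fun n => (F n x)%:E).
  apply/le_limn_einfP => t t0; apply: nearW => n; apply: lt_le_trans t0 _; by rewrite lee_fin.
rewrite le_eqVlt; apply/orP; left; apply/eqP; apply: ge0_ae_eq_integral => //.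
- exact/measurable_EFinP.
- by move=> x _; rewrite lee_fin.
- apply: filterS Ff => x Fx _; apply/esym.
  have /cvg_limn_einf_sup[-> _] // : (F n x)%:E @[n --> \oo] --> (f x)%:E.
  by apply: cvg_EFin => //; exact: nearW.
Qed.
End LiminfBounds.

(** * Completeness of the space of integrable functions *)

Section L1Complete.
Variables (R : realType) (G : preTopologicalZmodType).
Variable mu : {measure set (borel G) -> \bar R}.
Local Notation Re := complex.Re.
Local Notation Im := complex.Im.
Local Notation cint := (cintegrable mu).

Lemma cabs_dist (a b : R[i]) : `|cabs a - cabs b| <= cabs (a - b).
Proof.
rewrite ler_norml lerNl opprB; apply/andP; split.
  by rewrite lerBlDr cabsB (le_trans _ (cabsD _ _))// subrK.
by rewrite lerBlDr (le_trans _ (cabsD _ _))// subrK.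
Qed.

Lemma cabs_cvg (z : nat -> R[i]) (w a : R[i]) : cabs (z n - w) @[n --> \oo] --> (0 : R) ->
  cabs (a - z n) @[n --> \oo] --> cabs (a - w).
Proof.
move=> zw; apply/cvgrPdist_le => e e0.
move/cvgrPdist_le : zw => /(_ e e0); apply: filterS => n.
rewrite sub0r normrN ger0_norm ?cabs_ge0// => zwe; apply: le_trans (cabs_dist _ _) _.
by rewrite opprB addrC addrA subrK.
Qed.

Lemma cabs_cvg0 (z : nat -> R[i]) (w : R[i]) : cabs (z n - w) @[n --> \oo] --> (0 : R) ->
  cabs (z n) @[n --> \oo] --> cabs w.
Proof.
move=> /(cabs_cvg (a := 0)); rewrite sub0r cabsN.
by under eq_cvg do rewrite sub0r cabsN.
Qed.

Lemma complex_cvg (z : nat -> R[i]) (w : R[i]) :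
  Re (z n) @[n --> \oo] --> Re w -> Im (z n) @[n --> \oo] --> Im w ->
  cabs (z n - w) @[n --> \oo] --> (0 : R).
Proof.
move=> rw iw; apply: (@squeeze_cvgr _ _ _ _ (fun=> 0) (fun n => `|Re (z n) - Re w| + `|Im (z n) - Im w|)).
- apply: nearW => n; rewrite cabs_ge0 /=; apply: le_trans (cabs_le _) _.
  by rewrite ReD ReN ImD ImN.
- exact: cvg_cst.
- rewrite -[X in _ --> X](addr0 0); apply: cvgD.
    apply/norm_cvg0P; rewrite -(subrr (Re w)); apply: cvgB => //; exact: cvg_cst.
  apply/norm_cvg0P; rewrite -(subrr (Im w)); apply: cvgB => //; exact: cvg_cst.
Qed.

Lemma cvgn_of_summable (u : nat -> R) (v : nat -> R) :
  (forall n, `|u n.+1 - u n| <= v n) -> (\sum_(n <oo) (v n)%:E < +oo)%E -> cvgn u.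
Proof.
move=> uv vfin.
have v0 n : 0 <= v n by apply: le_trans (uv n).
have cv : cvgn (series v).
  apply: nondecreasing_is_cvgn; first by apply: nondecreasing_series => n _ _.
  exists (fine (\sum_(n <oo) (v n)%:E)%E) => _ [n _ <-].
  rewrite -lee_fin fineK; last by rewrite ge0_fin_numE// nneseries_ge0// => k _ _; rewrite lee_fin.
  rewrite /series /= -sumEFin; apply: nneseries_lim_ge => k _ _; by rewrite lee_fin.
have cn : cvgn [normed series (telescope u)].
  apply: series_le_cvg cv => // n; first exact: normr_ge0.
have := @normed_cvg R R^o (telescope u) cn.
rewrite telescopeK => cu.
have -> : u = (fun n => (u n - u 0%N) + u 0%N) by apply/funext => n; rewrite subrK.
by apply: is_cvgD => //; exact: is_cvg_cst.
Qed.

(** The Riesz-Fischer theorem.  The subsequence is part of the conclusion because the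
lower semicontinuity of a [fatou_norm] is stated for convergence almost everywhere. *)
Lemma L1_complete (f_ : nat -> G -> R[i]) : (forall n, cint (f_ n)) ->
  (forall e : R, 0 < e -> exists k, forall m n, (k <= m)%N -> (k <= n)%N ->
     (\int[mu]_x (cabs (f_ m x - f_ n x))%:E < e%:E)%E) ->
  exists (f : G -> R[i]) (phi : nat -> nat), [/\ cint f, forall k, (k <= phi k)%N,
    {ae mu, forall x : borel G, cabs (f_ (phi k) x - f x) @[k --> \oo] --> (0 : R)} &
    forall e : R, 0 < e -> exists k, forall n, (k <= n)%N ->
      (\int[mu]_x (cabs (f_ n x - f x))%:E <= e%:E)%E].
Proof.
move=> fi fcau.
(* Beyond [K j] the members are within 2^-j of each other, so the increments of the
   subsequence [phi] are summable. *)
have [K KP] : {K : nat -> nat & forall j m n, (K j <= m)%N -> (K j <= n)%N ->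
    (\int[mu]_x (cabs (f_ m x - f_ n x))%:E < (2^-1 ^+ j)%:E)%E}.
  apply: (@choice _ _ (fun j k => forall m n, (k <= m)%N -> (k <= n)%N ->
      (\int[mu]_x (cabs (f_ m x - f_ n x))%:E < (2^-1 ^+ j)%:E)%E)) => j.
  by apply: fcau; rewrite exprn_gt0// invr_gt0.
pose phi := fix phi k := if k is k'.+1 then maxn (phi k').+1 (K k) else K 0%N.
have phiK k : (K k <= phi k)%N by case: k => //= k; exact: leq_maxr.
have phiS k : (phi k < phi k.+1)%N by rewrite /= leq_maxl.
have phi_ge k : (k <= phi k)%N.
  by elim: k => // k IH; exact: leq_ltn_trans IH (phiS k).
have mdiff m n : measurable_fun [set: borel G] (fun x : borel G => cabs (f_ m x - f_ n x)).
  by apply: cmeasurable_cabs; apply: cmeasurableB; [case: (fi m)|case: (fi n)].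
have mdiffE m n : measurable_fun [set: borel G] (fun x : borel G => (cabs (f_ m x - f_ n x))%:E).
  exact/measurable_EFinP.
pose h (x : borel G) := (\sum_(k <oo) (cabs (f_ (phi k.+1) x - f_ (phi k) x))%:E)%E.
have mh : measurable_fun setT h.
  by apply: ge0_emeasurable_sum => // k x _ _; rewrite lee_fin cabs_ge0.
have h0 x : (0 <= h x)%E by apply: nneseries_ge0 => k _ _; rewrite lee_fin cabs_ge0.
have hfin : (\int[mu]_x h x < +oo)%E.
  rewrite integral_nneseries//; last by move=> k x _; rewrite lee_fin cabs_ge0.
  apply: (@le_lt_trans _ _ 2%:E); last exact: ltry.
  apply: lime_le.
    by apply: is_cvg_nneseries => k _ _; apply: integral_ge0 => x _; rewrite lee_fin cabs_ge0.
  apply: nearW => n; apply: (@le_trans _ _ (\sum_(0 <= k < n) (2^-1 ^+ k)%:E)%E).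
    apply: lee_sum => k _; apply: ltW; apply: KP; last exact: phiK.
    exact: leq_trans (phiK k) (ltnW (phiS k)).
  rewrite sumEFin lee_fin.
  have := @geometric_le_lim R n 1 2^-1 ler01; rewrite invr_gt0 ltr0n => /(_ isT).
  rewrite ger0_norm ?invr_ge0// invf_lt1 ?ltr1n// => /(_ isT).
  rewrite (_ : 1 / (1 - 2^-1) = 2 :> R); last by field.
  by apply: le_trans; rewrite /series /= /geometric; under [leRHS]eq_bigr do rewrite mul1r.
(* Where the sum of the increments converges the subsequence is Cauchy; the
   limit is set to 0 elsewhere to be defined and measurable everywhere. *)
pose A : set (borel G) := [set x | (h x < +oo)%E].
have mA : measurable A.
  by rewrite -[A]setTI; apply: measurable_lte => //; exact: measurable_cst.
have hA : {ae mu, forall x, A x}.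
  have hi : mu.-integrable setT h.
    by apply/integrableP; split=> //; under eq_integral do rewrite gee0_abs//.
  by apply: filterS (integrable_ae measurableT hi) => x /(_ I); rewrite ge0_fin_numE.
have cRe x : A x -> cvgn (fun k => Re (f_ (phi k) x)).
  move=> Ax; apply: (cvgn_of_summable (v := fun k => cabs (f_ (phi k.+1) x - f_ (phi k) x))) => // k.
  by rewrite -ReN -ReD; exact: cabs_Re.
have cIm x : A x -> cvgn (fun k => Im (f_ (phi k) x)).
  move=> Ax; apply: (cvgn_of_summable (v := fun k => cabs (f_ (phi k.+1) x - f_ (phi k) x))) => // k.
  by rewrite -ImN -ImD; exact: cabs_Im.
pose f (x : G) : R[i] := if x \in (A : set G)
  then (limn (fun k => Re (f_ (phi k) x)) +i* limn (fun k => Im (f_ (phi k) x)))%C else 0.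
have mf : cmeasurable f.
  have mlim (g : R[i] -> R) : (forall n, measurable_fun setT (fun x : borel G => g (f_ n x))) ->
      (forall x, A x -> cvgn (fun k => g (f_ (phi k) x))) ->
      measurable_fun setT (fun x : borel G => limn (fun k => g (f_ (phi k) x)) * \1_A x).
    move=> mg cg; apply: (@measurable_fun_cvg _ (borel G) R setT
      (fun k (x : borel G) => g (f_ (phi k) x) * \1_A x)) => [k|x _].
      by apply: measurable_funM => //; exact: measurable_indic.
    rewrite indicE; have [xA|xA] := boolP (x \in A).
      under eq_cvg do rewrite mulr1; rewrite mulr1; apply: cg; by rewrite inE in xA.
    rewrite mulr0; under eq_cvg do rewrite mulr0; exact: cvg_cst.
  split.
  - rewrite (_ : (fun x => _) = (fun x : borel G => limn (fun k => Re (f_ (phi k) x)) * \1_A x)).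
      by apply: mlim => // n; case: (fi n) => -[].
    by apply/funext => x; rewrite /f indicE; case: (_ \in _); rewrite ?mulr1 ?mulr0.
  - rewrite (_ : (fun x => _) = (fun x : borel G => limn (fun k => Im (f_ (phi k) x)) * \1_A x)).
      by apply: mlim => // n; case: (fi n) => -[].
    by apply/funext => x; rewrite /f indicE; case: (_ \in _); rewrite ?mulr1 ?mulr0.
have fcvg : {ae mu, forall x : borel G, cabs (f_ (phi k) x - f x) @[k --> \oo] --> (0 : R)}.
  apply: filterS hA => x Ax; apply: complex_cvg; rewrite /f mem_set//=; [exact: cRe|exact: cIm].
have key j n : (K j <= n)%N -> (\int[mu]_x (cabs (f_ n x - f x))%:E <= (2^-1 ^+ j)%:E)%E.
  move=> Kn; apply: (@le_trans _ _
    (limn_einf (fun k => \int[mu]_x (cabs (f_ n x - f_ (phi k) x))%:E)%E)).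
    apply: (@fatou_ae R _ (borel G) mu (fun k (x : borel G) => cabs (f_ n x - f_ (phi k) x))
      (fun x : borel G => cabs (f_ n x - f x))) => //.
    - by move=> k x; exact: cabs_ge0.
    - by apply: cmeasurable_cabs; apply: cmeasurableB => //; case: (fi n).
    - by move=> x; exact: cabs_ge0.
    - by apply: filterS fcvg => x; exact: cabs_cvg.
  apply: limn_einf_le; exists (K j) => // k /= Kk; apply: ltW; apply: KP => //.
  exact: leq_trans Kk (phi_ge k).
have fint : cint f.
  have fnf : cint (fun x => f_ (K 0%N) x - f x).
    split; first by apply: cmeasurableB => //; case: (fi (K 0%N)).
    by apply: le_lt_trans (key 0%N (K 0%N) (leqnn _)) _; exact: ltry.
  rewrite (_ : f = fun x => f_ (K 0%N) x - (f_ (K 0%N) x - f x)).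
    exact: cintegrableB.
  by apply/funext => x; rewrite opprB addrC subrK.
exists f, phi; split => // e e0.
have [j je] : exists j : nat, 2^-1 ^+ j <= e.
  have /cvgrPdist_le /(_ e e0) [j _ /(_ j)] : (2^-1 : R) ^+ n @[n --> \oo] --> 0.
    by apply: cvg_expr; rewrite ger0_norm ?invr_ge0// invf_lt1 ?ltr1n.
  rewrite /= leqnn sub0r normrN ger0_norm ?exprn_ge0 ?invr_ge0// => /(_ isT) je.
  by exists j.
exists (K j) => n Kn; apply: le_trans (key j n Kn) _; by rewrite lee_fin.
Qed.
End L1Complete.

(** * Banach spaces from lower semicontinuous norms *)

Section FatouNorm.
Variables (R : realType) (G : topologicalZmodType).
Variable mu : {measure set (borel G) -> \bar R}.
Local Notation cint := (cintegrable mu).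
Implicit Types f g : G -> R[i].

(** The last clause is Fatou's lemma, required only of sequences that converge both
in the mean and almost everywhere.  Suitable subsequences of Cauchy sequences do, and
the norm of a transform is lower semicontinuous for convergence in the mean. *)
Definition fatou_norm (N : (G -> R[i]) -> \bar R) : Prop :=
  [/\ forall f, cint f -> (\int[mu]_x (cabs (f x))%:E <= N f)%E,
      forall a f, cint f -> N (fun x => a * f x) = ((cabs a)%:E * N f)%E,
      forall f g, cint f -> cint g -> (N (fun x => f x + g x)%R <= N f + N g)%E &
      forall (f_ : nat -> G -> R[i]) f (c : R), (forall n, cint (f_ n)) -> cint f ->
        {ae mu, forall x : borel G, cabs (f_ n x - f x) @[n --> \oo] --> (0 : R)} ->
        (forall e : R, 0 < e -> exists k, forall n, (k <= n)%N ->
          (\int[mu]_x (cabs (f_ n x - f x))%:E <= e%:E)%E) ->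
        (forall n, N (f_ n) <= c%:E)%E -> (N f <= c%:E)%E].

Variable N : (G -> R[i]) -> \bar R.
Hypothesis hN : fatou_norm N.

Definition norm_class : set (L0 mu) :=
  [set ae_class mu f | f in [set f | cint f /\ (N f < +oo)%E]].

Definition norm_of (u : L0 mu) : R := fine (N (mrepr u)).

Lemma ae_class0 : ae_class mu (fun=> 0) = 0.
Proof.
have := ae_classD mu 0 0; rewrite addr0 => /eqP; rewrite addrC -subr_eq subrr => /eqP E.
exact/esym.
Qed.

Lemma ae_classB f g : ae_class mu f - ae_class mu g = ae_class mu (fun x => f x - g x).
Proof.
rewrite addrC -scaleN1r ae_class_lin; congr ae_class; apply/funext => x.
by rewrite mulN1r addrC.
Qed.

Lemma fatou_norm_ge0 f : cint f -> (0 <= N f)%E.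
Proof.
move=> fi; case: hN => + _ _ _ => /(_ f fi); apply: le_trans.
by apply: integral_ge0 => x _; rewrite lee_fin cabs_ge0.
Qed.

(** Lower semicontinuity along a constant sequence, which converges to every function
equal to it almost everywhere. *)
Lemma fatou_norm_ae f g : cint f -> cint g -> {ae mu, forall x : borel G, f x = g x} ->
  N f = N g.
Proof.
have H f' g' : cint f' -> cint g' -> {ae mu, forall x : borel G, f' x = g' x} -> (N g' <= N f')%E.
  move=> fi gi fg; have [_ _ _ N4] := hN.
  have := fatou_norm_ge0 fi; case E : (N f') => [c| |]// _; last by rewrite leey.
  apply: (N4 (fun=> f')) => // [|e e0|n]; last by rewrite E.
  - apply: filterS fg => x ->; rewrite subrr cabs0; exact: cvg_cst.
  - exists 0%N => n _; have [mf _] := fi; have [mg _] := gi.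
    rewrite (@ae_eq_integral _ _ _ mu setT (cst 0%E)) ?integral0 ?lee_fin ?ltW//.
    + by apply/measurable_EFinP; apply: cmeasurable_cabs; exact: cmeasurableB.
    + by apply: filterS fg => x -> _; rewrite subrr cabs0.
move=> fi gi fg; apply/eqP; rewrite eq_le !H//.
by apply: filterS fg => x.
Qed.

Lemma norm_ofE f : cint f -> norm_of (ae_class mu f) = fine (N f).
Proof.
move=> fi; have [mf _] := fi; have [mr fr] := mreprP mu mf.
congr fine; apply: fatou_norm_ae => //; apply: cintegrable_ae fi => //.
by apply: filterS fr => x ->.
Qed.

Lemma norm_class_lin a u v : norm_class u -> norm_class v -> norm_class (a *: u + v).
Proof.
move=> [f [fi Nf] <-] [g [gi Ng] <-]; have [_ N2 N3 _] := hN.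
have afi := cintegrableZ a fi.
exists (fun x => a * f x + g x); last by rewrite ae_class_lin.
split; first exact: cintegrableD.
apply: le_lt_trans (N3 _ _ afi gi) _; rewrite N2//.
apply: lte_add_pinfty => //; apply: lte_mul_pinfty => //; by rewrite lee_fin cabs_ge0.
Qed.

(** A Cauchy sequence for [N] is Cauchy in the mean, hence has a limit [f] in the mean
and along a subsequence almost everywhere.  For fixed large [n], the differences of
f_n and late members of the subsequence have small norm and converge to f_n - f,
whose norm is therefore small. *)
Lemma fatou_norm_banach : banach_space norm_class norm_of.
Proof.
have [N1 N2 N3 N4] := hN.
have fin f : cint f -> (N f < +oo)%E -> N f \is a fin_num.
  by move=> fi Nf; rewrite ge0_fin_numE//; exact: fatou_norm_ge0.
have B0 : norm_class 0.
  exists (fun=> 0).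
    split; first exact: cintegrable0.
    have := N2 0 (fun=> 0) (cintegrable0 mu).
    by rewrite cabs0 mul0e; under eq_fun do rewrite mul0r; move=> ->; exact: ltry.
  exact: ae_class0.
split.
- by split=> // a u v; exact: norm_class_lin.
- move=> _ [f [fi Nf] <-]; rewrite norm_ofE//; split.
    by apply: fine_ge0; exact: fatou_norm_ge0.
  move=> Nf0; have {}Nf0 : N f = 0%E by rewrite -(fineK (fin f fi Nf)) Nf0.
  rewrite -ae_class0; apply/ae_class_eqP.
  have [mf _] := fi.
  have mfE : measurable_fun [set: borel G] (fun x : borel G => (cabs (f x))%:E).
    by apply/measurable_EFinP; exact: cmeasurable_cabs.
  have : (\int[mu]_x `|(cabs (f x))%:E| = 0)%E.
    under eq_integral do rewrite gee0_abs ?lee_fin ?cabs_ge0//.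
    apply/eqP; rewrite eq_le -{1}Nf0 N1//=.
    by apply: integral_ge0 => x _; rewrite lee_fin cabs_ge0.
  move/(ae_eq_integral_abs mu measurableT mfE); apply: filterS => x /(_ I) /= [].
  exact: cabs_eq0.
- move=> a _ [f [fi Nf] <-].
  have -> : a *: ae_class mu f = ae_class mu (fun x => a * f x).
    by rewrite -[LHS]addr0 -ae_class0 ae_class_lin; congr ae_class; apply/funext => x; rewrite addr0.
  rewrite !norm_ofE//; last exact: cintegrableZ.
  by rewrite N2// fineM// fin.
- move=> _ _ [f [fi Nf] <-] [g [gi Ng] <-].
  rewrite -ae_classD -[_ + _]/(fun x => f x + g x) !norm_ofE//; last exact: cintegrableD.
  rewrite -fineD ?fin//; apply: fine_le; last exact: N3.
    rewrite fin//; first exact: cintegrableD.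
    by apply: le_lt_trans (N3 _ _ fi gi) _; exact: lte_add_pinfty.
  by rewrite fin_numD !fin.
- move=> s sB scau.
  have [f_ fP] : {f_ : nat -> G -> R[i] & forall n, (cint (f_ n) /\ (N (f_ n) < +oo)%E) /\ ae_class mu (f_ n) = s n}.
    apply: (@choice _ _ (fun n f => (cint f /\ (N f < +oo)%E) /\ ae_class mu f = s n)) => n.
    by have [f [fi Nf] fE] := sB n; exists f.
  have fi n : cint (f_ n) by case: (fP n) => -[].
  have Nf n : (N (f_ n) < +oo)%E by case: (fP n) => -[].
  have fs n : ae_class mu (f_ n) = s n by case: (fP n).
  have dN m n : (N (fun x => f_ m x - f_ n x)%R < +oo)%E.
    have nfi : cint (fun x => -1 * f_ n x) by exact: cintegrableZ.
    rewrite (_ : (fun x => _) = fun x => f_ m x + (-1 * f_ n x)); last first.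
      by apply/funext => x; rewrite mulN1r.
    apply: le_lt_trans (N3 _ _ (fi m) nfi) _; rewrite N2//.
    by apply: lte_add_pinfty => //; apply: lte_mul_pinfty => //; rewrite lee_fin cabs_ge0.
  have di m n : cint (fun x => f_ m x - f_ n x) by exact: cintegrableB.
  have cau e : 0 < e -> exists k, forall m n, (k <= m)%N -> (k <= n)%N ->
      (N (fun x => f_ m x - f_ n x)%R < e%:E)%E.
    move=> e0; have [k kP] := scau e e0; exists k => m n km kn.
    have := kP m n km kn; rewrite -!fs ae_classB norm_ofE//.
    by rewrite -lte_fin fineK// fin.
  have [|f [phi [fint phi_ge fcvg fL1]]] := L1_complete fi.
    move=> e e0; have [k kP] := cau e e0; exists k => m n km kn.
    by apply: le_lt_trans (kP m n km kn); apply: N1.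
  have key e : 0 < e -> exists k, forall n, (k <= n)%N -> (N (fun x => f_ n x - f x)%R <= e%:E)%E.
    move=> e0; have [k kP] := cau e e0; exists k => n kn.
    have subE (x : G) (m : nat) : f_ n x - f_ m x - (f_ n x - f x) = - (f_ m x - f x).
      by ring.
    apply: (N4 (fun j => fun x => f_ n x - f_ (phi (j + k)%N) x)).
    + by move=> j; exact: di.
    + exact: cintegrableB.
    + apply: filterS fcvg => x fx; under eq_cvg do rewrite subE cabsN.
      by move: fx; rewrite -(cvg_shiftn k).
    + move=> d d0; have [M MP] := fL1 d d0; exists M => j Mj.
      under eq_integral do rewrite subE cabsN.
      by apply: MP; apply: leq_trans (phi_ge _); apply: leq_trans Mj _; exact: leq_addr.
    + move=> j; apply: ltW; apply: kP => //.
      by apply: leq_trans (phi_ge _); exact: leq_addl.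
  have Nfin : (N f < +oo)%E.
    have [k kP] := key 1 ltr01.
    have dfi : cint (fun x => -1 * (f_ k x - f x)) by apply: cintegrableZ; exact: cintegrableB.
    rewrite (_ : f = fun x => f_ k x + (-1 * (f_ k x - f x))); last first.
      by apply/funext => x; rewrite mulN1r opprB addrC subrK.
    apply: le_lt_trans (N3 _ _ (fi k) dfi) _; rewrite N2; last exact: cintegrableB.
    apply: lte_add_pinfty => //; apply: lte_mul_pinfty => //; first by rewrite lee_fin cabs_ge0.
    by apply: le_lt_trans (kP k (leqnn k)) _; exact: ltry.
  exists (ae_class mu f); first by exists f.
  apply/cvgrPdist_le => e e0; have [k kP] := key e e0; exists k => // n /= kn.
  have fnf : cint (fun x => f_ n x - f x) by exact: cintegrableB.
  rewrite sub0r normrN -fs ae_classB norm_ofE// ger0_norm ?fine_ge0 ?fatou_norm_ge0//.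
  rewrite -lee_fin fineK; first exact: kP.
  rewrite ge0_fin_numE ?fatou_norm_ge0//; apply: le_lt_trans (kP n kn) _; exact: ltry.
Qed.
End FatouNorm.

(** * Beurling algebras *)

Section WeightedL1.
Variables (R : realType) (G : topologicalZmodType).
Variable mu : {measure set (borel G) -> \bar R}.
Hypothesis hG : lca G.
Hypothesis hmu : haar_measure mu.
Variable w : G -> R.
Hypothesis hw : beurling_weight mu w.
Local Notation cint := (cintegrable mu).
Implicit Types f g : G -> R[i].

Let mw : measurable_fun [set: borel G] (w : borel G -> R). Proof. by case: hw. Qed.
Let w1 x : 1 <= w x. Proof. by case: hw. Qed.
Let w0 x : 0 <= w x. Proof. exact: le_trans (w1 x). Qed.
Let wM x y : w (x + y) <= w x * w y. Proof. by case: hw. Qed.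

Lemma norm1wE f : norm1w mu w f = (\int[mu]_x (cabs (f x) * w x)%:E)%E.
Proof.
rewrite /norm1w Lnorm1; apply: eq_integral => x _ /=.
by rewrite ger0_norm// mulr_ge0 ?cabs_ge0.
Qed.

Lemma measurable_cabsw f : cmeasurable f ->
  measurable_fun [set: borel G] (fun x : borel G => cabs (f x) * w x).
Proof. by move=> mf; apply: measurable_funM => //; exact: cmeasurable_cabs. Qed.

Lemma norm1w_fatou_norm : fatou_norm mu (norm1w mu w).
Proof.
have cw0 f x : 0 <= cabs (f x) * w x by rewrite mulr_ge0 ?cabs_ge0.
have mE f : cmeasurable f -> measurable_fun [set: borel G] (fun x : borel G => (cabs (f x) * w x)%:E).
  by move=> mf; apply/measurable_EFinP; exact: measurable_cabsw.
split.
- move=> f [mf _]; rewrite norm1wE; apply: ge0_le_integral => //.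
  + by move=> x _; rewrite lee_fin cabs_ge0.
  + by apply/measurable_EFinP; exact: cmeasurable_cabs.
  + exact: mE.
  + by move=> x _; rewrite lee_fin ler_peMr ?cabs_ge0.
- move=> a f [mf _]; rewrite !norm1wE.
  transitivity (\int[mu]_x ((cabs a)%:E * (cabs (f x) * w x)%:E))%E.
    by apply: eq_integral => x _; rewrite cabsM -mulrA EFinM.
  apply: ge0_integralZl_EFin; [exact: measurableT| |exact: mE|exact: cabs_ge0].
  by move=> x _; rewrite lee_fin.
- move=> f g [mf _] [mg _]; rewrite !norm1wE -ge0_integralD//; last 4 first.
  + by move=> x _; rewrite lee_fin.
  + exact: mE.
  + by move=> x _; rewrite lee_fin.
  + exact: mE.
  apply: ge0_le_integral => //.
  + by move=> x _; rewrite lee_fin; exact: (cw0 (fun x => f x + g x)).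
  + by apply: mE; exact: cmeasurableD.
  + by apply: emeasurable_funD; exact: mE.
  + by move=> x _; rewrite -EFinD lee_fin -mulrDl ler_wpM2r// cabsD.
- move=> f_ f c fi [mf _] fcvg _ fc; rewrite norm1wE.
  apply: (@le_trans _ _ (limn_einf (fun n => norm1w mu w (f_ n)))); last first.
    by apply: limn_einf_le; exact: nearW.
  under [X in limn_einf X]eq_fun do rewrite norm1wE.
  apply: (@fatou_ae R _ (borel G) mu (fun n (x : borel G) => cabs (f_ n x) * w x)
    (fun x : borel G => cabs (f x) * w x)) => //.
  + by move=> n; apply: measurable_cabsw; case: (fi n).
  + exact: measurable_cabsw.
  + apply: filterS fcvg => x fx; apply: cvgM; [exact: cabs_cvg0|exact: cvg_cst].
Qed.

Lemma convolution_weight_le f g (x : G) : cmeasurable f -> cmeasurable g ->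
  ((cabs (convolution mu f g x) * w x)%:E <=
   econv mu (fun y => (cabs (f y) * w y)%:E) (fun y => (cabs (g y) * w y)%:E) x)%E.
Proof.
move=> mf mg.
have m1 := measurable_modulus mf; have m2 := measurable_modulus mg.
have m3 : measurable_fun [set: borel G] (fun x : borel G => (cabs (f x) * w x)%:E).
  by apply/measurable_EFinP; exact: measurable_cabsw.
have m4 : measurable_fun [set: borel G] (fun x : borel G => (cabs (g x) * w x)%:E).
  by apply/measurable_EFinP; exact: measurable_cabsw.
rewrite EFinM; apply: (@le_trans _ _ (econv mu (modulus f) (modulus g) x * (w x)%:E)%E).
  by apply: lee_wpmul2r; rewrite ?lee_fin//; exact: convolution_le.
apply: (@le_trans _ _ (\int[mu]_z (modulus f z * modulus g (x - z)%R * (w x)%:E))%E).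
  rewrite le_eqVlt; apply/orP; left; apply/eqP; apply/esym.
  apply: ge0_integralZr => //; last by rewrite lee_fin.
  - by apply: emeasurable_funM => //; exact: measurable_comp_subl.
  - by move=> z _; rewrite mule_ge0// modulus_ge0.
apply: ge0_le_integral => //.
- by move=> z _; rewrite !mule_ge0 ?modulus_ge0// lee_fin.
- by apply: emeasurable_funM; [apply: emeasurable_funM => //; exact: measurable_comp_subl|exact: measurable_cst].
- by apply: emeasurable_funM => //; apply: (measurable_comp_subl (g := fun y => (cabs (g y) * w y)%:E)).
- move=> z _; rewrite /modulus -!EFinM lee_fin mulrACA ler_wpM2l ?mulr_ge0 ?cabs_ge0//.
  by rewrite -[x in w x <= _](subrK z) addrC; exact: wM.
Qed.

Lemma norm1w_nnL1 f : cmeasurable f -> (norm1w mu w f < +oo)%E ->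
  nnL1 mu (fun y : borel G => (cabs (f y) * w y)%:E).
Proof.
move=> mf Nf; split; first by apply/measurable_EFinP; exact: measurable_cabsw.
- by move=> x; rewrite lee_fin mulr_ge0 ?cabs_ge0.
- by rewrite -norm1wE.
Qed.

Lemma norm1w_cint f : cmeasurable f -> (norm1w mu w f < +oo)%E -> cint f.
Proof.
move=> mf Nf; apply: (@cintegrable_le _ _ mu f (fun x => (cabs (f x) * w x)%:E)) => //.
- by apply/measurable_EFinP; exact: measurable_cabsw.
- by move=> x; rewrite lee_fin ler_peMr ?cabs_ge0.
- by rewrite -norm1wE.
Qed.

(** Integrate [convolution_weight_le]: the integral of a convolution of nonnegative
functions is the product of the integrals. *)
Lemma norm1w_convolution_le f g F : cmeasurable f -> cmeasurable g -> cmeasurable F ->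
  (norm1w mu w f < +oo)%E -> (norm1w mu w g < +oo)%E ->
  {ae mu, forall x : borel G, convolution mu f g x = F x} ->
  (norm1w mu w F <= norm1w mu w f * norm1w mu w g)%E.
Proof.
move=> mf mg mF Nf Ng FE.
have fL1 := norm1w_nnL1 mf Nf; have gL1 := norm1w_nnL1 mg Ng.
have [mc c0 _] := nnL1_econv hG hmu fL1 gL1.
rewrite [X in (_ <= X * _)%E]norm1wE [X in (_ <= _ * X)%E]norm1wE -(integral_econv hG hmu fL1 gL1) norm1wE.
apply: ae_ge0_le_integral => //.
- by move=> x _; rewrite lee_fin mulr_ge0 ?cabs_ge0.
- by apply/measurable_EFinP; exact: measurable_cabsw.
- by apply: filterS FE => x <- _; exact: convolution_weight_le.
Qed.

Lemma L1wE : L1w mu w = norm_class (norm1w mu w).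
Proof.
apply/seteqP; split=> _ [f [mf Nf] <-]; exists f => //; split => //; first exact: norm1w_cint.
by case: mf.
Qed.

Lemma L1w_L1class u : L1w mu w u -> L1class u.
Proof. by rewrite L1wE => -[f [fi _] <-]; exists f. Qed.

Lemma L1w_banach_algebra : banach_algebra (L1w mu w) (L1w_norm mu w) (conv_class mu).
Proof.
have N := norm1w_fatou_norm.
have H u v : L1w mu w u -> L1w mu w v -> L1w mu w (conv_class mu u v) /\
    L1w_norm mu w (conv_class mu u v) <= L1w_norm mu w u * L1w_norm mu w v.
  rewrite L1wE => -[f [fi Nf] <-] [g [gi Ng] <-].
  have [mf _] := fi; have [mg _] := gi.
  have [F [iF FE _]] := convolution_repr hG hmu fi gi; have [mF _] := iF.
  have NF := norm1w_convolution_le mf mg mF Nf Ng FE.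
  have fN f' : cint f' -> (norm1w mu w f' < +oo)%E -> norm1w mu w f' \is a fin_num.
    by move=> fi' Nf'; rewrite ge0_fin_numE//; exact: (fatou_norm_ge0 N).
  have NFfin : (norm1w mu w F < +oo)%E.
    by apply: le_lt_trans NF _; apply: lte_mul_pinfty; rewrite ?fN//; exact: (fatou_norm_ge0 N).
  rewrite conv_classE// (_ : ae_class mu (convolution mu f g) = ae_class mu F); last exact/ae_class_eqP.
  split; first by exists F.
  rewrite -[L1w_norm mu w]/(norm_of (norm1w mu w)) !(norm_ofE N)//.
  by rewrite -fineM ?fN//; apply: fine_le => //; rewrite ?fN// fin_numM ?fN.
split.
- by rewrite L1wE; exact: fatou_norm_banach.
- by move=> f g fL gL; case: (H f g fL gL).
- split.
    by move=> a f g h /L1w_L1class fL /L1w_L1class gL /L1w_L1class hL; exact: conv_class_linl.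
  by move=> a f h k /L1w_L1class fL /L1w_L1class hL /L1w_L1class kL; exact: conv_class_linr.
- by move=> f g h /L1w_L1class fL /L1w_L1class gL /L1w_L1class hL; exact: conv_classA.
- by move=> f g fL gL; case: (H f g fL gL).
Qed.
End WeightedL1.

(** * The cells of a decomposition *)

Section Cells.
Variables (R : realType) (G : preTopologicalZmodType) (D : decomposition R G).
Local Notation a := (dec_dim D).
Local Notation iso := (@dec_iso R G D).
Local Notation H := (@dec_H R G D).

Lemma dec_iso_inj : injective iso.
Proof. by move=> u v; case: (dec_iso_bij D) => _ ij _; apply: ij; rewrite inE. Qed.

Lemma dec_iso_sur (x : G) : exists u, iso u = x.
Proof. by case: (dec_iso_bij D) => _ _ /(_ x I)[u _ <-]; exists u. Qed.

Definition dec_inv (x : G) : 'rV[R]_a * dec_G1 D := projT1 (cid (dec_iso_sur x)).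

Lemma dec_invK : cancel dec_inv iso.
Proof. by move=> x; exact: (projT2 (cid (dec_iso_sur x))). Qed.

Lemma dec_isoK : cancel iso dec_inv.
Proof. by move=> u; apply: dec_iso_inj; rewrite dec_invK. Qed.

Lemma dec_invD x y : dec_inv (x + y) = dec_inv x + dec_inv y.
Proof. by apply: dec_iso_inj; rewrite dec_isoD !dec_invK. Qed.

Lemma dec_invN x : dec_inv (- x) = - dec_inv x.
Proof.
have inv0 : dec_inv 0 = 0.
  by apply: (addrI (dec_inv 0)); rewrite -dec_invD !addr0.
by apply: (addrI (dec_inv x)); rewrite -dec_invD !subrr.
Qed.

Lemma dec_invB x y : dec_inv (x - y) = dec_inv x - dec_inv y.
Proof. by rewrite dec_invD dec_invN. Qed.

Lemma dec_inv_continuous : continuous dec_inv.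
Proof.
apply/continuousP => U oU.
rewrite (_ : _ @^-1` _ = iso @` U); first exact: dec_iso_open.
apply/seteqP; split => x /=; first by exists (dec_inv x); rewrite ?dec_invK.
by case=> u Uu <-; rewrite dec_isoK.
Qed.

Lemma dec_HN x : H x -> H (- x).
Proof. by move=> Hx; rewrite -sub0r; apply: dec_HB => //; exact: dec_H0. Qed.

Lemma dec_HD x y : H x -> H y -> H (x + y).
Proof. by move=> Hx Hy; rewrite -[y]opprK; apply: dec_HB => //; exact: dec_HN. Qed.

Lemma dec_HC x y : H (x - y) -> H (y - x).
Proof. by move=> /dec_HN; rewrite opprB. Qed.

Lemma dec_H_trans y x z : H (x - y) -> H (y - z) -> H (x - z).
Proof. by move=> h1 h2; rewrite -(subrKA y); exact: dec_HD. Qed.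

Definition coset_rep (x : dec_G1 D) : dec_G1 D := projT1 (cid (dec_T_transversal (d := D) x)).

Lemma coset_repT x : dec_T (coset_rep x).
Proof. by rewrite /coset_rep; case: cid => t /= [[]]. Qed.

Lemma coset_repH x : H (x - coset_rep x).
Proof. by rewrite /coset_rep; case: cid => t /= [[]]. Qed.

Lemma coset_rep_eq x t : dec_T t -> H (x - t) -> coset_rep x = t.
Proof. by move=> Tt Ht; rewrite /coset_rep; case: cid => s /= [_]; apply; split. Qed.

Lemma coset_rep_class x y : (coset_rep x = coset_rep y) <-> H (x - y).
Proof.
split=> [e|h].
  by apply: (@dec_H_trans (coset_rep x)); [exact: coset_repH|rewrite e; apply: dec_HC; exact: coset_repH].
by apply: coset_rep_eq; [exact: coset_repT|apply: (dec_H_trans h); exact: coset_repH].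
Qed.

Definition lattice_point (n : 'rV[int]_a) (t : dec_G1 D) : G := iso (map_mx intr n, t).

Definition int_part (v : 'rV[R]_a) : 'rV[int]_a := \row_i Num.floor (v 0 i).

Definition cell_of (x : G) : G :=
  lattice_point (int_part (dec_inv x).1) (coset_rep (dec_inv x).2).

Lemma lattice_point_inj n m t s : lattice_point n t = lattice_point m s -> n = m /\ t = s.
Proof.
move/dec_iso_inj => [nm ->]; split => //; apply/rowP => i.
move/rowP : nm => /(_ i); rewrite !mxE => /eqP; rewrite eqr_int => /eqP.
by [].
Qed.

Lemma cell_of_index x : cell_index D (cell_of x).
Proof.
by exists (int_part (dec_inv x).1) => //; exists (coset_rep (dec_inv x).2); first exact: coset_repT.
Qed.

Lemma cellE x : cell D x <->
  (forall i, 0 <= (dec_inv x).1 0 i < 1) /\ H (dec_inv x).2.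
Proof.
split=> [[v Hv [h Hh <-]]|[h1 h2]]; first by rewrite dec_isoK.
exists (dec_inv x).1 => //; exists (dec_inv x).2 => //.
by rewrite -surjective_pairing dec_invK.
Qed.

Definition in_box (u : 'rV[R]_a * dec_G1 D) : set G := [set x |
  (forall i, u.1 0 i <= (dec_inv x).1 0 i < u.1 0 i + 1) /\ H ((dec_inv x).2 - u.2)].

Lemma cell_atE alpha : cell_at D alpha = in_box (dec_inv alpha).
Proof.
apply/seteqP; split=> x.
  move=> [y /cellE [h1 h2] <-]; rewrite /in_box /= dec_invD /=; split => [i|].
    by move: (h1 i); rewrite !mxE lerDl ltrD2l.
  by rewrite [_ + _ - _]addrAC subrr add0r.
move=> [h1 h2]; exists (x - alpha); last by rewrite addrC subrK.
apply/cellE; rewrite dec_invB; split=> // i.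
by move: (h1 i); rewrite !mxE subr_ge0 ltrBlDl.
Qed.

(** Floors and coset representatives locate the cell of a point, which makes the cells
a partition. *)
Lemma cell_atP alpha x : cell_index D alpha -> (cell_at D alpha x <-> cell_of x = alpha).
Proof.
case=> n _ [t Tt <-]; rewrite cell_atE dec_isoK /in_box /=; split=> [[h1 h2]|].
  rewrite /cell_of (coset_rep_eq Tt h2); congr lattice_point; apply/rowP => i; rewrite mxE.
  by apply: floor_def; rewrite intrD; move: (h1 i); rewrite !mxE.
move/lattice_point_inj => [<- <-]; split; last exact: coset_repH.
by move=> i; rewrite !mxE -[X in _ + X]/(1%:~R) -intrD; exact: floor_itv.
Qed.

Lemma cell_at_of x : cell_at D (cell_of x) x.
Proof. by apply/cell_atP => //; exact: cell_of_index. Qed.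

Lemma dec_coord_continuous i : continuous (fun x => (dec_inv x).1 0 i : R).
Proof.
move=> x; apply: (@continuous_comp _ _ _ dec_inv (fun u : 'rV[R]_a * dec_G1 D => u.1 0 i)).
  exact: dec_inv_continuous.
apply: (@continuous_comp _ _ _ fst (fun v : 'rV[R]_a => v 0 i)); first exact: cvg_fst.
exact: coord_continuous.
Qed.

Lemma dec_inv2_continuous : continuous (fun x => (dec_inv x).2).
Proof.
move=> x; apply: (@continuous_comp _ _ _ dec_inv snd); first exact: dec_inv_continuous.
exact: cvg_snd.
Qed.

Lemma measurable_box u : measurable (in_box u : set (borel G)).
Proof.
rewrite (_ : in_box u = \bigcap_(i in [set: 'I_a])
   ((fun x => (dec_inv x).1 0 i : R) @^-1` `[u.1 0 i, u.1 0 i + 1[%classic) `&`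
   ((fun x => (dec_inv x).2 - u.2) @^-1` H)).
  apply: measurableI; first last.
    apply: open_borel; move: (dec_H_open D); apply: open_comp => x _.
    apply: (@continuous_comp _ _ _ (fun x => (dec_inv x).2) (fun z => z - u.2)).
      exact: dec_inv2_continuous.
    apply: (continuous2_cvg _ (@add_continuous (dec_G1 D) (_, _))); first exact: cvg_id.
    exact: cvg_cst.
  apply: fin_bigcap_measurable => // i _; rewrite -[X in measurable X]setTI.
  exact: (continuous_borel_real (@dec_coord_continuous i)).
apply/seteqP; split=> x /= [h1 h2]; split => // i.
  by move=> _; rewrite /= in_itv /=; exact: h1.
by have := h1 i I; rewrite /= in_itv.
Qed.

Lemma measurable_cell_at alpha : measurable (cell_at D alpha : set (borel G)).
Proof. by rewrite cell_atE; exact: measurable_box. Qed.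

Lemma measurable_cell : measurable (cell D : set (borel G)).
Proof.
rewrite (_ : cell D = in_box 0); first exact: measurable_box.
apply/seteqP; split => x; rewrite cellE /in_box /= subr0 => -[h1 h2]; split => // i;
  by move: (h1 i); rewrite mxE add0r.
Qed.

Lemma haar_cell_at (mu : {measure set (borel G) -> \bar R}) alpha :
  haar_measure mu -> mu (cell D) = 1%E -> mu (cell_at D alpha) = 1%E.
Proof.
by case=> _ muT _ _ <-; apply: muT; exact: measurable_cell.
Qed.

(** The projection of [K] to the second factor meets finitely many cosets of the open
subgroup, and the lattice of the first factor is countable. *)
Lemma compact_cells (K : set G) : compact K -> countable (cell_of @` K).
Proof.
move=> cK.
have cL : compact ((fun x => (dec_inv x).2) @` K).
  apply: continuous_compact => //; apply: continuous_subspaceT; exact: dec_inv2_continuous.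
have [s sP] := compact_translates cL (dec_H_open D) (dec_H0 D).
apply: (@sub_countable _ _ _ ((fun nt => lattice_point nt.1 (coset_rep nt.2)) @`
   [set nt : 'rV[int]_a * dec_G1 D | nt.2 \in s])).
  apply: subset_card_le => _ [x Kx <-].
  have [z zs Hz] := sP (dec_inv x).2 (ex_intro2 _ _ x Kx erefl).
  by exists (int_part (dec_inv x).1, z) => //; rewrite /cell_of /= ((coset_rep_class _ _).2 Hz).
apply: (@sub_countable _ _ _ [set nt : 'rV[int]_a * dec_G1 D | nt.2 \in s]).
  exact: card_image_le.
rewrite (_ : [set nt | _] = [set: 'rV[int]_a] `*` [set` s]); last first.
  by apply/seteqP; split=> x /=; [split|case].
by apply: countableX; [exact: countableP|exact: finite_set_countable].
Qed.
End Cells.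

(** * Norms of families over an arbitrary index set *)

Section EsumNorms.
Variables (R : realType) (T : choiceType) (J : set T).
Local Open Scope ereal_scope.

Lemma esumZ (a : T -> \bar R) (c : R) : (0 <= c)%R -> (forall j, 0 <= a j) ->
  \esum_(j in J) (c%:E * a j) = c%:E * \esum_(j in J) a j.
Proof.
have H (b : T -> \bar R) (t : R) : (0 <= t)%R -> (forall j, 0 <= b j) ->
    \esum_(j in J) (t%:E * b j) <= t%:E * \esum_(j in J) b j.
  move=> t0 b0; apply: ge_ereal_sup => _ [F [finF FJ] <-].
  rewrite -ge0_mule_fsumr//; apply: lee_wpmul2l; first by rewrite lee_fin.
  by apply: esum_ge; exists F.
move=> c0 a0; apply/eqP; rewrite eq_le H//=.
have [->|cn0] := eqVneq c 0%R.
  by rewrite mul0e; apply: esum_ge0 => j _; rewrite mul0e.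
have cp : (0 < c)%R by rewrite lt_neqAle eq_sym cn0.
rewrite -lee_pdivlMl//; apply: le_trans (H _ _ _ _); last 2 first.
- by rewrite invr_ge0.
- by move=> j; rewrite mule_ge0.
by apply: le_esum => j _; rewrite muleA -EFinM mulVf// mul1e.
Qed.

(** Write x + y as (s + t) times the convex combination of x/s and y/t with weights
s/(s+t) and t/(s+t), and use convexity of the power. *)
Lemma powR_convex (q s t x y : R) : (1 <= q)%R -> (0 < s)%R -> (0 < t)%R ->
  (0 <= x)%R -> (0 <= y)%R ->
  ((x + y) `^ q <= (s + t) `^ q * (s / (s + t) * s `^ (- q) * x `^ q +
                                   t / (s + t) * t `^ (- q) * y `^ q))%R.
Proof.
move=> q1 s0 t0 x0 y0.
have st0 : (0 < s + t)%R by exact: addr_gt0.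
have e : (x + y = (s + t) * (s / (s + t) * (x / s) + t / (s + t) * (y / t)))%R.
  by field; rewrite !gt_eqF.
have l0 : (0 <= s / (s + t))%R by rewrite divr_ge0// ltW.
have l1 : (s / (s + t) <= 1)%R by rewrite ler_pdivrMr// mul1r lerDl ltW.
have u0 : (0 <= s / (s + t) * (x / s) + t / (s + t) * (y / t))%R.
  by rewrite addr_ge0// mulr_ge0// divr_ge0// ltW.
rewrite e powRM//; last exact: ltW.
apply: ler_wpM2l; first exact: powR_ge0.
have tE : (t / (s + t) = 1 - s / (s + t))%R by field; rewrite gt_eqF.
have c : ((s / (s + t) * (x / s) + t / (s + t) * (y / t)) `^ q <=
   s / (s + t) * (x / s) `^ q + t / (s + t) * (y / t) `^ q)%R.
  rewrite tE.
  apply: (convex_powR q1 (Itv01 l0 l1)) => /=;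
    by rewrite inE /= in_itv /= andbT divr_ge0// ltW.
apply: (le_trans c); rewrite -!mulrA.
have dE (z u : R) : (0 <= z)%R -> (0 < u)%R -> ((z / u) `^ q = u `^ (- q) * z `^ q)%R.
  move=> z0 up; rewrite powRM//; last by rewrite invr_ge0 ltW.
  by rewrite -(powR_inv1 (ltW up)) -powRrM mulN1r mulrC.
by rewrite !dE.
Qed.

(** Minkowski's inequality in terms of bounds [s] and [t] for the two norms, which
unlike the norms may be taken positive, as [powR_convex] divides by them. *)
Lemma esum_minkowski (a b : T -> \bar R) (q s t : R) : (1 <= q)%R -> (0 < s)%R -> (0 < t)%R ->
  (forall j, 0 <= a j) -> (forall j, 0 <= b j) ->
  \esum_(j in J) a j `^ q <= (s `^ q)%:E -> \esum_(j in J) b j `^ q <= (t `^ q)%:E ->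
  \esum_(j in J) (a j + b j) `^ q <= ((s + t) `^ q)%:E.
Proof.
move=> q1 s0 t0 a0 b0 sa sb; have st0 : (0 < s + t)%R by exact: addr_gt0.
have q0 : (0 < q)%R by exact: lt_le_trans q1.
pose c1 := ((s + t) `^ q * (s / (s + t) * s `^ (- q)))%R.
pose c2 := ((s + t) `^ q * (t / (s + t) * t `^ (- q)))%R.
have c10 : (0 < c1)%R by rewrite /c1 !mulr_gt0// ?powR_gt0 ?invr_gt0.
have c20 : (0 < c2)%R by rewrite /c2 !mulr_gt0// ?powR_gt0 ?invr_gt0.
apply: (@le_trans _ _ (\esum_(j in J) (c1%:E * a j `^ q + c2%:E * b j `^ q))).
  apply: le_esum => j _; move: (a0 j) (b0 j).
  case: (a j) => [x| |]//; case: (b j) => [y| |]//; rewrite ?lee_fin => x0 y0.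
  - by apply: le_trans (powR_convex q1 s0 t0 x0 y0) _; rewrite /c1 /c2 mulrDr !mulrA.
  - by rewrite [+oo `^ q]poweRyr ?gt_eqF// gt0_muley ?lte_fin// addey ?leey.
  - by rewrite [+oo `^ q]poweRyr ?gt_eqF// gt0_muley ?lte_fin// addye ?leey.
  - by rewrite [+oo `^ q]poweRyr ?gt_eqF// !gt0_muley ?lte_fin// addye ?leey.
rewrite esumD; last 2 first.
- by move=> j _; rewrite mule_ge0 ?poweR_ge0// lee_fin ltW.
- by move=> j _; rewrite mule_ge0 ?poweR_ge0// lee_fin ltW.
rewrite esumZ; [|exact: ltW|by move=> j; exact: poweR_ge0].
rewrite esumZ; [|exact: ltW|by move=> j; exact: poweR_ge0].
apply: (@le_trans _ _ (c1%:E * (s `^ q)%:E + c2%:E * (t `^ q)%:E)).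
  by apply: leeD; apply: lee_wpmul2l => //; rewrite lee_fin ltW.
rewrite -!EFinM -EFinD lee_fin /c1 /c2 !powRN.
have sq := powR_gt0 q s0; have tq := powR_gt0 q t0.
by rewrite le_eqVlt; apply/orP; left; apply/eqP; field; rewrite !gt_eqF.
Qed.

Definition lq_norm (q : R) (a : T -> \bar R) : \bar R :=
  (\esum_(j in J) a j `^ q) `^ q^-1.

Lemma lq_norm_ge0 q a : 0 <= lq_norm q a.
Proof. exact: poweR_ge0. Qed.

Lemma esum_poweR_ge0 q (a : T -> \bar R) : 0 <= \esum_(j in J) a j `^ q.
Proof. by apply: esum_ge0 => j _; exact: poweR_ge0. Qed.

Lemma lq_normP (q c : R) a : (0 < q)%R -> (0 <= c)%R ->
  (lq_norm q a <= c%:E) = (\esum_(j in J) a j `^ q <= (c `^ q)%:E).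
Proof.
move=> q0 c0; rewrite /lq_norm; have := esum_poweR_ge0 q a.
set S := \esum_(j in J) _ => S0; have qi : (0 < q^-1)%R by rewrite invr_gt0.
by rewrite !leNgt; congr negb; rewrite poweR_lt_inv// invrK.
Qed.

Lemma lq_norm_le q a b : (0 <= q)%R -> (forall j, J j -> 0 <= a j) ->
  (forall j, J j -> a j <= b j) -> lq_norm q a <= lq_norm q b.
Proof.
move=> q0 a0 ab; apply: poweR_le; [by rewrite invr_ge0|exact: esum_poweR_ge0|].
by apply: le_esum => j Jj; apply: poweR_le => //; [exact: a0|exact: ab].
Qed.

Lemma lq_normZ q (c : R) a : (0 < q)%R -> (0 <= c)%R -> (forall j, 0 <= a j) ->
  lq_norm q (fun j => c%:E * a j) = c%:E * lq_norm q a.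
Proof.
move=> q0 c0 a0; rewrite /lq_norm.
under eq_esum => j _ do rewrite poweRM// poweR_EFin.
rewrite esumZ ?powR_ge0//; last by move=> j; exact: poweR_ge0.
rewrite poweRM ?lee_fin ?powR_ge0//; last exact: esum_poweR_ge0.
by rewrite poweR_EFin -powRrM mulfV ?gt_eqF// powRr1.
Qed.

Lemma lq_normD q a b : (1 <= q)%R -> (forall j, 0 <= a j) -> (forall j, 0 <= b j) ->
  lq_norm q (fun j => a j + b j) <= lq_norm q a + lq_norm q b.
Proof.
move=> q1 a0 b0; have q0 : (0 < q)%R by exact: lt_le_trans q1.
have := lq_norm_ge0 q a; have := lq_norm_ge0 q b.
case E1 : (lq_norm q a) => [s| |]//; case E2 : (lq_norm q b) => [t| |]//; rewrite ?leey//.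
(* The margin [e] makes both bounds positive. *)
rewrite !lee_fin => t0 s0; apply/lee_addgt0Pr => e e0.
rewrite -!EFinD (_ : (s + t + e = (s + e / 2) + (t + e / 2))%R); last by field.
have e2 : (0 < e / 2)%R by rewrite divr_gt0.
have s'0 : (0 < s + e / 2)%R by rewrite ltr_wpDl.
have t'0 : (0 < t + e / 2)%R by rewrite ltr_wpDl.
rewrite lq_normP//; last by rewrite addr_ge0// ltW.
apply: esum_minkowski => //.
- by rewrite -lq_normP ?E1 ?lee_fin ?lerDl// ltW.
- by rewrite -lq_normP ?E2 ?lee_fin ?lerDl// ltW.
Qed.

Lemma lq_norm_fatou (q : R) (a_ : nat -> T -> \bar R) a : (0 < q)%R ->
  (forall j, 0 <= a j) -> (forall n j, 0 <= a_ n j) ->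
  (forall j, a j <= limn_einf (a_ ^~ j)) ->
  lq_norm q a <= limn_einf (fun n => lq_norm q (a_ n)).
Proof.
move=> q0 a0 an0 aa; apply: limn_einf_poweR; first by rewrite invr_gt0.
- exact: esum_poweR_ge0.
- by move=> n; exact: esum_poweR_ge0.
apply: limn_einf_esum; [by move=> j; exact: poweR_ge0|by move=> n j; exact: poweR_ge0|].
by move=> j; exact: limn_einf_poweR.
Qed.
End EsumNorms.

(** * Amalgam norms *)

Section CellNorms.
Variables (R : realType) (G : preTopologicalZmodType) (D : decomposition R G).
Variable mu : {measure set (borel G) -> \bar R}.
Implicit Types X Y : borel G -> R.

Lemma cvg_powR (x_ : nat -> R) (x p : R) : 0 < p -> (forall n, 0 <= x_ n) -> 0 <= x ->
  x_ n @[n --> \oo] --> x -> x_ n `^ p @[n --> \oo] --> x `^ p.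
Proof.
move=> p0 xn0 x0 /cvgrPdist_lt xx; apply/cvgrPdist_le => e e0.
have pK (z : R) : 0 <= z -> (z `^ p^-1) `^ p = z.
  by move=> z0; rewrite -powRrM mulVf ?gt_eqF// powRr1.
have ltp (y z : R) : 0 <= y -> 0 <= z -> y `^ p < z `^ p -> y < z.
  by move=> y0 z0; rewrite !ltNge; apply: contra => zy; apply: ge0_ler_powR; rewrite ?nnegrE// ltW.
have hi : \forall n \near \oo, x_ n `^ p <= x `^ p + e.
  have u0 : 0 <= x `^ p + e by rewrite addr_ge0 ?powR_ge0 ?ltW.
  have xu : 0 < (x `^ p + e) `^ p^-1 - x.
    by rewrite subr_gt0; apply: ltp => //; rewrite ?powR_ge0// pK// ltrDl.
  apply: filterS (xx _ xu) => n; rewrite ltr_norml ltrBlDr => /andP[h _].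
  rewrite -[leRHS]pK//; apply: ge0_ler_powR; rewrite ?nnegrE ?powR_ge0//; first exact: ltW.
  by move: h; rewrite ltrNl opprB ltrBlDr subrK => /ltW.
have lo : \forall n \near \oo, x `^ p - e <= x_ n `^ p.
  have [l0|l0] := leP (x `^ p - e) 0.
    by apply: nearW => n; apply: le_trans l0 _; exact: powR_ge0.
  have xu : 0 < x - (x `^ p - e) `^ p^-1.
    rewrite subr_gt0; apply: ltp => //; rewrite ?powR_ge0// pK//; last exact: ltW.
    by rewrite ltrBlDr ltrDl.
  apply: filterS (xx _ xu) => n; rewrite ltr_norml => /andP[_ h].
  rewrite -[leLHS]pK; last exact: ltW.
  apply: ge0_ler_powR; rewrite ?nnegrE ?powR_ge0//; first exact: ltW.
  by move: h; rewrite ltrD2l ltrN2 => /ltW.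
apply: filterS2 hi lo => n h1 h2; rewrite ler_distl; apply/andP; split.
  by rewrite lerBlDr.
by rewrite -lerBlDr.
Qed.

Definition cell_norm (p : R) (alpha : G) X : \bar R :=
  'N[mu]_p%:E[EFin \o X \_ (cell_at D alpha)]%E.

Definition amal (p q : R) X : \bar R := lq_norm (cell_index D) q (fun alpha => cell_norm p alpha X).

Lemma amalgam_normE p q w f :
  amalgam_norm mu D p q w f = amal p q (fun x => cabs (f x) * w x).
Proof. by []. Qed.

Lemma restrictE X (A : set (borel G)) x : (X \_ A) x = X x * \1_A x.
Proof. by rewrite patchE indicE; case: (_ \in _); rewrite ?mulr1 ?mulr0. Qed.

Lemma measurable_restr X (A : set (borel G)) : measurable A ->
  measurable_fun setT X -> measurable_fun setT (X \_ A).
Proof. by move=> mA mX; apply: (measurable_restrictT X mA).1; exact: measurable_funTS. Qed.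

Lemma restrict_ge0 X (A : set (borel G)) : (forall x, 0 <= X x) -> forall x, 0 <= (X \_ A) x.
Proof. by move=> X0 x; rewrite restrictE mulr_ge0// indicE ler0n. Qed.

Definition cell_power (p : R) (alpha : G) X (x : borel G) : R := (X \_ (cell_at D alpha)) x `^ p.

Lemma cell_power_ge0 p alpha X x : 0 <= cell_power p alpha X x.
Proof. exact: powR_ge0. Qed.

Lemma integral_cell_power_ge0 p alpha X : (0 <= \int[mu]_x (cell_power p alpha X x)%:E)%E.
Proof. by apply: integral_ge0 => x _; rewrite lee_fin cell_power_ge0. Qed.

Lemma measurable_cell_power p alpha X : measurable_fun setT X ->
  measurable_fun setT (cell_power p alpha X).
Proof.
move=> mX; apply: (measurableT_comp (measurable_powR _)).
by apply: measurable_restr => //; exact: measurable_cell_at.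
Qed.

Lemma cell_normE p alpha X : (forall x, 0 <= X x) ->
  cell_norm p alpha X = ((\int[mu]_x (cell_power p alpha X x)%:E) `^ p^-1)%E.
Proof.
move=> X0; rewrite /cell_norm unlock.
have -> : (\int[mu]_x (`|(EFin \o X \_ (cell_at D alpha)) x| `^ p) =
   \int[mu]_x (cell_power p alpha X x)%:E)%E; last by [].
apply: eq_integral => x _; rewrite /= ger0_norm//; exact: restrict_ge0.
Qed.

Lemma cell_norm_ge0 p alpha X : (0 <= cell_norm p alpha X)%E.
Proof. exact: Lnorm_ge0. Qed.

Lemma cell_norm_le p alpha X Y : 0 < p ->
  measurable_fun setT X -> measurable_fun setT Y -> (forall x, 0 <= X x) -> (forall x, 0 <= Y x) ->
  {ae mu, forall x, X x <= Y x} -> (cell_norm p alpha X <= cell_norm p alpha Y)%E.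
Proof.
move=> p0 mX mY X0 Y0 XY.
rewrite (cell_normE _ _ X0) (cell_normE _ _ Y0).
apply: poweR_le; [by rewrite invr_ge0 ltW|exact: integral_cell_power_ge0|].
apply: ae_ge0_le_integral.
- by [].
- by move=> x _; rewrite lee_fin cell_power_ge0.
- by apply/measurable_EFinP; exact: measurable_cell_power.
- by move=> x _; rewrite lee_fin cell_power_ge0.
- by apply/measurable_EFinP; exact: measurable_cell_power.
apply: filterS XY => x XY _; rewrite lee_fin.
apply: ge0_ler_powR; rewrite ?nnegrE ?restrict_ge0//; first exact: ltW.
by rewrite !restrictE ler_wpM2r// indicE ler0n.
Qed.

Lemma cell_normZ p alpha (c : R) X : 0 < p -> 0 <= c ->
  measurable_fun setT X -> (forall x, 0 <= X x) ->
  cell_norm p alpha (fun x => c * X x) = (c%:E * cell_norm p alpha X)%E.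
Proof.
move=> p0 c0 mX X0; have cX0 x : 0 <= c * X x by rewrite mulr_ge0.
rewrite (cell_normE _ _ cX0) (cell_normE _ _ X0).
have -> : (\int[mu]_x (cell_power p alpha (fun x => (c * X x)%R) x)%:E =
    (c `^ p)%:E * \int[mu]_x (cell_power p alpha X x)%:E)%E.
  transitivity (\int[mu]_x ((c `^ p)%:E * (cell_power p alpha X x)%:E))%E.
    apply: eq_integral => x _.
    by rewrite -EFinM -powRM ?restrict_ge0// /cell_power !restrictE mulrA.
  apply: ge0_integralZl_EFin.
  - by [].
  - by move=> x _; rewrite lee_fin cell_power_ge0.
  - by apply/measurable_EFinP; exact: measurable_cell_power.
  - exact: powR_ge0.
rewrite poweRM ?lee_fin ?powR_ge0//; last exact: integral_cell_power_ge0.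
by rewrite poweR_EFin -powRrM mulfV ?gt_eqF// powRr1.
Qed.

Lemma cell_normD p alpha X Y : 1 <= p -> measurable_fun setT X -> measurable_fun setT Y ->
  (cell_norm p alpha (fun x => X x + Y x)%R <= cell_norm p alpha X + cell_norm p alpha Y)%E.
Proof.
move=> p1 mX mY; have mA := measurable_cell_at D alpha.
have e : (fun x => X x + Y x) \_ (cell_at D alpha) =
    (X \_ (cell_at D alpha) \+ Y \_ (cell_at D alpha)).
  by apply/funext => x /=; rewrite !restrictE mulrDl.
by rewrite /cell_norm e; apply: minkowski_EFin => //; exact: measurable_restr.
Qed.

Lemma cell_norm_fatou p alpha (X_ : nat -> borel G -> R) X : 0 < p ->
  (forall n, measurable_fun setT (X_ n)) -> (forall n x, 0 <= X_ n x) ->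
  measurable_fun setT X -> (forall x, 0 <= X x) ->
  {ae mu, forall x, X_ n x @[n --> \oo] --> X x} ->
  (cell_norm p alpha X <= limn_einf (fun n => cell_norm p alpha (X_ n)))%E.
Proof.
move=> p0 mX_ X_0 mX X0 XX.
have -> : (fun n => cell_norm p alpha (X_ n)) =
    (fun n => ((\int[mu]_x (cell_power p alpha (X_ n) x)%:E) `^ p^-1)%E).
  by apply/funext => n; exact: cell_normE.
rewrite (cell_normE _ _ X0).
apply: limn_einf_poweR; first by rewrite invr_gt0.
- exact: integral_cell_power_ge0.
- by move=> n; exact: integral_cell_power_ge0.
apply: fatou_ae.
- by move=> n; exact: measurable_cell_power.
- by move=> n x; exact: powR_ge0.
- exact: measurable_cell_power.
- by move=> x; exact: powR_ge0.
apply: filterS XX => x Xx; apply: cvg_powR => //; [by move=> n; exact: restrict_ge0|exact: restrict_ge0|].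
rewrite restrictE; under eq_fun do rewrite restrictE.
by apply: cvgM => //; exact: cvg_cst.
Qed.

Lemma amal_ge0 p q X : (0 <= amal p q X)%E.
Proof. exact: lq_norm_ge0. Qed.

Lemma amal_le p q X Y : 0 < p -> 0 <= q ->
  measurable_fun setT X -> measurable_fun setT Y -> (forall x, 0 <= X x) -> (forall x, 0 <= Y x) ->
  {ae mu, forall x, X x <= Y x} -> (amal p q X <= amal p q Y)%E.
Proof.
move=> p0 q0 mX mY X0 Y0 XY; apply: lq_norm_le => // alpha _; first exact: cell_norm_ge0.
exact: cell_norm_le.
Qed.

Lemma amalZ p q (c : R) X : 0 < p -> 0 < q -> 0 <= c ->
  measurable_fun setT X -> (forall x, 0 <= X x) ->
  amal p q (fun x => c * X x) = (c%:E * amal p q X)%E.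
Proof.
move=> p0 q0 c0 mX X0; rewrite -lq_normZ//; last by move=> ?; exact: cell_norm_ge0.
by congr lq_norm; apply/funext => alpha; rewrite cell_normZ.
Qed.

Lemma amalD p q X Y : 1 <= p -> 1 <= q -> measurable_fun setT X -> measurable_fun setT Y ->
  (amal p q (fun x => X x + Y x)%R <= amal p q X + amal p q Y)%E.
Proof.
move=> p1 q1 mX mY; apply: le_trans (lq_normD _ q1 _ _).
- apply: lq_norm_le; first exact: le_trans q1.
    by move=> alpha _; exact: cell_norm_ge0.
  by move=> alpha _; exact: cell_normD.
- by move=> alpha; exact: cell_norm_ge0.
- by move=> alpha; exact: cell_norm_ge0.
Qed.

Lemma amal_fatou p q (X_ : nat -> borel G -> R) X : 0 < p -> 0 < q ->
  (forall n, measurable_fun setT (X_ n)) -> (forall n x, 0 <= X_ n x) ->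
  measurable_fun setT X -> (forall x, 0 <= X x) ->
  {ae mu, forall x, X_ n x @[n --> \oo] --> X x} ->
  (amal p q X <= limn_einf (fun n => amal p q (X_ n)))%E.
Proof.
move=> p0 q0 mX_ X_0 mX X0 XX.
apply: (lq_norm_fatou (cell_index D) (a_ := fun n alpha => cell_norm p alpha (X_ n)) q0).
- by move=> alpha; exact: cell_norm_ge0.
- by move=> n alpha; exact: cell_norm_ge0.
- by move=> alpha; exact: cell_norm_fatou.
Qed.
End CellNorms.

(** * Integrals as sums over cells *)

Section CellSums.
Variables (R : realType) (G : topologicalZmodType) (D : decomposition R G).
Variable mu : {measure set (borel G) -> \bar R}.
Hypothesis hG : lca G.
Hypothesis hmu : haar_measure mu.
Hypothesis hmu1 : mu (cell D) = 1%E.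
Implicit Types X Y : borel G -> R.
Local Notation J := (cell_index D).
Local Open Scope ereal_scope.

Lemma le_esum_subset (T : choiceType) (A B : set T) (a : T -> \bar R) :
  A `<=` B -> \esum_(j in A) a j <= \esum_(j in B) a j.
Proof.
move=> AB; apply: ereal_sup_le => _ [F [finF FA] <-]; exists F => //.
by split=> //; exact: subset_trans AB.
Qed.

(** A countable family of cells, finite or not, as a sequence of disjoint sets padded
with empty sets, so that sums over the family become series. *)
Lemma countable_cells (C : set G) : countable C -> C `<=` J ->
  exists F : nat -> set (borel G), [/\ forall k, measurable (F k), trivIset setT F,
    forall k, exists2 alpha, J alpha & F k `<=` cell_at D alpha,
    forall x, (\bigcup_k F k) x <-> C (cell_of D x) &
    forall a : set (borel G) -> \bar R, a set0 = 0 -> (forall A, 0 <= a A) ->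
      \sum_(k <oo) a (F k) = \esum_(alpha in C) a (cell_at D alpha)].
Proof.
move=> /countable_injP[e einj] CJ.
pose F k : set (borel G) := [set x | C (cell_of D x) /\ e (cell_of D x) = k].
have Fe alpha : C alpha -> F (e alpha) = cell_at D alpha.
  move=> Ca; apply/seteqP; split=> x.
    by move=> [Cx /einj]; rewrite !inE => <- //; exact: cell_at_of.
  by move=> /(cell_atP _ (CJ _ Ca)) xa; rewrite /F /= xa.
have F0 k : ~ (e @` C) k -> F k = set0.
  by move=> nk; apply/seteqP; split=> // x [Cx ex]; apply: nk; exists (cell_of D x).
have Fcase k : F k = set0 \/ exists2 alpha, C alpha & F k = cell_at D alpha.
  have [[alpha Ca <-]|nk] := pselect ((e @` C) k); last by left; exact: F0.
  by right; exists alpha => //; exact: Fe.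
exists F; split.
- move=> k; case: (Fcase k) => [->|[alpha _ ->]] //; exact: measurable_cell_at.
- by move=> i j _ _ [x [[_ <-] [_ <-]]].
- move=> k; case: (Fcase k) => [->|[alpha Ca ->]]; last by exists alpha => //; exact: CJ.
  by exists (cell_of D 0%R); [exact: cell_of_index|exact: sub0set].
- by move=> x; split=> [[k _ []]|Cx] //; exists (e (cell_of D x)).
- move=> a a0 age0; rewrite nneseries_esumT//.
  transitivity (\esum_(k in e @` C) a (F k)).
    rewrite [RHS]esum_mkcond; apply: eq_esum => k _.
    by case: ifPn => // /negP nk; rewrite F0 ?a0// => ek; apply: nk; rewrite inE.
  by rewrite esum_image//; apply: eq_esum => alpha Ca; rewrite Fe.
Qed.

Lemma measurable_level X (t : R) : measurable_fun setT X -> measurable ([set x | (t <= X x)%R] : set (borel G)).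
Proof.
move=> mX; have := mX measurableT `[t, +oo[%classic%R (measurable_itv _).
by rewrite setTI; congr measurable; apply/seteqP; split=> x /=; rewrite in_itv /= andbT.
Qed.

Lemma markov_level X (t : R) (A : set (borel G)) : measurable_fun setT X -> (forall x, (0 <= X x)%R) ->
  (0 < t)%R -> measurable A -> (forall x, A x -> (t <= X x)%R) ->
  mu A <= (t^-1)%:E * \int[mu]_(x in A) (X x)%:E.
Proof.
move=> mX X0 t0 mA tX; rewrite lee_pdivlMl// -integral_cst//.
apply: ge0_le_integral => //.
- by move=> x _; rewrite lee_fin ltW.
- by apply/measurable_EFinP; exact: measurable_funTS.
Qed.

Definition meets_countably_many_cells X : Prop := exists C : set G,
  [/\ countable C, C `<=` J & {ae mu, forall x : borel G, ~ C (cell_of D x) -> X x = 0%R}].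

(** The set where [X] is nonzero is the union of the sets where [X] is at least
1/(n+1), and each of these is exhausted by compact sets up to a null set. *)
Lemma finite_levels_sigma_compact X : measurable_fun setT X -> (forall x, (0 <= X x)%R) ->
  (forall n, mu [set x | (n.+1%:R^-1 <= X x)%R] < +oo) ->
  exists K : nat -> set G, (forall i, compact (K i)) /\
    {ae mu, forall x : borel G, (forall i, ~ K i x) -> X x = 0%R}.
Proof.
move=> mX X0 Xfin; pose B n : set (borel G) := [set x | (n.+1%:R^-1 <= X x)%R].
have mB n : measurable (B n) by exact: measurable_level.
have /choice[K KP] n : exists K : nat -> set G, (forall i, compact (K i)) /\
    mu (B n `\` \bigcup_i K i) = 0.
  by have [K [cK _ _ K0]] := haar_compact_exhaustion hG hmu (mB n) (Xfin n); exists K.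
pose f i : nat * nat := odflt (0%N, 0%N) (unpickle i).
exists (fun i => K (f i).1 (f i).2); split=> [i|]; first exact: (KP _).1.
apply: (@negligibleS _ _ _ mu (\bigcup_n (B n `\` \bigcup_i K n i))); last first.
  apply: negligible_bigcup => n; exists (B n `\` \bigcup_i K n i); split=> //; last exact: (KP n).2.
  apply: measurableD => //; apply: bigcupT_measurable => i.
  by apply: lca_compact_borel => //; exact: (KP n).1.
move=> x /= /not_implyP[nK Xn0].
have Xp : (0 < X x)%R by rewrite lt_neqAle X0 andbT eq_sym; apply/eqP.
have [n _ /(_ n (leqnn n)) h] := near_infty_natSinv_lt (PosNum Xp).
exists n => //; split; first exact: ltW.
by move=> [i _ Kx]; apply: (nK (pickle (n, i))); rewrite /f pickleK.
Qed.

Lemma finite_levels_cells X : measurable_fun setT X -> (forall x, (0 <= X x)%R) ->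
  (forall n, mu [set x | (n.+1%:R^-1 <= X x)%R] < +oo) -> meets_countably_many_cells X.
Proof.
move=> mX X0 Xfin; have [K [cK K0]] := finite_levels_sigma_compact mX X0 Xfin.
exists (\bigcup_i (cell_of D @` K i)); split.
- by apply: bigcup_countable => // i _; exact: (compact_cells D (cK i)).
- by move=> _ [i _ [x _ <-]]; exact: cell_of_index.
- by apply: filterS K0 => x Kx nC; apply: Kx => i Kix; apply: nC; exists i => //; exists x.
Qed.

Lemma nnL1_finite_levels X n : (forall x, (0 <= X x)%R) -> nnL1 mu (EFin \o X) ->
  mu [set x | (n.+1%:R^-1 <= X x)%R] < +oo.
Proof.
move=> X0 [/measurable_EFinP mX _ Xfin]; set B := [set x | _].
have mB : measurable (B : set (borel G)) by exact: measurable_level.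
apply: le_lt_trans (markov_level mX X0 (t := n.+1%:R^-1) _ mB _) _ => //.
have B0 : 0 <= \int[mu]_(x in B) (X x)%:E by apply: integral_ge0 => x _; rewrite lee_fin.
rewrite invrK; apply: lte_mul_pinfty => //.
apply: le_lt_trans Xfin; apply: ge0_subset_integral => //.
  exact/measurable_EFinP.
by move=> x _; rewrite lee_fin.
Qed.

Lemma nnL1_cells X : (forall x, (0 <= X x)%R) -> nnL1 mu (EFin \o X) -> meets_countably_many_cells X.
Proof.
move=> X0 XL1; have [/measurable_EFinP mX _ _] := XL1.
by apply: finite_levels_cells => // n; exact: nnL1_finite_levels.
Qed.

Lemma integral_over_cells X (C : set G) : measurable_fun setT X -> (forall x, (0 <= X x)%R) ->
  countable C -> C `<=` J ->
  measurable ([set x | C (cell_of D x)] : set (borel G)) /\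
  \int[mu]_(x in [set x | C (cell_of D x)]) (X x)%:E =
  \esum_(alpha in C) \int[mu]_(x in cell_at D alpha) (X x)%:E.
Proof.
move=> mX X0 cC CJ; have [F [mF tF _ FC Fsum]] := countable_cells cC CJ.
have FE : [set x | C (cell_of D x)] = \bigcup_k F k.
  by apply/seteqP; split=> x; rewrite /= FC.
split; first by rewrite FE; exact: bigcupT_measurable.
rewrite FE -(Fsum (fun A => \int[mu]_(x in A) (X x)%:E)); last 2 first.
- exact: integral_set0.
- by move=> A; apply: integral_ge0 => x _; rewrite lee_fin.
apply: ge0_integral_bigcup => //.
- by apply/measurable_EFinP; exact: measurable_funTS.
- by move=> x _; rewrite lee_fin.
Qed.

(** There may be uncountably many cells, and countable additivity alone does not
compare the integral with the sum.  If the sum is finite it bounds the integral over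
every compact set, as that meets countably many cells.  By inner regularity the
levels of [X] then have finite measure, so [X] lives on countably many cells. *)
Lemma integral_le_cells X : measurable_fun setT X -> (forall x, (0 <= X x)%R) ->
  \int[mu]_x (X x)%:E <= \esum_(alpha in J) \int[mu]_(x in cell_at D alpha) (X x)%:E.
Proof.
move=> mX X0; set S := \esum_(_ in _) _.
have X0' (A : set (borel G)) : forall x, A x -> 0 <= (X x)%:E by move=> x _; rewrite lee_fin.
have mXA (A : set (borel G)) : measurable_fun A (fun x => (X x)%:E).
  by apply/measurable_EFinP; exact: measurable_funTS.
have [->|Sfin] := eqVneq S +oo; first exact: leey.
have {}Sfin : S < +oo by rewrite ltey.
have CS (C : set G) : countable C -> C `<=` J ->
    \int[mu]_(x in [set x | C (cell_of D x)]) (X x)%:E <= S.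
  by move=> cC CJ; have [_ ->] := integral_over_cells mX X0 cC CJ; exact: le_esum_subset.
have KS (K : set G) : compact K -> \int[mu]_(x in K) (X x)%:E <= S.
  move=> cK; have cC := compact_cells D cK.
  have CJ : cell_of D @` K `<=` J by move=> _ [x _ <-]; exact: cell_of_index.
  apply: le_trans (CS _ cC CJ); apply: ge0_subset_integral => //.
  - exact: lca_compact_borel.
  - by have [] := integral_over_cells mX X0 cC CJ.
  - exact: X0'.
  - by move=> x Kx; exists x.
have [] := @finite_levels_cells X mX X0.
  move=> n; set B := [set x | _].
  have mB : measurable (B : set (borel G)) by exact: measurable_level.
  apply: (@le_lt_trans _ _ (n.+1%:R%:E * S)); last first.
    by apply: lte_mul_pinfty => //; rewrite ?lee_fin.
  case: (hmu) => _ _ _ ->//; apply: ge_ereal_sup => _ [K [cK KB] <-].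
  have mK := lca_compact_borel hG cK.
  apply: le_trans (markov_level mX X0 (t := n.+1%:R^-1) _ mK _) _ => //.
  by rewrite invrK; apply: lee_wpmul2l; [rewrite lee_fin|exact: KS].
move=> C [cC CJ C0]; apply: le_trans (CS _ cC CJ).
have [mC _] := integral_over_cells mX X0 cC CJ.
have -> : \int[mu]_x (X x)%:E = \int[mu]_x (((fun x => (X x)%:E) \_ [set x | C (cell_of D x)]) x).
  apply: ae_eq_integral => //.
    exact: (measurable_restrictT _ mC).1.
  apply: filterS C0 => x Cx _; rewrite patchE; case: ifPn => // /negP nC.
  by rewrite Cx// => h; apply: nC; rewrite inE.
by rewrite [leRHS]integral_mkcond.
Qed.

(** Hoelder's inequality on a set of measure 1. *)
Lemma integral_cell_le p alpha X : (1 < p)%R -> measurable_fun setT X -> (forall x, (0 <= X x)%R) ->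
  \int[mu]_(x in cell_at D alpha) (X x)%:E <= cell_norm D mu p alpha X.
Proof.
move=> p1 mX X0; have mA := measurable_cell_at D alpha.
have p0 : (0 < p)%R by exact: lt_trans p1.
have q0 : (0 < 1 - p^-1)%R by rewrite subr_gt0 invf_lt1.
have mI : measurable_fun setT (\1_(cell_at D alpha) : borel G -> R) by exact: measurable_indic.
have := hoelder mu (measurable_restr mA mX) mI p0 (q := (1 - p^-1)^-1%R).
rewrite invr_gt0 invrK => /(_ q0); rewrite addrCA subrr addr0 => /(_ erefl).
have -> : 'N[mu]_((1 - p^-1)^-1)%:E[EFin \o (\1_(cell_at D alpha) : borel G -> R)] = 1.
  rewrite unlock; have -> : \int[mu]_x (`|(EFin \o (\1_(cell_at D alpha) : borel G -> R)) x| `^ (1 - p^-1)^-1)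
     = \int[mu]_x (\1_(cell_at D alpha) x)%:E.
    apply: eq_integral => x _ /=; rewrite indicE; case: (_ \in _); rewrite ?normr1 ?normr0 ?powR1 ?powR0//.
    by rewrite invr_neq0// gt_eqF.
  rewrite integral_indic// setIT; have -> := haar_cell_at alpha hmu hmu1.
  by rewrite poweR_EFin powR1.
rewrite mule1 Lnorm1; apply: le_trans; rewrite [leLHS]integral_mkcond.
apply: ge0_le_integral => //.
- by move=> x _; rewrite patchE; case: ifP; rewrite ?lee_fin.
- by apply: (measurable_restrictT _ mA).1; apply/measurable_EFinP; exact: measurable_funTS.
- apply: measurableT_comp => //; apply/measurable_EFinP; apply: measurable_funM => //.
  exact: measurable_restr.
move=> x _; rewrite /= ger0_norm; last by rewrite mulr_ge0 ?restrict_ge0.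
by rewrite restrictE patchE indicE; case: (_ \in _); rewrite /= ?mulr1 ?mulr0.
Qed.

Lemma amal1E p X : amal D mu p 1 X = \esum_(alpha in J) cell_norm D mu p alpha X.
Proof.
rewrite /amal /lq_norm invr1 poweRe1; last exact: esum_poweR_ge0.
by apply: eq_esum => alpha _; rewrite poweRe1//; exact: cell_norm_ge0.
Qed.

Lemma integral_le_amal1 p X : (1 < p)%R -> measurable_fun setT X -> (forall x, (0 <= X x)%R) ->
  \int[mu]_x (X x)%:E <= amal D mu p 1 X.
Proof.
move=> p1 mX X0; apply: le_trans (integral_le_cells mX X0) _.
by rewrite amal1E; apply: le_esum => alpha _; exact: integral_cell_le.
Qed.

Lemma esum_ge1 (T : choiceType) (A : set T) (a : T -> \bar R) t : (forall j, 0 <= a j) -> A t ->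
  a t <= \esum_(j in A) a j.
Proof.
by move=> a0 At; apply: esum_ge; exists [set t]; rewrite ?fsbig_set1//; split=> // _ ->.
Qed.

Lemma cell_norm_le_amal1 p alpha X : J alpha ->
  cell_norm D mu p alpha X <= amal D mu p 1 X.
Proof.
by move=> Ja; rewrite amal1E; apply: esum_ge1 => // ?; exact: cell_norm_ge0.
Qed.

Lemma integral_cell_power p alpha X : (0 < p)%R -> (forall x, (0 <= X x)%R) ->
  \int[mu]_(x in cell_at D alpha) (X x `^ p)%:E = cell_norm D mu p alpha X `^ p.
Proof.
move=> p0 X0; rewrite cell_normE// -poweRrM mulVf ?gt_eqF// poweRe1; last exact: integral_cell_power_ge0.
rewrite integral_mkcond; apply: eq_integral => x _.
rewrite /cell_power restrictE patchE indicE; case: (_ \in _); rewrite ?mulr1 ?mulr0//.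
by rewrite powR0 ?gt_eqF.
Qed.

(** Each cell norm [z] is at most [c], whence z^p <= c^(p-1) z, and the sum of the cell
norms is again at most [c]. *)
Lemma powR_integral_le_amal1 p X (c : R) : (1 < p)%R -> measurable_fun setT X -> (forall x, (0 <= X x)%R) ->
  amal D mu p 1 X <= c%:E -> \int[mu]_x (X x `^ p)%:E <= (c `^ p)%:E.
Proof.
move=> p1 mX X0 Xc; have p0 : (0 < p)%R by exact: lt_trans p1.
have c0 : (0 <= c)%R by rewrite -lee_fin; apply: le_trans Xc; exact: amal_ge0.
have mXp : measurable_fun setT (fun x => X x `^ p)%R by exact: (measurableT_comp (measurable_powR _)).
have Xp0 x : (0 <= X x `^ p)%R by exact: powR_ge0.
apply: le_trans (integral_le_cells mXp Xp0) _.
apply: (@le_trans _ _ (\esum_(alpha in J) ((c `^ (p - 1))%:E * cell_norm D mu p alpha X))).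
  apply: le_esum => alpha Ja; rewrite integral_cell_power//.
  have := cell_norm_le_amal1 p X Ja => /le_trans/(_ Xc); have := cell_norm_ge0 D mu p alpha X.
  case: (cell_norm D mu p alpha X) => [z| |]//; rewrite !lee_fin => z0 zc.
  have [->|zn0] := eqVneq z 0%R; first by rewrite powR0 ?gt_eqF// mulr0.
  rewrite -(mulr_powRB1 z0 p0) mulrC ler_wpM2r//.
  by apply: ge0_ler_powR; rewrite ?nnegrE ?subr_ge0// ltW.
rewrite esumZ ?powR_ge0//; last by move=> ?; exact: cell_norm_ge0.
rewrite -amal1E; apply: (@le_trans _ _ ((c `^ (p - 1))%:E * c%:E)).
  by apply: lee_wpmul2l => //; rewrite lee_fin powR_ge0.
by rewrite -EFinM mulrC mulr_powRB1.
Qed.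
End CellSums.

(** * Differences of cells *)

Section NeighbourCells.
Variables (R : realType) (G : preTopologicalZmodType) (D : decomposition R G).
Local Notation a := (dec_dim D).
Local Notation J := (cell_index D).

(** As [e] varies, the cells that contain a difference of a point of [gamma] and a point
of [beta]: in each real coordinate the floor of the difference is the difference of the floors,
or one less, and [e] records the coordinates with this borrow. *)
Definition neighbour_cell (beta : G) (e : {ffun 'I_a -> bool}) (gamma : G) : G :=
  cell_of D (gamma - beta - lattice_point (\row_i Posz (e i)) 0).

Lemma neighbour_cellE n t m s e :
  neighbour_cell (lattice_point m s) e (lattice_point n t) =
  lattice_point (n - m - \row_i Posz (e i)) (coset_rep (t - s)).
Proof.
rewrite /neighbour_cell /cell_of !dec_invB !dec_isoK /= subr0; congr lattice_point.
apply/rowP => i; rewrite !mxE -!intrB; exact: intrKfloor.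
Qed.

(** Only the coset component requires care: the representative of t - s determines the
coset of [t], and [t] is itself a representative. *)
Lemma neighbour_cell_inj beta e : J beta -> {in J &, injective (neighbour_cell beta e)}.
Proof.
move=> [m _ [s Ts <-]] _ _ /set_mem[n _ [t Tt <-]] /set_mem[n' _ [t' Tt' <-]].
rewrite -!/(lattice_point _ _) !neighbour_cellE => /lattice_point_inj[/addIr/addIr -> /coset_rep_class].
rewrite opprB addrA subrK => htt; congr dec_iso; congr pair.
transitivity (coset_rep t); last exact: coset_rep_eq.
by apply/esym/coset_rep_eq => //; rewrite subrr; exact: dec_H0.
Qed.

Lemma neighbour_cell_index beta e gamma : J (neighbour_cell beta e gamma).
Proof. exact: cell_of_index. Qed.

Lemma cell_atB gamma beta x y : J gamma -> J beta ->
  cell_at D gamma x -> cell_at D beta y ->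
  exists e, cell_at D (neighbour_cell beta e gamma) (x - y).
Proof.
move=> [n _ [t Tt <-]] [m _ [s Ts <-]]; rewrite -!/(lattice_point _ _) !cell_atE.
rewrite !dec_isoK => -[/= hx Hx] [/= hy Hy].
pose d i : int := Num.floor ((dec_inv D x).1 0 i - (dec_inv D y).1 0 i).
exists [ffun i => d i != n 0 i - m 0 i].
apply/cell_atP; first exact: neighbour_cell_index.
rewrite neighbour_cellE /cell_of dec_invB /=; congr lattice_point; last first.
  apply/coset_rep_class; rewrite (_ : _ - _ - (t - s) =
      ((dec_inv D x).2 - t) - ((dec_inv D y).2 - s)); first exact: dec_HB.
  by rewrite !opprB addrACA [in RHS]addrACA; congr (_ + _); rewrite addrC.
apply/rowP => i; rewrite !mxE -/(d i) ffunE.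
have /andP[x1 x2] := hx i; have /andP[y1 y2] := hy i.
rewrite !mxE in x1 x2 y1 y2.
have /andP[d1 d2] : (d i)%:~R <= (dec_inv D x).1 0 i - (dec_inv D y).1 0 i < (d i + 1)%:~R.
  exact: floor_itv.
have u : d i < n 0 i - m 0 i + 1.
  by rewrite -(ltr_int R) !intrD intrN; lra.
have l : n 0 i - m 0 i - 1 < d i + 1.
  by rewrite -(ltr_int R) !intrD !intrN; move: d2; rewrite intrD; lra.
case: eqP => h /=; first by rewrite subr0.
by lia.
Qed.
End NeighbourCells.

(** * Young inequality for amalgams *)

Section Young.
Variables (R : realType) (G : topologicalZmodType) (D : decomposition R G).
Variable mu : {measure set (borel G) -> \bar R}.
Hypothesis hG : lca G.
Hypothesis hmu : haar_measure mu.
Hypothesis hmu1 : mu (cell D) = 1%E.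
Variable p : R.
Hypothesis p1 : (1 < p)%R.
Implicit Types F H K X : borel G -> R.
Local Notation J := (cell_index D).
Local Notation econv := (@econv R G mu).
Local Open Scope ereal_scope.

Let p0 : (0 < p)%R. Proof. exact: lt_trans p1. Qed.

Definition lp_norm X : \bar R := 'N[mu]_p%:E[EFin \o X].

Lemma lp_normE X : (forall x, (0 <= X x)%R) -> lp_norm X = (\int[mu]_x (X x `^ p)%:E) `^ p^-1.
Proof.
move=> X0; rewrite /lp_norm unlock.
have -> : \int[mu]_x (`|(EFin \o X) x| `^ p) = \int[mu]_x (X x `^ p)%:E; last by [].
by apply: eq_integral => x _; rewrite /= ger0_norm.
Qed.

(** Hoelder's inequality for F = F^(1/p) F^(1/q), with 1/q = 1 - 1/p; equivalently,
convexity of the power for the measure of density [F]. *)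
Lemma econv_holder F K x : measurable_fun setT F -> (forall x, (0 <= F x)%R) ->
  measurable_fun setT K -> (forall x, (0 <= K x)%R) ->
  econv (EFin \o F) (EFin \o K) x `^ p <=
  (\int[mu]_z (F z)%:E) `^ (p - 1) * econv (EFin \o F) (fun z => (K z `^ p)%:E) x.
Proof.
move=> mF F0 mK K0; pose q := ((1 - p^-1)^-1)%R.
have q0 : (0 < q)%R by rewrite invr_gt0 subr_gt0 invf_lt1.
have pq : (p^-1 + q^-1 = 1)%R by rewrite /q invrK addrCA subrr addr0.
have mKx : measurable_fun setT (fun z : borel G => K (x - (z : G))%R).
  exact: (measurableT_comp mK (@measurable_subl _ x)).
have mFr r : measurable_fun setT (fun z => F z `^ r)%R.
  exact: (measurableT_comp (measurable_powR _)).
have := hoelder mu (measurable_funM (mFr p^-1%R) mKx) (mFr q^-1%R) p0 q0 pq.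
rewrite Lnorm1 [X in X <= _](_ : _ = econv (EFin \o F) (EFin \o K) x); last first.
  apply: eq_integral => z _ /=; rewrite ger0_norm; last by rewrite !mulr_ge0 ?powR_ge0.
  rewrite -EFinM mulrAC -powRD ?pq ?powRr1//.
  by rewrite oner_eq0.
set P := 'N[mu]_p%:E[_]; set Q := 'N[mu]_q%:E[_] => eK.
have E0 : 0 <= econv (EFin \o F) (EFin \o K) x.
  by apply: integral_ge0 => z _; rewrite -EFinM lee_fin mulr_ge0.
apply: le_trans (poweR_le (ltW p0) E0 eK) _.
rewrite poweRM ?Lnorm_ge0// muleC; apply: lee_pmul; rewrite ?poweR_ge0//.
  rewrite /Q unlock -poweRrM.
  rewrite (_ : (q^-1 * p = p - 1)%R); last by rewrite /q invrK mulrBl mul1r mulVf// gt_eqF.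
  rewrite [X in X `^ _ <= _](_ : _ = \int[mu]_z (F z)%:E)//.
  apply: eq_integral => z _ /=; rewrite ger0_norm ?powR_ge0//.
  by rewrite -powRrM mulVf ?gt_eqF// powRr1.
rewrite /P unlock -poweRrM mulVf ?gt_eqF// poweRe1; last first.
  by apply: integral_ge0 => z _; exact: poweR_ge0.
rewrite le_eqVlt; apply/orP; left; apply/eqP; apply: eq_integral => z _ /=.
rewrite ger0_norm; last by rewrite mulr_ge0 ?powR_ge0.
by rewrite powRM ?powR_ge0// -powRrM mulVf ?gt_eqF// powRr1.
Qed.

(** Integrate [econv_holder]. *)
Lemma lp_econv_le F K : (forall x, (0 <= F x)%R) -> nnL1 mu (EFin \o F) ->
  measurable_fun setT K -> (forall x, (0 <= K x)%R) -> \int[mu]_x (K x `^ p)%:E < +oo ->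
  \int[mu]_x (econv (EFin \o F) (EFin \o K) x `^ p) <=
  (\int[mu]_z (F z)%:E) `^ p * \int[mu]_x (K x `^ p)%:E.
Proof.
move=> F0 FL1 mK K0 Kfin; have [mFE FE0 Ffin] := FL1.
have mF : measurable_fun setT F by exact/measurable_EFinP.
have KL1 : nnL1 mu (fun x => (K x `^ p)%:E).
  split=> //; first by apply/measurable_EFinP; exact: (measurableT_comp (measurable_powR _)).
  by move=> x; rewrite lee_fin powR_ge0.
have [mKp Kp0 _] := KL1.
have mEK : measurable_fun setT (fun x : borel G => econv (EFin \o F) (fun z => (K z `^ p)%:E) x).
  by apply: measurable_econv.
have mE : measurable_fun setT (fun x : borel G => econv (EFin \o F) (EFin \o K) x).
  by apply: measurable_econv => //; exact/measurable_EFinP.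
have I0 : 0 <= \int[mu]_z (F z)%:E by apply: integral_ge0 => z _; rewrite lee_fin.
apply: (@le_trans _ _ (\int[mu]_x ((\int[mu]_z (F z)%:E) `^ (p - 1) *
    econv (EFin \o F) (fun z => (K z `^ p)%:E) x))).
  apply: ge0_le_integral => //.
  - by move=> x _; exact: poweR_ge0.
  - exact: (measurableT_comp (measurable_poweR _)).
  - exact: measurable_funeM.
  - by move=> x _; exact: econv_holder.
have -> : \int[mu]_x ((\int[mu]_z (F z)%:E) `^ (p - 1) *
    econv (EFin \o F) (fun z => (K z `^ p)%:E) x) =
  (\int[mu]_z (F z)%:E) `^ (p - 1) * (\int[mu]_x econv (EFin \o F) (fun z => (K z `^ p)%:E) x).
  apply: ge0_integralZl => //; last exact: poweR_ge0.
  by move=> x _; exact: econv_ge0.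
have -> : \int[mu]_x econv (EFin \o F) (fun z => (K z `^ p)%:E) x =
   (\int[mu]_z (F z)%:E) * \int[mu]_x (K x `^ p)%:E by exact: integral_econv.
rewrite muleA; apply: lee_wpmul2r; first by apply: integral_ge0 => x _; rewrite lee_fin powR_ge0.
move: I0 Ffin; rewrite /comp; case: (\int[mu]_z (F z)%:E) => [c| |]//; rewrite lee_fin => c0 _.
by rewrite !poweR_EFin -EFinM lee_fin mulrC mulr_powRB1.
Qed.

Lemma lp_norm_sum (I : Type) (s : seq I) (X : I -> borel G -> R) :
  (forall i, measurable_fun setT (X i)) ->
  lp_norm (fun x => \sum_(i <- s) X i x)%R <= \sum_(i <- s) lp_norm (X i).
Proof.
move=> mX; elim: s => [|i s IH].
  rewrite big_nil /lp_norm (_ : _ \o _ = cst 0); last by apply/funext => x /=; rewrite big_nil.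
  by rewrite Lnorm0// gt_eqF.
rewrite big_cons; apply: le_trans (leeD (lexx _) IH).
rewrite /lp_norm (_ : (fun x => _) = (X i \+ (fun x => \sum_(i <- s) X i x))%R); last first.
  by apply/funext => x /=; rewrite big_cons.
apply: minkowski_EFin => //; last exact: ltW.
exact: measurable_sum.
Qed.

Lemma powR_fine_le (x : \bar R) : 0 <= x -> ((fine x `^ p)%R)%:E <= x `^ p.
Proof. by case: x => [x| |]//= _; rewrite ?gt_eqF// leey. Qed.

Lemma lp_norm_fin X : (forall x, (0 <= X x)%R) -> lp_norm X < +oo -> \int[mu]_x (X x `^ p)%:E < +oo.
Proof.
move=> X0; rewrite lp_normE// !ltey; apply: contra => /eqP ->.
by rewrite poweRyr// gt_eqF// invr_gt0.
Qed.

Section SingleCell.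
Variables (F H : borel G -> R) (beta : G).
Hypotheses (F0 : forall x, (0 <= F x)%R) (FL1 : nnL1 mu (EFin \o F)).
Hypotheses (mH : measurable_fun setT H) (H0 : forall x, (0 <= H x)%R).
Hypothesis Jb : J beta.
Hypothesis Fb : forall x, F x != 0%R -> cell_at D beta x.
Hypothesis Hfin : amal D mu p 1 H < +oo.
Local Notation E := (fun x => fine (econv (EFin \o F) (EFin \o H) x)).

(** At a point of [gamma] the convolution with [F], which lives on [beta], involves the
values of [H] on the neighbour cells only; Young's inequality applies to [H] cut off
outside these cells. *)
Lemma cell_norm_econv gamma : J gamma -> cell_norm D mu p gamma E <=
  (\int[mu]_z (F z)%:E) * \sum_(e : {ffun 'I_(dec_dim D) -> bool})
     cell_norm D mu p (neighbour_cell beta e gamma) H.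
Proof.
move=> Jg; have [mFE FE0 Ffin] := FL1.
pose Hc (e : {ffun 'I_(dec_dim D) -> bool}) : borel G -> R := H \_ (cell_at D (neighbour_cell beta e gamma)).
pose H' x : R := (\sum_(e : {ffun 'I_(dec_dim D) -> bool}) Hc e x)%R.
have mHc e : measurable_fun setT (Hc e) by apply: measurable_restr => //; exact: measurable_cell_at.
have Hc0 e x : (0 <= Hc e x)%R by exact: restrict_ge0.
have mH' : measurable_fun setT H' by exact: measurable_sum.
have H'0 x : (0 <= H' x)%R by exact: sumr_ge0.
have mFH : measurable_fun setT (fun x : borel G => econv (EFin \o F) (EFin \o H) x).
  by apply: measurable_econv => //; exact/measurable_EFinP.
have mFH' : measurable_fun setT (fun x : borel G => econv (EFin \o F) (EFin \o H') x).
  by apply: measurable_econv => //; exact/measurable_EFinP.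
have FH0 x : 0 <= econv (EFin \o F) (EFin \o H) x by apply: econv_ge0 => // y; rewrite lee_fin.
have FH'0 x : 0 <= econv (EFin \o F) (EFin \o H') x by apply: econv_ge0 => // y; rewrite lee_fin.
have H'le : lp_norm H' <= \sum_(e : {ffun 'I_(dec_dim D) -> bool})
     cell_norm D mu p (neighbour_cell beta e gamma) H by exact: lp_norm_sum.
have H'fin : \int[mu]_x (H' x `^ p)%:E < +oo.
  apply: lp_norm_fin => //; apply: le_lt_trans H'le _; apply/lte_sum_pinfty => e _.
  apply: le_lt_trans Hfin; apply: cell_norm_le_amal1; exact: neighbour_cell_index.
have Hloc x : cell_at D gamma x ->
    econv (EFin \o F) (EFin \o H) x <= econv (EFin \o F) (EFin \o H') x.
  move=> gx; apply: ge0_le_integral => //.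
  - by move=> z _; rewrite -EFinM lee_fin mulr_ge0.
  - apply: emeasurable_funM => //; apply: (measurable_comp_subl (g := EFin \o H)).
    exact/measurable_EFinP.
  - apply: emeasurable_funM => //; apply: (measurable_comp_subl (g := EFin \o H')).
    exact/measurable_EFinP.
  move=> z _; rewrite -!EFinM lee_fin.
  have [->|Fz] := eqVneq (F z) 0%R; first by rewrite !mul0r.
  apply: ler_wpM2l => //; have [e xze] := cell_atB Jg Jb gx (Fb Fz).
  have e1 : Hc e (x - (z : G))%R = H (x - (z : G))%R by rewrite /Hc patchE mem_set.
  by rewrite /H' (bigD1 e)//= e1 lerDl; exact: sumr_ge0.
have E0 x : (0 <= E x)%R by exact: fine_ge0.
rewrite (cell_normE _ _ _ _ E0).
apply: (@le_trans _ _ ((\int[mu]_z (F z)%:E) * lp_norm H')); last first.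
  by apply: lee_wpmul2l => //; apply: integral_ge0 => z _; rewrite lee_fin.
rewrite lp_normE//.
have -> : \int[mu]_z (F z)%:E = ((\int[mu]_z (F z)%:E) `^ p) `^ p^-1.
  by rewrite -poweRrM mulfV ?gt_eqF// poweRe1//; apply: integral_ge0 => z _; rewrite lee_fin.
rewrite -poweRM ?poweR_ge0//; last by apply: integral_ge0 => z _; rewrite lee_fin powR_ge0.
apply: poweR_le; [by rewrite invr_ge0 ltW|exact: integral_cell_power_ge0|].
apply: le_trans (lp_econv_le F0 FL1 mH' H'0 H'fin).
apply: ge0_le_integral => //.
- by move=> x _; rewrite lee_fin cell_power_ge0.
- apply/measurable_EFinP; apply: measurable_cell_power; exact: measurableT_comp.
- exact: (measurableT_comp (measurable_poweR _)).
move=> x _; rewrite /cell_power patchE; case: ifPn => [|_]; last by rewrite powR0 ?poweR_ge0// gt_eqF.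
rewrite inE => gx; apply: le_trans (powR_fine_le (FH0 x)) _.
by apply: poweR_le => //; [exact: ltW|exact: Hloc].
Qed.

(** For each of the 2^a choices of [e] the neighbour cells of different cells [gamma]
differ, so the sum over [gamma] of the norms of [H] on them is at most the norm of [H]. *)
Lemma amal_econv_cell : amal D mu p 1 E <=
  (2 ^ dec_dim D)%:R%:E * (\int[mu]_z (F z)%:E) * amal D mu p 1 H.
Proof.
rewrite [leLHS]amal1E.
pose c := fine (\int[mu]_z (F z)%:E).
have I0 : 0 <= \int[mu]_z (F z)%:E by apply: integral_ge0 => z _; rewrite lee_fin.
have cE : \int[mu]_z (F z)%:E = c%:E.
  by rewrite fineK// ge0_fin_numE//; have [_ _] := FL1.
have c0 : (0 <= c)%R by exact: fine_ge0.
apply: (@le_trans _ _ (\esum_(gamma in J) (c%:E *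
   \sum_(e : {ffun 'I_(dec_dim D) -> bool}) cell_norm D mu p (neighbour_cell beta e gamma) H))).
  by apply: le_esum => gamma Jg; rewrite -cE; exact: cell_norm_econv.
rewrite esumZ//; last by move=> gamma; apply: sume_ge0 => e _; exact: cell_norm_ge0.
rewrite cE [_ * c%:E]muleC -muleA; apply: lee_wpmul2l; first by rewrite lee_fin.
rewrite esum_sum; last by move=> gamma e _ _; exact: cell_norm_ge0.
apply: (@le_trans _ _ (\sum_(e : {ffun 'I_(dec_dim D) -> bool}) amal D mu p 1 H)).
  apply: lee_sum => e _; rewrite amal1E.
  have inj : set_inj J (neighbour_cell beta e) by exact: neighbour_cell_inj.
  rewrite -(esum_image J (neighbour_cell beta e) (fun g => cell_norm D mu p g H) inj).
  by apply: le_esum_subset => _ [g _ <-]; exact: neighbour_cell_index.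
have hE : amal D mu p 1 H = (fine (amal D mu p 1 H))%:E.
  by rewrite fineK// ge0_fin_numE//; exact: amal_ge0.
rewrite hE sumEFin sumr_const -EFinM lee_fin mulr_natl.
by rewrite cardT -cardE card_ffun card_bool card_ord.
Qed.
End SingleCell.

Lemma amal_sum (E : nat -> borel G -> R) n : (forall k, measurable_fun setT (E k)) ->
  (forall k x, (0 <= E k x)%R) ->
  amal D mu p 1 (fun x => \sum_(0 <= k < n) E k x)%R <= \sum_(0 <= k < n) amal D mu p 1 (E k).
Proof.
move=> mE E0; elim: n => [|n IH].
  rewrite big_nil (_ : (fun x => _) = (fun x => 0 * E 0%N x)%R); last first.
    by apply/funext => x; rewrite big_nil mul0r.
  by rewrite amalZ// mul0e.
rewrite big_nat_recr//= (_ : (fun x => _) = (fun x => \sum_(0 <= k < n) E k x + E n x)%R); last first.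
  by apply/funext => x; rewrite big_nat_recr.
apply: le_trans (amalD _ _ _ _ _ _) _ => //; [exact: ltW|exact: measurable_sum|].
exact: leeD.
Qed.

(** Cut [F] along the countably many cells that it meets.  The bounds of
[amal_econv_cell] are proportional to the integral of the pieces and add up; the
norm of the full sum is at most the lower limit of the norms of partial sums. *)
Lemma amal_econv F H : (forall x, (0 <= F x)%R) -> nnL1 mu (EFin \o F) ->
  measurable_fun setT H -> (forall x, (0 <= H x)%R) -> amal D mu p 1 H < +oo ->
  amal D mu p 1 (fun x => fine (econv (EFin \o F) (EFin \o H) x)) <=
  (2 ^ dec_dim D)%:R%:E * (\int[mu]_z (F z)%:E) * amal D mu p 1 H.
Proof.
move=> F0 FL1 mH H0 Hfin; have [mFE FE0 Ffin] := FL1.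
have mF : measurable_fun setT F by exact/measurable_EFinP.
have HL1 : nnL1 mu (EFin \o H).
  split; [exact/measurable_EFinP|by move=> x; rewrite lee_fin|].
  by apply: le_lt_trans Hfin; exact: integral_le_amal1.
have [C [cC CJ C0]] := nnL1_cells D hG hmu F0 FL1.
have [c [mc tc cJ cCE _]] := countable_cells cC CJ.
pose Fk k x := (F x * \1_(c k) x)%R.
have Fk0 k x : (0 <= Fk k x)%R by rewrite mulr_ge0// indicE ler0n.
have FkL1 k : nnL1 mu (EFin \o Fk k).
  by rewrite (_ : _ \o _ = fun x => (EFin \o F) x * (\1_(c k) x)%:E); [exact: nnL1_restrict|].
have sumFk x : \sum_(k <oo) (EFin \o Fk k) x = (F x * \1_(\bigcup_k c k) x)%:E.
  by rewrite [RHS]EFinM indic_bigcup// -nneseriesMl ?lee_fin.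
have sumFkL1 : nnL1 mu (fun x => \sum_(k <oo) (EFin \o Fk k) x).
  rewrite (_ : (fun x => _) = fun x => (EFin \o F) x * (\1_(\bigcup_k c k) x)%:E).
    by apply: nnL1_restrict => //; exact: bigcupT_measurable.
  by apply/funext => x; rewrite sumFk.
have sumFkE : ae_eq mu setT (EFin \o F) (fun x => \sum_(k <oo) (EFin \o Fk k) x).
  apply: filterS C0 => x Cx _; rewrite sumFk /= indicE.
  case: (boolP (x \in _)) => [_|/negP xc]; first by rewrite mulr1.
  rewrite mulr0 Cx// => h; apply: xc; rewrite inE; exact/cCE.
have Lsum (psi : borel G -> \bar R) : measurable_fun setT psi -> (forall x, 0 <= psi x) ->
    \int[mu]_z ((EFin \o F) z * psi z) = \sum_(k <oo) \int[mu]_z ((EFin \o Fk k) z * psi z).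
  move=> mpsi psi0; have [_ _ LS Le] := nnlinear_integral mu mpsi psi0.
  by rewrite (Le _ _ FL1 sumFkL1 sumFkE) LS.
have econvS x : econv (EFin \o F) (EFin \o H) x = \sum_(k <oo) econv (EFin \o Fk k) (EFin \o H) x.
  apply: (Lsum (fun z => (H (x - (z : G))%R)%:E)); last by move=> z; rewrite lee_fin.
  by apply: (measurable_comp_subl (g := EFin \o H)); exact/measurable_EFinP.
have intS : \int[mu]_z (F z)%:E = \sum_(k <oo) \int[mu]_z (Fk k z)%:E.
  have := Lsum (cst 1) (measurable_cst _) (fun=> lee01).
  have mule1 (X : borel G -> R) : \int[mu]_z ((EFin \o X) z * cst 1 z) = \int[mu]_z (X z)%:E.
    by apply: eq_integral => z _; rewrite mule1.
  by rewrite mule1 => ->; apply: eq_eseriesr => k _; rewrite mule1.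
pose E k x := fine (econv (EFin \o Fk k) (EFin \o H) x).
have ek0 k x : 0 <= econv (EFin \o Fk k) (EFin \o H) x.
  by apply: econv_ge0 => y; rewrite lee_fin.
have E0 k x : (0 <= E k x)%R by exact: fine_ge0.
have mE k : measurable_fun setT (E k : borel G -> R).
  by apply: measurableT_comp => //; apply: measurable_econv => //; exact/measurable_EFinP.
have Esum n : amal D mu p 1 (fun x => \sum_(0 <= k < n) E k x)%R <=
    (2 ^ dec_dim D)%:R%:E * (\int[mu]_z (F z)%:E) * amal D mu p 1 H.
  apply: le_trans (amal_sum _ _ _) _ => //.
  apply: (@le_trans _ _ (\sum_(0 <= k < n)
    ((2 ^ dec_dim D)%:R%:E * (\int[mu]_z (Fk k z)%:E) * amal D mu p 1 H))).
    apply: lee_sum => k _; have [beta Jb cb] := cJ k.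
    apply: (@amal_econv_cell _ _ beta) => // x; apply: contraNP => nb; apply/eqP.
    rewrite /Fk indicE (_ : _ \in _ = false) ?mulr0//.
    by apply/negP; rewrite inE => /cb.
  have amal0 := amal_ge0 D mu p 1 H.
  have I0 (X : borel G -> R) : (forall x, (0 <= X x)%R) -> 0 <= \int[mu]_z (X z)%:E.
    by move=> X0; apply: integral_ge0 => z _; rewrite lee_fin.
  rewrite -ge0_sume_distrl; last by move=> k _; rewrite mule_ge0 ?I0// lee_fin.
  apply: lee_wpmul2r => //; rewrite -ge0_sume_distrr; last by move=> k _; exact: I0.
  apply: lee_wpmul2l; rewrite ?lee_fin//.
  by rewrite intS; apply: nneseries_lim_ge => k _ _; exact: I0.
apply: le_trans (limn_einf_le (nearW _ Esum)).
apply: (@amal_fatou _ _ _ _ _ _ (fun n x => \sum_(0 <= k < n) E k x)%R) => //.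
- by move=> n; exact: measurable_sum.
- by move=> n x; exact: sumr_ge0.
- by apply: measurableT_comp => //; apply: measurable_econv => //; exact/measurable_EFinP.
- by move=> x; apply: fine_ge0; apply: econv_ge0 => y; rewrite lee_fin.
- apply: filterS (nnL1_ae_lty (nnL1_econv hG hmu FL1 HL1)) => x.
  rewrite econvS => xfin.
  have kfin k : econv (EFin \o Fk k) (EFin \o H) x \is a fin_num.
    rewrite ge0_fin_numE//; apply: le_lt_trans xfin.
    apply: le_trans (nneseries_lim_ge k.+1 _) => //.
    by rewrite big_nat_recr//= leeDr// sume_ge0.
  rewrite (_ : (fun n => _) = fine \o (fun n => \sum_(0 <= k < n) econv (EFin \o Fk k) (EFin \o H) x)).
    apply: fine_cvg; rewrite fineK; last by rewrite ge0_fin_numE// nneseries_ge0.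
    by apply: is_cvg_nneseries => k _ _; exact: ek0.
  apply/funext => n; rewrite /= -[LHS]/(fine _%:E) -sumEFin; congr fine.
  by apply: eq_bigr => k _; rewrite fineK.
Qed.
End Young.

(** * Topology of the dual group *)

Section DualTopology.
Variables (R : realType) (G : topologicalZmodType).
Local Notation dualG := (dual R G).
Local Notation Re := complex.Re.
Local Notation Im := complex.Im.

Lemma norm_complexE (z : R[i]) : `|z| = (cabs z)%:C%C.
Proof. by []. Qed.

Lemma char_cabs (chi : dualG) x : cabs (chi x) = 1.
Proof. by case: (chrP chi). Qed.

Lemma char_near (chi : dualG) x (e : R) : 0 < e ->
  \forall y \near x, cabs (chi y - chi x) < e.
Proof.
move=> e0; case: (chrP chi) => _ _ /(_ x) /cvgrPdist_lt /(_ e%:C%C).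
rewrite ltcR => /(_ e0); apply: filterS => y.
by rewrite norm_complexE ltcR cabsB.
Qed.

(** On continuous functions the compact-open topology is that of uniform convergence
on compact sets. *)
Lemma dual_near (chi : dualG) (K : set G) (e : R) : compact K -> 0 < e ->
  nbhs chi [set psi : dualG | forall x, K x -> cabs (psi x - chi x) < e].
Proof.
move=> cK e0.
have h : {compact-open, (@chr R G) @ chi --> (chr chi : G -> R[i]^o)}.
  exact: (@initial_continuous _ _ (@chr R G : dualG -> {compact-open, G -> R[i]^o}) chi).
have ctschi : continuous (chr chi : G -> R[i]^o) by case: (chrP chi).
have {h} := (@fam_cvgP _ _ _ _ _ _).1 ((compact_open_fam_compactP ctschi _).1 h) K cK.
have FF : Filter ((@chr R G : dualG -> {compact-open, G -> R[i]^o}) @ chi) by exact: (@fmap_filter _ _ _ (nbhs chi) (@nbhs_filter dualG chi)).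
move/(_ FF FF [set g : G -> R[i]^o | forall x, K x -> cabs (g x - chi x) < e]); apply.
apply/uniform_nbhs; exists [set ab : R[i]^o * R[i]^o | ball ab.1 e%:C%C ab.2]; split.
  by apply: (@entourage_ball _ R[i]^o (PosNum _)); rewrite ltcR.
move=> g /= hg x Kx; have := hg x Kx.
by rewrite -ball_normE /= norm_complexE ltcR cabsB.
Qed.

Lemma eps_continuous (T : topologicalType) (f : T -> R) :
  (forall x (e : R), 0 < e -> nbhs x [set y | `|f y - f x| < e]) -> continuous f.
Proof.
move=> cf x; apply/cvgrPdist_lt => e e0.
by apply: filterS (cf x e e0) => y /=; rewrite distrC.
Qed.

Lemma dual_eval_continuous (chi : dualG) (x : G) :
  continuous (fun psi : dualG => cabs (psi x - chi x)).
Proof.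
apply: eps_continuous => psi e e0.
apply: filterS (dual_near psi (@compact_set1 _ x) e0) => psi' /(_ x erefl) h.
apply: le_lt_trans (cabs_dist _ _) _.
by rewrite opprB addrA subrK.
Qed.

(** Characters are separated by evaluations.  This makes compact sets of characters
closed, hence Borel. *)
Lemma dual_hausdorff : hausdorff_space dualG.
Proof.
rewrite open_hausdorff => chi psi npsi.
have [x xn] : exists x, psi x - chi x != 0.
  apply: contrapT => h; move/eqP : npsi; apply; apply: dual_eq => x.
  apply/esym/eqP; rewrite -subr_eq0; apply: contraT => hx; exfalso; apply: h.
  by exists x.
pose d := cabs (psi x - chi x); have d0 : 0 < d by rewrite lt_neqAle cabs_ge0 andbT; apply: contra_neq xn => /esym/cabs_eq0.
pose phi (xi : dualG) := cabs (xi x - chi x).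
have cphi : continuous phi by exact: dual_eval_continuous.
exists (phi @^-1` [set y | y < d / 2], phi @^-1` [set y | d / 2 < y]); split => /=.
- by rewrite inE /= /phi subrr cabs0 divr_gt0.
- by rewrite inE /= /phi -/d ltr_pdivrMr// mulr_natr mulr2n ltrDl.
- by move/continuousP : cphi; apply; exact: open_lt.
- by move/continuousP : cphi; apply; exact: open_gt.
- by apply/eqP/seteqP; split => // xi [/= h1 h2]; have := lt_trans h1 h2; rewrite ltxx.
Qed.
End DualTopology.

(** * The Fourier transform *)

Section Fourier.
Variables (R : realType) (G : topologicalZmodType).
Variable mu : {measure set (borel G) -> \bar R}.
Hypothesis hG : lca G.
Hypothesis hmu : haar_measure mu.
Local Notation dualG := (dual R G).
Local Notation Re := complex.Re.
Local Notation Im := complex.Im.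
Local Notation cint := (cintegrable mu).
Implicit Types f g : G -> R[i].

Lemma complex_continuous (H : preTopologicalZmodType) (g : H -> R[i]) :
  (forall x (e : R), 0 < e -> nbhs x [set y | cabs (g y - g x) < e]) -> cmeasurable g.
Proof.
move=> cg; split; apply: continuous_borel_real; apply: eps_continuous => x e e0;
    apply: filterS (cg x e e0) => y; apply: le_lt_trans.
  by apply: le_trans (cabs_Re _); rewrite ReD ReN.
by apply: le_trans (cabs_Im _); rewrite ImD ImN.
Qed.

Lemma cmeasurable_char (chi : dualG) : cmeasurable (fun x => (chi x)^*%C).
Proof.
have [mr mi] : cmeasurable (chi : G -> R[i]).
  by apply: complex_continuous => x e; exact: char_near.
split.
  by rewrite (_ : (fun x => _) = (fun x : borel G => Re (chi x))) //; apply/funext => x; case: (chi x).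
rewrite (_ : (fun x => _) = (fun x : borel G => - Im (chi x))); first exact: measurableT_comp.
by apply/funext => x; case: (chi x).
Qed.

Lemma cabs_mul_char f (chi : dualG) x : cabs (f x * (chi x)^*%C) = cabs (f x).
Proof. by rewrite cabsM cabs_conj char_cabs mulr1. Qed.

Lemma cintegrable_mul_char f (chi : dualG) : cint f -> cint (fun x => f x * (chi x)^*%C).
Proof.
move=> [mf ffin]; split; first by apply: cmeasurableM => //; exact: cmeasurable_char.
by under eq_integral do rewrite cabs_mul_char.
Qed.

Lemma cabs_fourier_le f chi : cint f ->
  ((cabs (fourier mu f chi))%:E <= \int[mu]_x (cabs (f x))%:E)%E.
Proof.
move=> fi; apply: le_trans (cabs_cintegral (cintegrable_mul_char chi fi)) _.
by under eq_integral do rewrite cabs_mul_char.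
Qed.

Lemma fourierD f g chi : cint f -> cint g ->
  fourier mu (fun x => f x + g x) chi = fourier mu f chi + fourier mu g chi.
Proof.
move=> fi gi; rewrite -cintegralD; [|exact: cintegrable_mul_char..].
by congr cintegral; apply/funext => x; rewrite mulrDl.
Qed.

Lemma fourierZ a f chi : cint f -> fourier mu (fun x => a * f x) chi = a * fourier mu f chi.
Proof.
move=> fi; rewrite -cintegralZ; last exact: cintegrable_mul_char.
by congr cintegral; apply/funext => x; rewrite mulrA.
Qed.

Lemma fourierB f g chi : cint f -> cint g ->
  fourier mu (fun x => f x - g x) chi = fourier mu f chi - fourier mu g chi.
Proof.
move=> fi gi; rewrite (_ : (fun x => _) = (fun x => f x + (-1) * g x)).
  by rewrite fourierD ?fourierZ ?mulN1r//; exact: cintegrableZ.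
by apply/funext => x; rewrite mulN1r.
Qed.

Lemma char_conjD (chi : dualG) x y : (chi (x + y))^*%C = (chi x)^*%C * (chi y)^*%C.
Proof. by case: (chrP chi) => -> _ _; case: (chi x) (chi y) => a b [c d]; congr Complex; rewrite /=; ring. Qed.

(** Multiplication by a character commutes with convolution, so the transform of a
convolution is the integral of a convolution, which is multiplicative by
[convolution_repr]. *)
Lemma fourier_convolution f g F : cint f -> cint g -> cint F ->
  {ae mu, forall x : borel G, convolution mu f g x = F x} ->
  forall chi, fourier mu F chi = fourier mu f chi * fourier mu g chi.
Proof.
move=> fi gi Fi FE chi.
have [F' [F'i F'E F'c]] := convolution_repr hG hmu (cintegrable_mul_char chi fi) (cintegrable_mul_char chi gi).
rewrite -F'c; apply: cintegral_ae.
- by have [] := cintegrable_mul_char chi Fi.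
- by case: F'i.
apply: filterS3 FE F'E (convolution_ae_integrable hG hmu fi gi) => x <- <- xi.
rewrite /convolution mulrC -cintegralZ//; congr cintegral; apply/funext => y.
have -> : (chi x)^*%C = (chi y)^*%C * (chi (x - y))^*%C by rewrite -char_conjD addrC subrK.
by ring.
Qed.

Lemma integral_tail (F : borel G -> R) (e : R) : (forall x, 0 <= F x) -> nnL1 mu (EFin \o F) -> 0 < e ->
  exists K : set G, compact K /\ (\int[mu]_x (F x * \1_(~` K) x)%:E <= e%:E)%E.
Proof.
move=> F0 FL1 e0; have [/measurable_EFinP mF _ Ffin] := FL1.
have [K [cK KF]] := finite_levels_sigma_compact hG hmu mF F0 (fun n => nnL1_finite_levels n F0 FL1).
pose L n := \big[setU/set0]_(i < n) K i.
have cL n : compact (L n) by exact: bigsetU_compact.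
pose u n x := (F x * \1_(~` L n) x)%:E.
have mu_ n : measurable_fun setT (u n : borel G -> \bar R).
  apply/measurable_EFinP; apply: measurable_funM => //; apply: measurable_indic.
  by apply: measurableC; exact: lca_compact_borel.
have cv : (\int[mu]_x u n x)%E @[n --> \oo] --> (\int[mu]_x (cst 0%E x))%E.
  have [] // := @dominated_convergence _ _ _ mu setT measurableT u (cst 0%E) (EFin \o F) mu_ (measurable_cst _).
  - apply: filterS KF => x Kx _; apply: cvg_near_cst.
    have [[i Kix]|/forallNP nK] := pselect (exists i, K i x); last first.
      by apply: nearW => n; rewrite /u Kx// mul0r.
    exists i.+1 => // n /= ni; rewrite /u indicE memNset ?mulr0//= => nL; apply: nL.
    by rewrite /L -bigcup_mkord; exists i.
  - apply/integrableP; split; first exact/measurable_EFinP.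
    rewrite (_ : (\int[mu]_x `|(EFin \o F) x| = \int[mu]_x (EFin \o F) x)%E)//.
    by apply: eq_integral => x _; rewrite gee0_abs// lee_fin.
  - apply: aeW => x n _; rewrite /u /= lee_fin ger0_norm ?mulr_ge0// ?indicE ?ler0n//.
    by case: (_ \in _); rewrite ?mulr1 ?mulr0.
move: cv; rewrite integral0 => /fine_cvgP[fin /cvgrPdist_lt/(_ e e0)] ue.
have [n [nfin nlt]] := filter_ex (filterI fin ue); exists (L n); split => //.
rewrite -[leLHS](fineK nfin) lee_fin; apply/ltW/(le_lt_trans _ nlt).
by rewrite sub0r normrN ler_norm.
Qed.

(** Outside a compact set [f] has a small integral; on the compact set nearby characters
are uniformly close. *)
Lemma fourier_continuous f chi (e : R) : cint f -> 0 < e ->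
  nbhs chi [set psi : dualG | cabs (fourier mu f psi - fourier mu f chi) < e].
Proof.
move=> fi e0; have [mf ffin] := fi.
pose c := fine (\int[mu]_x (cabs (f x))%:E)%E.
have I0 : (0 <= \int[mu]_x (cabs (f x))%:E)%E by apply: integral_ge0 => x _; rewrite lee_fin cabs_ge0.
have cE : (\int[mu]_x (cabs (f x))%:E)%E = c%:E by rewrite fineK// ge0_fin_numE.
have c0 : 0 <= c by exact: fine_ge0.
(* Characters differ by at most 2 in modulus, so the tail contributes at most
   2 (e / 4), and the compact part contributes at most e / 4. *)
have e4 : 0 < e / 4 by rewrite divr_gt0.
have [K [cK Ktail]] := integral_tail (fun x => cabs_ge0 (f x)) (modulus_nnL1 fi) e4.
have d0 : 0 < e / (4 * (c + 1)) by rewrite divr_gt0// mulr_gt0// ltr_wpDl.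
apply: filterS (dual_near chi cK d0) => psi Kpsi.
have mK : measurable (~` K : set (borel G)).
  by apply: measurableC; apply: compact_borel => //; case: hG.
have fpi := cintegrable_mul_char psi fi; have fci := cintegrable_mul_char chi fi.
have E : fourier mu f psi - fourier mu f chi =
    cintegral mu (fun x => f x * (psi x)^*%C - f x * (chi x)^*%C).
  rewrite /fourier -[RHS]/(cintegral mu (fun x => f x * (psi x)^*%C + - (f x * (chi x)^*%C))).
  rewrite cintegralD//; last exact: cintegrableN.
  congr (_ + _); rewrite -mulN1r -cintegralZ//; congr cintegral.
  by apply/funext => x; rewrite mulN1r.
change (cabs (fourier mu f psi - fourier mu f chi) < e); rewrite E -lte_fin; apply: le_lt_trans (cabs_cintegral (cintegrableB fpi fci)) _.
have mc : measurable_fun [set: borel G] (fun x : borel G => cabs (f x)) by exact: cmeasurable_cabs.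
pose d := e / (4 * (c + 1)).
apply: (@le_lt_trans _ _ (\int[mu]_x (d%:E * (cabs (f x))%:E + 2%:E * (cabs (f x) * \1_(~` K) x)%:E))%E).
  apply: ge0_le_integral => //.
  - by move=> x _; rewrite lee_fin cabs_ge0.
  - apply/measurable_EFinP; apply: cmeasurable_cabs.
    by have [] := cintegrableB fpi fci.
  - apply: emeasurable_funD; apply: measurable_funeM; apply/measurable_EFinP => //.
    by apply: measurable_funM => //; exact: measurable_indic.
  move=> x _; rewrite -!EFinM -EFinD lee_fin.
  have -> : f x * (psi x)^*%C - f x * (chi x)^*%C = f x * (psi x - chi x)^*%C.
    by rewrite -mulrBr; congr (_ * _); case: (psi x) (chi x) => a b [a' b'] /=; congr Complex; ring.
  rewrite cabsM cabs_conj indicE; case: (boolP (x \in _)) => [_|/negP xK].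
    rewrite mulr1 [2 * _]mulrC; apply: (@le_trans _ _ (cabs (f x) * 2)).
      apply: ler_wpM2l; first exact: cabs_ge0.
      by apply: le_trans (cabsD _ _) _; rewrite cabsN !char_cabs.
    by rewrite lerDr mulr_ge0 ?cabs_ge0// ltW.
  rewrite !mulr0 addr0 mulrC ler_wpM2r ?cabs_ge0// ltW//; apply: Kpsi.
  by apply: contrapT => nK; apply: xK; rewrite inE.
rewrite ge0_integralD//; last 4 first.
- by move=> x _; rewrite -EFinM lee_fin mulr_ge0 ?cabs_ge0// ltW.
- by apply: measurable_funeM; exact/measurable_EFinP.
- by move=> x _; rewrite -EFinM lee_fin !mulr_ge0 ?cabs_ge0// indicE ler0n.
- by apply: measurable_funeM; apply/measurable_EFinP; apply: measurable_funM => //; exact: measurable_indic.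
rewrite ge0_integralZl_EFin//; last 3 first.
- by move=> x _; rewrite lee_fin cabs_ge0.
- exact/measurable_EFinP.
- exact: ltW.
rewrite ge0_integralZl_EFin//; last 2 first.
- by move=> x _; rewrite lee_fin mulr_ge0 ?cabs_ge0// indicE ler0n.
- by apply/measurable_EFinP; apply: measurable_funM => //; exact: measurable_indic.
rewrite cE; apply: (@le_lt_trans _ _ (d%:E * c%:E + 2%:E * (e / 4)%:E)%E).
  by apply: leeD => //; apply: lee_wpmul2l => //; rewrite lee_fin.
rewrite -!EFinM -EFinD lte_fin.
have : d * c <= e / 4.
  rewrite /d invfM mulrA -mulrA -[leRHS]mulr1; apply: ler_wpM2l; first exact: ltW.
  by rewrite ler_pdivrMl ?mulr1 ?lerDl// ltr_wpDl.
lra.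
Qed.

Lemma cmeasurable_fourier f : cint f -> cmeasurable (fourier mu f).
Proof. by move=> fi; apply: complex_continuous => chi e e0; exact: fourier_continuous. Qed.
End Fourier.

(** * The space of functions with a transform in an amalgam *)

Section BanachEq.
Variables (R : realType) (V : lmodType R[i]).

Lemma banach_space_eq (B : set V) (N N' : V -> R) : (forall u, B u -> N u = N' u) ->
  banach_space B N -> banach_space B N'.
Proof.
move=> NE [[B0 Blin] Nge0 NZ ND Ncomp].
have BZ a u : B u -> B (a *: u) by move=> Bu; rewrite -[_ *: _]addr0; exact: Blin.
have BD u v : B u -> B v -> B (u + v) by move=> Bu; rewrite -[u]scale1r; exact: Blin.
have BB u v : B u -> B v -> B (u - v) by move=> Bu Bv; rewrite -scaleN1r; apply: BD => //; exact: BZ.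
split => //.
- by move=> u Bu; rewrite -NE//; exact: Nge0.
- by move=> a u Bu; rewrite -!NE ?NZ//; exact: BZ.
- by move=> u v Bu Bv; rewrite -!NE ?ND//; exact: BD.
move=> s Bs cs; have [] := Ncomp s Bs.
  by move=> e /cs[k kP]; exists k => m n km kn; rewrite NE ?kP//; exact: BB.
by move=> l Bl sl; exists l => //; rewrite (_ : (fun n => _) = fun n => N (s n - l))//;
  apply/funext => n; rewrite NE//; exact: BB.
Qed.
End BanachEq.

Section ASpace.
Variables (R : realType) (G : topologicalZmodType).
Hypothesis hG : lca G.
Variables (D : decomposition R G) (D' : decomposition R (dual R G)).
Variables (mu : {measure set (borel G) -> \bar R}).
Variables (nu : {measure set (borel (dual R G)) -> \bar R}).
Hypotheses (hmu : haar_measure mu) (hmu1 : mu (cell D) = 1%E) (hnu : haar_measure nu).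
Variables (p q r : R).
Hypotheses (hp : 1 < p) (hq : 1 < q) (hr : 1 < r).
Variables (w0 w1 : G -> R) (w2 : dual R G -> R).
Hypotheses (hw0 : beurling_weight mu w0) (hw1 : beurling_weight mu w1).
Hypothesis hw2 : beurling_weight nu w2.
Local Notation cint := (cintegrable mu).
Local Notation fourier := (fourier mu).
Implicit Types f g h : G -> R[i].

Let p0 : 0 < p. Proof. exact: lt_trans hp. Qed.
Let q0 : 0 < q. Proof. exact: lt_trans hq. Qed.
Let r0 : 0 < r. Proof. exact: lt_trans hr. Qed.

Definition time_norm f : \bar R := amalgam_norm mu D p 1 w1 f.
Definition frequency_norm f : \bar R := amalgam_norm nu D' q r w2 (fourier f).
Definition A_fatou_norm f : \bar R := (time_norm f + frequency_norm f)%E.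

Lemma weight_ge0 (H : preTopologicalZmodType) (m : {measure set (borel H) -> \bar R}) (w : H -> R) :
  beurling_weight m w -> forall x, 0 <= w x.
Proof. by case=> _ _ w_gt0 _ _ x; exact: ltW. Qed.

Lemma cabsw_ge0 (H : preTopologicalZmodType) (m : {measure set (borel H) -> \bar R}) (w : H -> R)
    (f : H -> R[i]) : beurling_weight m w -> forall x, 0 <= cabs (f x) * w x.
Proof. by move=> hW x; rewrite mulr_ge0 ?cabs_ge0// (weight_ge0 hW). Qed.

Lemma measurable_cabs_weight (H : preTopologicalZmodType) (m : {measure set (borel H) -> \bar R})
    (w : H -> R) (f : H -> R[i]) : beurling_weight m w -> cmeasurable f ->
  measurable_fun [set: borel H] (fun x : borel H => cabs (f x) * w x).
Proof. by case=> mw _ _ _ _ mf; apply: measurable_funM => //; exact: cmeasurable_cabs. Qed.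

Lemma time_norm_ge0 f : (0 <= time_norm f)%E. Proof. exact: amal_ge0. Qed.
Lemma frequency_norm_ge0 f : (0 <= frequency_norm f)%E. Proof. exact: amal_ge0. Qed.

Lemma amalgam_normZ (H : preTopologicalZmodType) (E : decomposition R H) (m : {measure set (borel H) -> \bar R})
    (s t : R) (w : H -> R) (f : H -> R[i]) (a : R[i]) : 0 < s -> 0 < t ->
  beurling_weight m w -> cmeasurable f ->
  amalgam_norm m E s t w (fun x => a * f x) = ((cabs a)%:E * amalgam_norm m E s t w f)%E.
Proof.
move=> s0 t0 hW mf; rewrite !amalgam_normE -amalZ ?cabs_ge0//.
- by congr amal; apply/funext => x; rewrite cabsM mulrA.
- exact: (measurable_cabs_weight hW).
- exact: (cabsw_ge0 f hW).
Qed.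

Lemma amalgam_normD (H : preTopologicalZmodType) (E : decomposition R H) (m : {measure set (borel H) -> \bar R})
    (s t : R) (w : H -> R) (f g : H -> R[i]) : 1 <= s -> 1 <= t ->
  beurling_weight m w -> cmeasurable f -> cmeasurable g ->
  (amalgam_norm m E s t w (fun x => f x + g x)%R <=
   amalgam_norm m E s t w f + amalgam_norm m E s t w g)%E.
Proof.
move=> s1 t1 hW mf mg; have s0 : 0 < s by exact: lt_le_trans s1.
rewrite !amalgam_normE; apply: le_trans (amalD _ _ s1 t1 _ _); last 2 first.
- exact: (measurable_cabs_weight hW).
- exact: (measurable_cabs_weight hW).
apply: amal_le => //.
- exact: le_trans t1.
- by apply: (measurable_cabs_weight hW); exact: cmeasurableD.
- by apply: measurable_funD; exact: (measurable_cabs_weight hW).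
- exact: (cabsw_ge0 (fun x => f x + g x) hW).
- by move=> x; rewrite addr_ge0// (cabsw_ge0 _ hW).
- by apply: aeW => x; rewrite -mulrDl ler_wpM2r ?(weight_ge0 hW)// cabsD.
Qed.

Lemma amalgam_norm_fatou (H : preTopologicalZmodType) (E : decomposition R H) (m : {measure set (borel H) -> \bar R})
    (s t : R) (w : H -> R) (f_ : nat -> H -> R[i]) (f : H -> R[i]) : 0 < s -> 0 < t ->
  beurling_weight m w -> (forall n, cmeasurable (f_ n)) -> cmeasurable f ->
  {ae m, forall x : borel H, cabs (f_ n x - f x) @[n --> \oo] --> (0 : R)} ->
  (amalgam_norm m E s t w f <= limn_einf (fun n => amalgam_norm m E s t w (f_ n)))%E.
Proof.
move=> s0 t0 hW mf_ mf ff.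
apply: (@amal_fatou _ _ E m s t (fun n x => cabs (f_ n x) * w x) (fun x => cabs (f x) * w x)) => //.
- by move=> n; exact: (measurable_cabs_weight hW).
- by move=> n; exact: (cabsw_ge0 (f_ n) hW).
- exact: (measurable_cabs_weight hW).
- exact: (cabsw_ge0 f hW).
- by apply: filterS ff => x fx; apply: cvgM; [exact: cabs_cvg0|exact: cvg_cst].
Qed.

Lemma integral_le_time_norm f : cmeasurable f -> (\int[mu]_x (cabs (f x))%:E <= time_norm f)%E.
Proof.
move=> mf.
apply: le_trans (integral_le_amal1 hG hmu hmu1 hp (measurable_cabs_weight hw1 mf) (cabsw_ge0 f hw1)).
apply: ge0_le_integral => //.
- by move=> x _; rewrite lee_fin cabs_ge0.
- by apply/measurable_EFinP; exact: cmeasurable_cabs.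
- by apply/measurable_EFinP; exact: (measurable_cabs_weight hw1).
- by move=> x _; rewrite lee_fin ler_peMr ?cabs_ge0//; case: hw1.
Qed.

(** The transform is bounded by the integral of the modulus, so convergence in the
mean implies convergence of the transforms at every character. *)
Lemma A_fatou_normP : fatou_norm mu A_fatou_norm.
Proof.
have mF f : cint f -> cmeasurable (fourier f) by exact: cmeasurable_fourier.
split.
- move=> f [mf _]; apply: le_trans (integral_le_time_norm mf) _.
  by rewrite leeDl// frequency_norm_ge0.
- move=> a f fi; have [mf _] := fi.
  rewrite /A_fatou_norm /time_norm amalgam_normZ// ge0_muleDr ?time_norm_ge0 ?frequency_norm_ge0//.
  congr (_ + _)%E; rewrite /frequency_norm -amalgam_normZ//; last exact: mF.
  by congr amalgam_norm; apply/funext => chi; exact: fourierZ.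
- move=> f g fi gi; have [mf _] := fi; have [mg _] := gi.
  rewrite /A_fatou_norm addeACA; apply: leeD.
    by apply: (amalgam_normD _ (ltW hp) _ hw1).
  rewrite /frequency_norm (_ : fourier _ = (fun chi => fourier f chi + fourier g chi)).
    by apply: (amalgam_normD _ (ltW hq) (ltW hr) hw2); exact: mF.
  by apply/funext => chi; exact: fourierD.
move=> f_ f c fi_ fi ff fL1 fc.
apply: le_trans (limn_einf_le (nearW _ fc)).
apply: limn_einfD; rewrite ?time_norm_ge0 ?frequency_norm_ge0//.
- by move=> n; exact: time_norm_ge0.
- by move=> n; exact: frequency_norm_ge0.
- by apply: amalgam_norm_fatou => // [n|]; [case: (fi_ n)|case: fi].
apply: (amalgam_norm_fatou D' q0 r0 hw2) => [n||]; [exact: mF|exact: mF|].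
apply: aeW => chi; apply/cvgrPdist_le => e e0; have [k kP] := fL1 e e0.
exists k => // n kn; rewrite sub0r normrN ger0_norm ?cabs_ge0// -lee_fin.
rewrite -fourierB//; apply: le_trans (kP n kn); apply: cabs_fourier_le => //.
exact: cintegrableB.
Qed.

Lemma A_fatou_norm_fin f : (A_fatou_norm f < +oo)%E -> time_norm f \is a fin_num /\ frequency_norm f \is a fin_num.
Proof.
have t0 := time_norm_ge0 f; have u0 := frequency_norm_ge0 f.
by move=> fin; split; rewrite ge0_fin_numE//; apply: le_lt_trans fin; rewrite ?leeDl ?leeDr.
Qed.

Lemma time_Lp_loc f : cmeasurable f -> time_norm f \is a fin_num -> Lp_loc mu p f.
Proof.
move=> mf fin; split => // K cK.
have mc := cmeasurable_cabs mf; have mcw := measurable_cabs_weight hw1 mf.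
have mp (X : borel G -> R) : measurable_fun setT X -> measurable_fun setT (fun x => X x `^ p).
  by move=> mX; exact: (measurableT_comp (measurable_powR _)).
have mK := lca_compact_borel hG cK.
apply/integrableP; split.
  by apply/measurable_EFinP; apply: measurable_funTS; exact: mp.
apply: (@le_lt_trans _ _ (\int[mu]_x ((cabs (f x) * w1 x) `^ p)%:E)%E); last first.
  apply: le_lt_trans (powR_integral_le_amal1 (D := D) hG hmu hp mcw (cabsw_ge0 f hw1) (c := fine (time_norm f)) _) _.
    by rewrite fineK.
  exact: ltry.
rewrite (_ : (\int[mu]_(x in K) `|_|)%E = (\int[mu]_(x in K) (cabs (f x) `^ p)%:E)%E); last first.
  by apply: eq_integral => x _; rewrite gee0_abs// lee_fin powR_ge0.
apply: (@le_trans _ _ (\int[mu]_x (cabs (f x) `^ p)%:E)%E).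
  apply: ge0_subset_integral => //; first by apply/measurable_EFinP; exact: mp.
  by move=> x _; rewrite lee_fin powR_ge0.
apply: ge0_le_integral => //.
- by move=> x _; rewrite lee_fin powR_ge0.
- by apply/measurable_EFinP; exact: mp.
- by apply/measurable_EFinP; exact: mp.
move=> x _; rewrite lee_fin; apply: ge0_ler_powR; rewrite ?nnegrE ?cabs_ge0//.
- exact: ltW.
- exact: (cabsw_ge0 f hw1).
- by rewrite ler_peMr ?cabs_ge0//; case: hw1.
Qed.

Lemma fourier_Lp_loc f : cint f -> Lp_loc nu q (fourier f).
Proof.
move=> fi; have mF := cmeasurable_fourier hG hmu fi; split => // K cK.
have mK : measurable (K : set (borel (dual R G))).
  by apply: compact_borel => //; exact: dual_hausdorff.
have mp : measurable_fun setT (fun chi : borel (dual R G) => cabs (fourier f chi) `^ q).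
  by apply: (measurableT_comp (measurable_powR _)); exact: cmeasurable_cabs.
have Kfin : (nu K < +oo)%E by case: hnu => _ _ + _; exact.
have [mf ffin] := fi; pose c := fine (\int[mu]_x (cabs (f x))%:E)%E.
have I0 : (0 <= \int[mu]_x (cabs (f x))%:E)%E by apply: integral_ge0 => x _; rewrite lee_fin cabs_ge0.
have cE : (\int[mu]_x (cabs (f x))%:E)%E = c%:E by rewrite fineK// ge0_fin_numE.
have c0 : 0 <= c by exact: fine_ge0.
apply/integrableP; split; first by apply/measurable_EFinP; exact: measurable_funTS.
apply: (@le_lt_trans _ _ (\int[nu]_(chi in K) (c `^ q)%:E)%E); last first.
  by rewrite integral_cst//; apply: lte_mul_pinfty => //; rewrite lee_fin powR_ge0.
apply: ge0_le_integral => //.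
- by apply: measurableT_comp => //; apply/measurable_EFinP; exact: measurable_funTS.
move=> chi _; rewrite gee0_abs ?lee_fin ?powR_ge0//.
apply: ge0_ler_powR; rewrite ?nnegrE ?cabs_ge0//; first exact: ltW.
by rewrite -lee_fin -cE; exact: cabs_fourier_le.
Qed.

Lemma A_spaceE : A_space mu D nu D' p q r w1 w2 = norm_class A_fatou_norm.
Proof.
apply/seteqP; split=> _ [f [h1 h2] <-]; exists f => //.
  have [[mf _] tfin] := h1; have [_ ffin] := h2.
  split; last exact: lte_add_pinfty.
  by split => //; apply: le_lt_trans (integral_le_time_norm mf) tfin.
have [mf _] := h1; have [tfin ffin] := A_fatou_norm_fin h2.
split; split.
- exact: time_Lp_loc.
- by move: tfin; rewrite ge0_fin_numE// time_norm_ge0.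
- exact: fourier_Lp_loc.
- by move: ffin; rewrite ge0_fin_numE// frequency_norm_ge0.
Qed.

(** [fine] is additive on finite values only; on the class both norms are finite. *)
Lemma A_normE u : norm_class A_fatou_norm u ->
  norm_of A_fatou_norm u = A_norm mu D nu D' p q r w1 w2 u.
Proof.
move=> [f [fi ffin] <-]; have [mf _] := fi; have [mr fr] := mreprP mu mf.
have ri : cint (mrepr (ae_class mu f)).
  by apply: cintegrable_ae fi => //; apply: filterS fr => x ->.
have rf : A_fatou_norm (mrepr (ae_class mu f)) = A_fatou_norm f.
  by apply: (fatou_norm_ae A_fatou_normP).
have [tfin sfin] : time_norm (mrepr (ae_class mu f)) \is a fin_num /\
    frequency_norm (mrepr (ae_class mu f)) \is a fin_num.
  by apply: A_fatou_norm_fin; rewrite rf.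
exact: (fineD tfin sfin).
Qed.

Lemma A_space_banach : banach_space (A_space mu D nu D' p q r w1 w2) (A_norm mu D nu D' p q r w1 w2).
Proof.
rewrite A_spaceE; apply: banach_space_eq (fatou_norm_banach A_fatou_normP) => u; exact: A_normE.
Qed.

Lemma A_space_L1class u : A_space mu D nu D' p q r w1 w2 u -> L1class u.
Proof. by rewrite A_spaceE => -[f [fi _] <-]; exists f. Qed.

Lemma time_norm_conv (C : R) f h F : 0 < C -> (forall x, w1 x <= C * w0 x) ->
  cmeasurable f -> (norm1w mu w0 f < +oo)%E ->
  cmeasurable h -> (time_norm h < +oo)%E -> cmeasurable F ->
  {ae mu, forall x : borel G, convolution mu f h x = F x} ->
  (time_norm F <= (2 ^ dec_dim D)%:R%:E * (C%:E * norm1w mu w0 f) * time_norm h)%E.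
Proof.
move=> C0 wC mf ffin mh hfin mF FE.
pose X x := cabs (f x) * w1 x; pose Y x := cabs (h x) * w1 x.
have X0 : forall x, 0 <= X x by exact: (cabsw_ge0 f hw1).
have Y0 : forall x, 0 <= Y x by exact: (cabsw_ge0 h hw1).
have mX : measurable_fun setT (X : borel G -> R) by exact: (measurable_cabs_weight hw1).
have mY : measurable_fun setT (Y : borel G -> R) by exact: (measurable_cabs_weight hw1).
have Xint : (\int[mu]_x (X x)%:E <= C%:E * norm1w mu w0 f)%E.
  rewrite norm1wE// -ge0_integralZl_EFin//; last 3 first.
  - by move=> x _; rewrite lee_fin (cabsw_ge0 f hw0).
  - by apply/measurable_EFinP; exact: (measurable_cabs_weight hw0).
  - exact: ltW.
  apply: ge0_le_integral => //.
  - by move=> x _; rewrite lee_fin.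
  - exact/measurable_EFinP.
  - by apply: measurable_funeM; apply/measurable_EFinP; exact: (measurable_cabs_weight hw0).
  by move=> x _; rewrite -EFinM lee_fin mulrCA ler_wpM2l ?cabs_ge0.
have XL1 : nnL1 mu (EFin \o X).
  split; [exact/measurable_EFinP|by move=> x; rewrite lee_fin|].
  apply: le_lt_trans Xint _; apply: lte_mul_pinfty => //; last by rewrite lee_fin ltW.
have YL1 : nnL1 mu (EFin \o Y).
  split; [exact/measurable_EFinP|by move=> x; rewrite lee_fin|].
  by apply: le_lt_trans hfin; exact: integral_le_amal1.
have mE : measurable_fun setT (fun x : borel G => fine (econv mu (EFin \o X) (EFin \o Y) x)).
  by apply: measurableT_comp => //; apply: measurable_econv => //; exact/measurable_EFinP.
apply: (@le_trans _ _ (amal D mu p 1 (fun x : borel G => fine (econv mu (EFin \o X) (EFin \o Y) x)))).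
  apply: amal_le => //.
  - exact: (measurable_cabs_weight hw1).
  - exact: (cabsw_ge0 F hw1).
  - by move=> x; apply: fine_ge0; apply: econv_ge0 => y; rewrite lee_fin.
  apply: filterS2 FE (nnL1_ae_lty (nnL1_econv hG hmu XL1 YL1)) => x <- xfin.
  rewrite -lee_fin fineK; first exact: convolution_weight_le.
  by rewrite ge0_fin_numE//; apply: econv_ge0 => y; rewrite lee_fin.
apply: le_trans (amal_econv hG hmu hmu1 hp X0 XL1 mY Y0 hfin) _.
by apply: lee_wpmul2r; [exact: amal_ge0|apply: lee_wpmul2l => //; rewrite lee_fin].
Qed.

Lemma frequency_norm_conv f h F : cint f -> (norm1w mu w0 f < +oo)%E -> cint h -> cint F ->
  {ae mu, forall x : borel G, convolution mu f h x = F x} ->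
  (frequency_norm F <= norm1w mu w0 f * frequency_norm h)%E.
Proof.
move=> fi ffin hi Fi FE; have [mf _] := fi.
have mFh := cmeasurable_fourier hG hmu hi; have mFF := cmeasurable_fourier hG hmu Fi.
have n0 : (0 <= norm1w mu w0 f)%E by exact: Lnorm_ge0.
have nE : norm1w mu w0 f = (fine (norm1w mu w0 f))%:E by rewrite fineK// ge0_fin_numE.
have c0 : 0 <= fine (norm1w mu w0 f) by exact: fine_ge0.
rewrite nE /frequency_norm !amalgam_normE -amalZ//; last 2 first.
- exact: (measurable_cabs_weight hw2).
- exact: (cabsw_ge0 (fourier h) hw2).
apply: amal_le => //.
- exact: ltW.
- exact: (measurable_cabs_weight hw2).
- by apply: measurable_funM => //; exact: (measurable_cabs_weight hw2).
- exact: (cabsw_ge0 (fourier F) hw2).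
- by move=> x; rewrite mulr_ge0// (cabsw_ge0 (fourier h) hw2).
apply: aeW => chi; rewrite (fourier_convolution hG hmu fi hi Fi FE) cabsM mulrA.
apply: ler_wpM2r; first exact: (weight_ge0 hw2).
apply: ler_wpM2r; first exact: cabs_ge0.
rewrite -lee_fin -nE; apply: le_trans (cabs_fourier_le chi fi) _.
by case: (norm1w_fatou_norm hw0) => + _ _ _; apply.
Qed.

(** The two parts of the norm are multiplied by at most 2^a C and 1, respectively. *)
Lemma A_space_module_act (C : R) u v : 0 < C -> (forall x, w1 x <= C * w0 x) ->
  L1w mu w0 u -> A_space mu D nu D' p q r w1 w2 v ->
  A_space mu D nu D' p q r w1 w2 (conv_class mu u v) /\
  A_norm mu D nu D' p q r w1 w2 (conv_class mu u v) <=
  Num.max 1 ((2 ^ dec_dim D)%:R * C) * L1w_norm mu w0 u * A_norm mu D nu D' p q r w1 w2 v.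
Proof.
move=> C0 wC; rewrite L1wE// A_spaceE => -[f [fi ffin] <-] [h [hi hfin] <-].
have [mf _] := fi; have [mh _] := hi.
have [F [Fi FE _]] := convolution_repr hG hmu fi hi; have [mF _] := Fi.
have [tfin sfin] := A_fatou_norm_fin hfin.
have tfin' : (time_norm h < +oo)%E by rewrite -ge0_fin_numE// time_norm_ge0.
have tF := time_norm_conv C0 wC mf ffin mh tfin' mF FE.
have sF := frequency_norm_conv fi ffin hi Fi FE.
have nf0 : (0 <= norm1w mu w0 f)%E by exact: Lnorm_ge0.
have nfE : norm1w mu w0 f = (fine (norm1w mu w0 f))%:E by rewrite fineK// ge0_fin_numE.
pose M := Num.max 1 ((2 ^ dec_dim D)%:R * C).
have bound : (A_fatou_norm F <= (M * fine (norm1w mu w0 f) * fine (A_fatou_norm h))%:E)%E.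
  have c0 : 0 <= fine (norm1w mu w0 f) by exact: fine_ge0.
  have t0 : 0 <= fine (time_norm h) by apply: fine_ge0; exact: time_norm_ge0.
  have s0 : 0 <= fine (frequency_norm h) by apply: fine_ge0; exact: frequency_norm_ge0.
  rewrite {2}/A_fatou_norm (fineD tfin sfin) mulrDr EFinD; apply: leeD.
    apply: le_trans tF _; rewrite nfE -(fineK tfin) -!EFinM lee_fin mulrA.
    by apply: ler_wpM2r => //; apply: ler_wpM2r => //; rewrite le_max lexx orbT.
  apply: le_trans sF _; rewrite nfE -(fineK sfin) -!EFinM lee_fin.
  by apply: ler_wpM2r => //; rewrite ler_peMl// le_max lexx.
have Ffin : (A_fatou_norm F < +oo)%E := le_lt_trans bound (ltry _).
have FA : norm_class A_fatou_norm (ae_class mu F).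
  by exists F; [exact: conj Fi Ffin|].
have hA : norm_class A_fatou_norm (ae_class mu h) by exists h.
rewrite conv_classE// (_ : ae_class mu (convolution mu f h) = ae_class mu F); last exact/ae_class_eqP.
split => //; rewrite -!A_normE//.
rewrite -[L1w_norm mu w0]/(norm_of (norm1w mu w0)) (norm_ofE (norm1w_fatou_norm hw0))//.
rewrite !(norm_ofE A_fatou_normP)// -lee_fin fineK//.
by rewrite ge0_fin_numE//; exact: (fatou_norm_ge0 A_fatou_normP).
Qed.
End ASpace.

Theorem theorem7 (R : realType) (G : topologicalZmodType) (hG : lca G)
  (D : decomposition R G) (D' : decomposition R (dual R G))
  (mu : {measure set (borel G) -> \bar R})
  (nu : {measure set (borel (dual R G)) -> \bar R})
  (hmu : haar_measure mu) (hmu1 : mu (cell D) = 1%E)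
  (hnu : haar_measure nu) (hnu1 : nu (cell D') = 1%E)
  (p q r : R) (hp : 1 < p) (hq : 1 < q) (hr : 1 < r)
  (w0 w1 : G -> R) (w2 : dual R G -> R)
  (hw0 : beurling_weight mu w0) (hw1 : beurling_weight mu w1)
  (hw2 : beurling_weight nu w2)
  (hw : weight_le w1 w0) :
  banach_module
    (L1w mu w0) (L1w_norm mu w0) (conv_class mu)
    (A_space mu D nu D' p q r w1 w2) (A_norm mu D nu D' p q r w1 w2)
    (conv_class mu).
Proof.
have [C C0 wC] := hw.
have act u v := @A_space_module_act _ _ hG D D' mu nu hmu hmu1 hnu p q r hp hq hr
  w0 w1 w2 hw0 hw1 hw2 C u v C0 wC.
have A1 u : A_space mu D nu D' p q r w1 w2 u -> L1class u by exact: A_space_L1class.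
have L1 u : L1w mu w0 u -> L1class u by exact: L1w_L1class.
split.
- split; first exact: L1w_banach_algebra.
  exact: A_space_banach.
- by move=> f h fL hA; case: (act f h fL hA).
- split=> [a f g h /L1 fL /L1 gL /A1 hA|a f h k /L1 fL /A1 hA /A1 kA].
    exact: conv_class_linl.
  exact: conv_class_linr.
- by move=> f g h /L1 fL /L1 gL /A1 hA; exact: conv_classA.
exists (Num.max 1 ((2 ^ dec_dim D)%:R * C)); first by rewrite le_max lexx.
by move=> f h fL hA; case: (act f h fL hA).
Qed.
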